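(* Let $t$ be a rational integer congruent to $5$ or $10$ modulo $27$. If the polynomial $$Y^3-3(t^2-3t+9)Y+(t-6)(t^2-3t+9)$$ is irreducible over $\mathbb{Q}$, then for $y$ a root of it, $\mathbb{Q}(y)$ is a cyclic extension of $\mathbb{Q}$; and if $$\begin{aligned}p(x)={}&x^9+27x^7+9(t^3-5t^2+14t-18)x^6-27(t-1)(t^2-2t+5)(t^2-3t+9)x^5\\&+9(t^2-2t+5)(t^2-3t+9)(t^3-2t^2+5t+12)x^4\\&-3(t^2-3t+9)(10t^2-33t+90)(t^2-2t+5)^2x^3\\&+27(t^2-3t+6)(t^2-2t+5)^2(t^2-3t+9)^2x^2\\&-9(t^2-2t+5)^3(t^2-3t+9)^3x\\&+(t^4-5t^3+27t^2-54t+135)(t^2-3t+9)^2(t^2-2t+5)^3\end{aligned}$$ is likewise irreducible over $\mathbb{Q}$, then the splitting field of $p(x)$ over $K=\mathbb{Q}(\sqrt{-3(t-1)^2-12},\,y)$ is an unramified cyclic extension of $K$.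
   Context: A cyclic extension is a Galois extension with cyclic Galois group. *)

(* Defs.v *)
From HB Require Import structures.
From mathcomp Require Import all_boot all_order all_algebra all_fingroup all_solvable all_field.

Set Implicit Arguments.
Unset Strict Implicit.
Unset Printing Implicit Defensive.

Import Order.TTheory GRing.Theory Num.Theory.
Local Open Scope ring_scope.

Definition cubic_poly (t : int) : {poly rat} :=
  let t : rat := t%:~R in
  let c : rat -> {poly rat} := polyC in
  'X^3 - c (3 * (t ^+ 2 - 3 * t + 9)) * 'X
  + c ((t - 6) * (t ^+ 2 - 3 * t + 9)).

Definition nonic_poly (t : int) : {poly rat} :=
  let t : rat := t%:~R in
  let c : rat -> {poly rat} := polyC in
  'X^9 + c 27 * 'X^7
  + c (9 * (t ^+ 3 - 5 * t ^+ 2 + 14 * t - 18)) * 'X^6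
  - c (27 * (t - 1) * (t ^+ 2 - 2 * t + 5) * (t ^+ 2 - 3 * t + 9)) * 'X^5
  + c (9 * (t ^+ 2 - 2 * t + 5) * (t ^+ 2 - 3 * t + 9)
         * (t ^+ 3 - 2 * t ^+ 2 + 5 * t + 12)) * 'X^4
  - c (3 * (t ^+ 2 - 3 * t + 9) * (10 * t ^+ 2 - 33 * t + 90)
         * (t ^+ 2 - 2 * t + 5) ^+ 2) * 'X^3
  + c (27 * (t ^+ 2 - 3 * t + 6) * (t ^+ 2 - 2 * t + 5) ^+ 2
          * (t ^+ 2 - 3 * t + 9) ^+ 2) * 'X^2
  - c (9 * (t ^+ 2 - 2 * t + 5) ^+ 3 * (t ^+ 2 - 3 * t + 9) ^+ 3) * 'X
  + c ((t ^+ 4 - 5 * t ^+ 3 + 27 * t ^+ 2 - 54 * t + 135)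
         * (t ^+ 2 - 3 * t + 9) ^+ 2 * (t ^+ 2 - 2 * t + 5) ^+ 3).

(* Number fields are represented as subfields of an ambient finite normal
   extension [L] of the rationals, as required by ['Gal(E / K)]. *)

Definition cyclic_extension (L : splittingFieldType rat) (K E : {subfield L}) :
    Prop :=
  galois K E /\ cyclic 'Gal(E / K).

(* Ideals of the ring of integers of [E] are represented as predicates on the
   ambient field, with no decidability assumption. *)
Section Ideals.
Variables (L : fieldExtType rat) (E : {subfield L}).
Implicit Types (I J P : L -> Prop) (x y : L).

Definition ring_of_integers x : Prop :=
  x \in E /\ integralOver (intr : int -> L) x.

Definition integral_ideal I : Prop :=
  [/\ forall x, I x -> ring_of_integers x,
      I 0,
      forall x y, I x -> I y -> I (x + y)
    & forall x y, ring_of_integers x -> I y -> I (x * y)].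

Definition prime_ideal P : Prop :=
  [/\ integral_ideal P,
      ~ P 1
    & forall x y, ring_of_integers x -> ring_of_integers y ->
        P (x * y) -> P x \/ P y].

Definition nonzero_ideal I : Prop := exists2 x, I x & x != 0.

Definition ideal_mul I J : L -> Prop := fun x =>
  exists2 s : seq (L * L),
    forall ab, ab \in s -> I ab.1 /\ J ab.2
    & x = \sum_(ab <- s) ab.1 * ab.2.

Fixpoint ideal_exp P (n : nat) : L -> Prop :=
  if n is n'.+1 then ideal_mul P (ideal_exp P n') else ring_of_integers.

Definition sub_ideal I J : Prop := forall x, I x -> J x.

(* For a prime [P] of [E], the extension to the integers of [E] of the prime of
   [K] lying below [P]. *)
Definition extended_contraction (K : {subfield L}) P : L -> Prop :=
  ideal_mul (fun x => x \in K /\ P x) ring_of_integers.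

(* [e] is the exact power of [P] dividing that extension. *)
Definition ramification_index (K : {subfield L}) P (e : nat) : Prop :=
  sub_ideal (extended_contraction K P) (ideal_exp P e)
  /\ ~ sub_ideal (extended_contraction K P) (ideal_exp P e.+1).

End Ideals.

(* Residue field extensions of number fields are separable, so only the
   ramification indices matter at the finite places. *)
Definition unramified_finite (L : fieldExtType rat) (K E : {subfield L}) : Prop :=
  forall P : L -> Prop, prime_ideal E P -> nonzero_ideal P ->
    ramification_index E K P 1.

(* No real place of [K] becomes complex in [E]. *)
Definition unramified_infinite (L : fieldExtType rat) (K E : {subfield L}) :
    Prop :=
  forall s : {rmorphism subvs_of E -> algC},
    (forall u : subvs_of E, vsval u \in K -> s u \is Num.real) ->
    forall u : subvs_of E, s u \is Num.real.

Definition unramified_extension (L : fieldExtType rat) (K E : {subfield L}) :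
    Prop :=
  [/\ (K <= E)%VS, unramified_finite K E & unramified_infinite K E].

(* Main.v *)
(* Let epsilon^2 = (t - 1) epsilon + 1 and let rho be a root of the simplest cubic
   X^3 + t X^2 + (t - 3) X - 1; put sigma(epsilon) = t - 1 - epsilon and let sigma
   permute the roots of the cubic cyclically. The six units
   phi_k = - sigma^k(rho + epsilon) have product -1, and for
   eta^9 = alpha = phi_0 phi_1^2 phi_2^4 phi_3^8 phi_4^7 phi_5^5 the elements
   eta_0 = eta, eta_1, ..., eta_5 with eta_j^2 = eta_(j+1) times a unit of
   Q(epsilon, rho) give the roots of the nonic as the resolvents
   x_i = sum_j zeta^(i 2^j) eta_j, where zeta is a primitive ninth root of unity
   and i is taken modulo 9. The generators sqrt(-3 (t-1)^2 - 12) and y of K are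
   fixed by exactly those automorphisms that act on zeta, epsilon and rho through
   one power of zeta |-> zeta^5 combined with sigma; these translate the indices i,
   so that Gal(E/K) embeds in Z/9.

   For the finite places, let F = K(zeta, epsilon, rho, eta). If for every g <> 1
   in Gal(F/K) the differences w - g w of integers of F generate the unit ideal,
   then F/K, hence E/K, is unramified. When g moves zeta, these differences yield
   3 together with t^2 - 2 t + 5 or t^2 - 3 t + 9, both prime to 3. When g only
   moves eta, they yield 3, and the congruence alpha b^9 = 1 modulo 27, valid for
   a suitable b in Z[epsilon, rho] when t is 5 or 10 modulo 27, makes the
   idempotents (1/9) sum_i (zeta^j b eta)^i integral, which yields 1. There is no
   real place to consider, since K is imaginary. *)

Require Import Defs.
From HB Require Import structures.
From mathcomp Require Import all_boot all_order all_algebra all_fingroup all_solvable all_field.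
From mathcomp Require Import ring.
From Stdlib Require Import Classical.

Set Implicit Arguments.
Unset Strict Implicit.
Unset Printing Implicit Defensive.

Import Order.TTheory GRing.Theory Num.Theory.
Local Open Scope ring_scope.

(** * Resolvents of the nonic *)

(** The integer -3 (t - 1)^2 - 12 is -3 times the discriminant (t - 1)^2 + 4 of the equation of
    epsilon. So the quadratic generator of K is sqrt(-3) (2 epsilon - (t - 1)), which changes sign
    with either factor; this couples the action on zeta with the action on epsilon. On rho, sigma is
    rho |-> -1 / (1 + rho), the usual cyclic permutation of the roots of a simplest cubic, written
    as a polynomial in rho. K need not contain zeta, so Kummer theory does not apply to E/K
    directly: the Galois action is read off from the indices of the resolvents. The identities
    behind it are proved over an arbitrary field, so that they serve both in [algC], where roots are
    compared, and in number fields, where ideals live. The given ambient field need not contain eta;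
    this forces a passage through [algC] to a larger ambient field, and a descent of unramifiedness
    from there. Ideals are bare predicates, so the criterion for unramifiedness is proved without
    factorization into primes, from traces, maximality of nonzero primes and a determinant
    argument. *)

Section Resolvents.
Variables (F : fieldType) (t : F).
Implicit Types (m : F * F) (h : F).

(* The point m = (epsilon, rho); sextic_conj is the generator sigma, of order 6. *)
Definition sextic_point m :=
  m.1 ^+ 2 = (t - 1) * m.1 + 1 /\ m.2 ^+ 3 = 1 - t * m.2 ^+ 2 - (t - 3) * m.2.

Definition sextic_conj m := (t - 1 - m.1, m.2 ^+ 2 + (t - 1) * m.2 - 2).

Definition conj_unit k m := let m' := iter k sextic_conj m in - (m'.1 + m'.2).

Definition kummer_unit m :=
  conj_unit 0 m * conj_unit 1 m ^+ 2 * conj_unit 2 m ^+ 4 * conj_unit 3 m ^+ 8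
  * conj_unit 4 m ^+ 7 * conj_unit 5 m ^+ 5.

(** The ninth power of this product is the quotient of [kummer_unit m ^+ 2] by the conjugate of
    [kummer_unit m] under sigma^-1. *)
Definition step_unit m := conj_unit 3 m * conj_unit 4 m * conj_unit 5 m.

(* The exponents 1, 2, 4, 8, 7, 5 of kummer_unit are the powers of 2 modulo 9, so
   squaring shifts them up to ninth powers: if h^9 = kummer_unit m, then step maps
   (m, h) to sigma^-1 m with a ninth root of its kummer_unit. *)
Definition step (st : F * F * F) :=
  (iter 5 sextic_conj st.1, st.2 ^+ 2 / step_unit st.1).

Definition kummer_state (st : F * F * F) :=
  sextic_point st.1 /\ st.2 ^+ 9 = kummer_unit st.1.

Definition resolvent (st : F * F * F) := \sum_(j < 6) (iter j step st).2.

Lemma sextic_point_conj m : sextic_point m -> sextic_point (sextic_conj m).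
Proof.
case: m => e r [/= he hr]; split => /=; first by ring: he.
by ring: hr.
Qed.

Lemma iter_sextic_point k m : sextic_point m -> sextic_point (iter k sextic_conj m).
Proof. by move=> hm; elim: k => //= k IH; apply: sextic_point_conj. Qed.

Lemma conj_unitD k l m : conj_unit k (iter l sextic_conj m) = conj_unit (k + l) m.
Proof. by rewrite /conj_unit -iterD. Qed.

Lemma iter2_conj m : sextic_point m ->
  iter 2 sextic_conj m = (m.1, - t - m.2 - (sextic_conj m).2).
Proof. by case: m => e r [/= he hr]; congr (_, _) => /=; [ring|ring: hr]. Qed.

Lemma iter3_conj m : sextic_point m ->
  iter 3 sextic_conj m = (t - 1 - m.1, m.2).
Proof.
move=> hm; rewrite iterS iter2_conj //; case: m hm => e r [/= he hr].
by congr (_, _) => /=; ring: hr.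
Qed.

Lemma iter6_conj m : sextic_point m -> iter 6 sextic_conj m = m.
Proof.
move=> hm; rewrite (iterD 3 3) (iter3_conj hm) iter3_conj /=; last first.
  by rewrite -(iter3_conj hm) /=; do 3!apply: sextic_point_conj.
by case: m {hm} => e r /=; congr (_, _); ring.
Qed.

Lemma conj_unit6 k m : sextic_point m -> conj_unit (k + 6) m = conj_unit k m.
Proof. by move=> hm; rewrite -conj_unitD iter6_conj. Qed.

Lemma conj_unit_mod k m : sextic_point m -> conj_unit k m = conj_unit (k %% 6) m.
Proof.
move=> hm; rewrite {1}(divn_eq k 6) addnC.
elim: (k %/ 6)%N => [|q IH]; first by rewrite addn0.
by rewrite mulSn addnCA addnC conj_unit6.
Qed.

Lemma conj_unitE m : sextic_point m ->
  let e' := t - 1 - m.1 in let r1 := m.2 ^+ 2 + (t - 1) * m.2 - 2 in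
  let r2 := - t - m.2 - r1 in
  [/\ conj_unit 0 m = - (m.1 + m.2), conj_unit 1 m = - (e' + r1)
    & conj_unit 2 m = - (m.1 + r2)] /\
  [/\ conj_unit 3 m = - (e' + m.2), conj_unit 4 m = - (m.1 + r1)
    & conj_unit 5 m = - (e' + r2)].
Proof.
move=> hm e' r1 r2; have hm3 := iter_sextic_point 3 hm.
have D k : conj_unit (k + 3) m = conj_unit k (t - 1 - m.1, m.2).
  by rewrite -conj_unitD iter3_conj.
rewrite -[3%N]/(0 + 3)%N -[4%N]/(1 + 3)%N -[5%N]/(2 + 3)%N !D.
rewrite iter3_conj // in hm3.
rewrite /conj_unit !iter2_conj //=; split; split => //.
by rewrite (_ : t - 1 - (t - 1 - m.1) = m.1) //; ring.
Qed.

Lemma prod_conj_unit m : sextic_point m ->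
  conj_unit 0 m * conj_unit 1 m * conj_unit 2 m * conj_unit 3 m * conj_unit 4 m
  * conj_unit 5 m = -1.
Proof.
move=> hm; have [[-> -> ->] [-> -> ->]] := conj_unitE hm.
by case: m hm => e r [/= he hr]; ring: hr he.
Qed.

Lemma conj_unit_neq0 m k : sextic_point m -> (k < 6)%N -> conj_unit k m != 0.
Proof.
move=> hm lk; apply/eqP => h0; have := prod_conj_unit hm.
by case: k lk h0 => [|[|[|[|[|[|//]]]]]] _ ->; rewrite ?(mul0r, mulr0) => /eqP;
  rewrite eq_sym oppr_eq0 oner_eq0.
Qed.

Ltac field_units hm :=
  move: (conj_unit_neq0 hm (isT : (0 < 6)%N)) (conj_unit_neq0 hm (isT : (1 < 6)%N))
    (conj_unit_neq0 hm (isT : (2 < 6)%N)) (conj_unit_neq0 hm (isT : (3 < 6)%N))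
    (conj_unit_neq0 hm (isT : (4 < 6)%N)) (conj_unit_neq0 hm (isT : (5 < 6)%N));
  move: (conj_unit 0 _) (conj_unit 1 _) (conj_unit 2 _) (conj_unit 3 _)
    (conj_unit 4 _) (conj_unit 5 _) => * ;
  field; do ?[by [] | apply/andP; split].

Lemma step_unit_neq0 m : sextic_point m -> step_unit m != 0.
Proof. by move=> hm; rewrite !mulf_neq0 ?conj_unit_neq0. Qed.

Lemma kummer_state_step st : kummer_state st -> kummer_state (step st).
Proof.
case: st => m h [/= hm hh]; split => /=; first exact: (iter_sextic_point 5).
rewrite expr_div_n -exprM mulnC exprM hh /kummer_unit.
have E k : conj_unit k (iter 5 sextic_conj m) = conj_unit (k + 5) m.
  exact: conj_unitD.
rewrite /= in E; rewrite !E [(0+5)%N]/=.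
rewrite -[(1 + 5)%N]/(0 + 6)%N -[(2 + 5)%N]/(1 + 6)%N -[(3 + 5)%N]/(2 + 6)%N.
rewrite -[(4 + 5)%N]/(3 + 6)%N -[(5 + 5)%N]/(4 + 6)%N !conj_unit6 // /step_unit.
by field_units hm.
Qed.

Lemma kummer_neq0 st : kummer_state st -> st.2 != 0.
Proof.
case=> hm hh; apply/eqP => h0; have : kummer_unit st.1 != 0.
  by rewrite !mulf_neq0 ?expf_neq0 ?conj_unit_neq0.
by rewrite -hh h0 expr0n eqxx.
Qed.

Lemma iter_kummer_state j st : kummer_state st -> kummer_state (iter j step st).
Proof. by move=> hs; elim: j => //= j IH; apply: kummer_state_step. Qed.

Lemma step1 j st : (iter j step st).1 = iter (j * 5) sextic_conj st.1.
Proof. by elim: j => // j IH; rewrite mulSn iterD -IH. Qed.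

Lemma step2S j st : (iter j.+1 step st).2
  = (iter j step st).2 ^+ 2 / step_unit (iter (j * 5) sextic_conj st.1).
Proof. by rewrite -step1. Qed.

Lemma step_unit_iter n m : step_unit (iter n sextic_conj m)
  = conj_unit (3 + n) m * conj_unit (4 + n) m * conj_unit (5 + n) m.
Proof. by rewrite /step_unit !conj_unitD. Qed.

(** Since 2^3 + 1 = 9, the product is h^9 divided by powers of the units; what this leaves of
    [kummer_unit] is each of the six conjugates exactly once. *)
Lemma step_opp st : kummer_state st -> st.2 * (iter 3 step st).2 = -1.
Proof.
case: st => m h hs; rewrite 3!step2S !step_unit_iter /=.
case: hs => /= hm hh.
rewrite -[(3 + 1 * 5)%N]/(2 + 6)%N -[(4 + 1 * 5)%N]/(3 + 6)%N.
rewrite -[(5 + 1 * 5)%N]/(4 + 6)%N -[(3 + 2 * 5)%N]/(1 + 6 + 6)%N.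
rewrite -[(4 + 2 * 5)%N]/(2 + 6 + 6)%N -[(5 + 2 * 5)%N]/(3 + 6 + 6)%N.
rewrite !(conj_unit6 _ hm) !mul0n !addn0.
transitivity (h ^+ 9 / (conj_unit 1 m * conj_unit 2 m ^+ 3 * conj_unit 3 m ^+ 7
   * conj_unit 4 m ^+ 6 * conj_unit 5 m ^+ 4)).
  by move: hh => _; field_units hm.
by rewrite hh /kummer_unit -(prod_conj_unit hm); clear hh; field_units hm.
Qed.

Lemma step6 st : kummer_state st -> iter 6 step st = st.
Proof.
move=> hs; have h3 := iter_kummer_state 3 hs.
have /eqP := step_opp h3; rewrite -iterD -[(3 + 3)%N]/6%N => /eqP h6.
have h0 := step_opp hs; have n3 := kummer_neq0 h3.
rewrite [LHS]surjective_pairing [RHS]surjective_pairing; congr (_, _).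
  by rewrite step1 -[(6 * 5)%N]/(6 + (6 + (6 + (6 + 6))))%N !iterD !iter6_conj //; case: hs.
by apply: (mulfI n3); rewrite h6 mulrC h0.
Qed.

(** The split by parity reflects 2^j modulo 3: twisting by a cube root of unity w multiplies the
    even terms by w and the odd ones by w^2. *)
Definition even_part st := st.2 + (iter 2 step st).2 + (iter 4 step st).2.
Definition even_prod st := - (st.2 * (iter 2 step st).2 * (iter 4 step st).2).

(* Coefficients on the basis 1, W, V of the cubic with root A + B, where A and B
   are the sums of the even and odd terms and W, V minus their products; found by
   elimination, using W V = -1, W^3 = -(t - 1 - e) and V^3 = - e. *)
Let C0 (e X : F) := X ^+ 3 + 9 * X - (54 - 42 * t + 15 * t ^+ 2 - 3 * t ^+ 3).
Let C1 (e X : F) := - (3 * (- 6 + 6 * e + 3 * t - 2 * t * e - t ^+ 2 + t ^+ 2 * e) * X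
  + (- 27 - 63 * e + 6 * t + 42 * t * e - 3 * t ^+ 2 - 23 * t ^+ 2 * e
     + 5 * t ^+ 3 * e - t ^+ 4 * e)).
Let C2 (e X : F) := - (3 * (- 12 - 6 * e + 11 * t + 2 * t * e - 4 * t ^+ 2 - t ^+ 2 * e + t ^+ 3) * X
  + (36 + 63 * e - 99 * t - 42 * t * e + 62 * t ^+ 2 + 23 * t ^+ 2 * e
     - 28 * t ^+ 3 - 5 * t ^+ 3 * e + 6 * t ^+ 4 + t ^+ 4 * e - t ^+ 5)).

Lemma step_units m : sextic_point m ->
  let e := m.1 in let r0 := m.2 in
  let e' := t - 1 - e in let r1 := r0 ^+ 2 + (t - 1) * r0 - 2 in
  let r2 := - t - r0 - r1 in
  let c j := step_unit (iter (j * 5) sextic_conj m) in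
  [/\ c 0 = - ((e' + r0) * (e + r1) * (e' + r2)),
       c 1 = - ((e + r2) * (e' + r0) * (e + r1)) &
       c 2 = - ((e' + r1) * (e + r2) * (e' + r0))] /\
  [/\ c 3 = - ((e + r0) * (e' + r1) * (e + r2)),
       c 4 = - ((e' + r2) * (e + r0) * (e' + r1)) &
       c 5 = - ((e + r1) * (e' + r2) * (e + r0))].
Proof.
move=> hm e r0 e' r1 r2 c.
have [[u0 u1 u2] [u3 u4 u5]] := conj_unitE hm.
have E j : c j = conj_unit ((3 + j * 5) %% 6) m * conj_unit ((4 + j * 5) %% 6) m
                 * conj_unit ((5 + j * 5) %% 6) m.
  by rewrite -!(conj_unit_mod _ hm) /c step_unit_iter.
have -> : c 0 = conj_unit 3 m * conj_unit 4 m * conj_unit 5 m := E 0%N.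
have -> : c 1 = conj_unit 2 m * conj_unit 3 m * conj_unit 4 m := E 1%N.
have -> : c 2 = conj_unit 1 m * conj_unit 2 m * conj_unit 3 m := E 2%N.
have -> : c 3 = conj_unit 0 m * conj_unit 1 m * conj_unit 2 m := E 3%N.
have -> : c 4 = conj_unit 5 m * conj_unit 0 m * conj_unit 1 m := E 4%N.
have -> : c 5 = conj_unit 4 m * conj_unit 5 m * conj_unit 0 m := E 5%N.
rewrite u0 u1 u2 u3 u4 u5 /e /r0 /r2 /r1 /e' /r0 /e.
by split; split; ring.
Qed.

Lemma step_neq0 j st : kummer_state st -> (iter j step st).2 != 0.
Proof. by move=> hs; apply/kummer_neq0/iter_kummer_state. Qed.

Lemma step_relations st : kummer_state st ->
  let n j := (iter j step st).2 in
  let c j := step_unit (iter (j * 5) sextic_conj st.1) in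
  let W := even_prod st in let V := even_prod (step st) in
  [/\ n 0 * n 3 = -1, n 1 * n 4 = -1 & n 2 * n 5 = -1] /\
  [/\ n 0 ^+ 2 = n 1 * c 0, n 1 ^+ 2 = n 2 * c 1, n 2 ^+ 2 = n 3 * c 2
      & n 3 ^+ 2 = n 4 * c 3 /\ n 4 ^+ 2 = n 5 * c 4 /\ n 5 ^+ 2 = n 0 * c 5].
Proof.
move=> hs n c W V.
have opp j : n j * n (j + 3)%N = -1.
  by rewrite /n addnC iterD; apply/step_opp/iter_kummer_state.
have sq j : n j ^+ 2 = n j.+1 * c j.
  rewrite /n step2S mulfVK // /c -step1.
  by apply/step_unit_neq0; case: (iter_kummer_state j hs).
have n6 : n 6 = n 0 by rewrite /n step6.
do 2!split; rewrite ?(opp 0%N) ?(opp 1%N) ?(opp 2%N) ?sq ?n6 //.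
Qed.

Lemma cubic_relation st X : kummer_state st ->
  let A := even_part st in let B := even_part (step st) in
  let W := even_prod st in let V := even_prod (step st) in
  [/\ X ^+ 3 - 3 * (A * B) * X - (A ^+ 3 + B ^+ 3)
      = C0 st.1.1 X + W * C1 st.1.1 X + V * C2 st.1.1 X,
      W * V = -1, W ^+ 3 = 1 - t + st.1.1 & V ^+ 3 = - st.1.1].
Proof.
move=> hs A B W V.
pose n j := (iter j step st).2; pose c j := step_unit (iter (j * 5) sextic_conj st.1).
have [[o0 o1 o2] [s0 s1 s2 [s3 [s4 s5]]]] :
    [/\ n 0 * n 3 = -1, n 1 * n 4 = -1 & n 2 * n 5 = -1] /\
  [/\ n 0 ^+ 2 = n 1 * c 0, n 1 ^+ 2 = n 2 * c 1, n 2 ^+ 2 = n 3 * c 2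
      & n 3 ^+ 2 = n 4 * c 3 /\ n 4 ^+ 2 = n 5 * c 4 /\ n 5 ^+ 2 = n 0 * c 5] := step_relations hs.
have [[hc0 hc1 hc2] [hc3 hc4 hc5]] := step_units hs.1.
rewrite -![step_unit _]/(c _) in hc0 hc1 hc2 hc3 hc4 hc5.
have nz0 : n 0 != 0 by apply: step_neq0.
have eA : A = n 0 + n 2 + n 4 by [].
have eB : B = n 1 + n 3 + n 5 by rewrite /B /even_part -!iterSr.
have eW : W = - (n 0 * n 2 * n 4) by [].
have eV : V = - (n 1 * n 3 * n 5) by rewrite /V /even_prod -!iterSr.
move: A B W V n c eA eB eW eV nz0 o0 o1 o2 s0 s1 s2 s3 s4 s5 hc0 hc1 hc2 hc3 hc4 hc5.
case: hs; case: st => [[e r] h] /= [/= he hr] _ A B W V n c.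
move: (n 0) (n 1) (n 2) (n 3) (n 4) (n 5) (c 0) (c 1) (c 2) (c 3) (c 4) (c 5) => {n c}.
move=> n0 n1 n2 n3 n4 n5 c0 c1 c2 c3 c4 c5.
move=> eA eB eW eV nz0 o0 o1 o2 s0 s1 s2 s3 s4 s5 hc0 hc1 hc2 hc3 hc4 hc5.
(* A product of two consecutive terms is a unit times W or V: writing b = - b^2 f, with f the term
   opposite to b, turns a b into a product of three terms of equal parity. *)
have adj (a b d f g : F) : b * f = -1 -> b ^+ 2 = d * g -> a * b = - (a * d * f) * g.
  move=> bf bb; have -> : - (a * d * f) * g = - a * (d * g) * f by ring.
  rewrite -bb; have -> : - a * b ^+ 2 * f = - (b * f) * (a * b) by ring.
  by rewrite bf; ring.
have p01 : n0 * n1 = W * c1 by rewrite (adj _ _ _ _ _ o1 s1) eW.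
have p12 : n1 * n2 = V * c2 by rewrite (adj _ _ _ _ _ o2 s2) eV.
have p23 : n2 * n3 = W * c3 by rewrite mulrC in o0; rewrite (adj _ _ _ _ _ o0 s3) eW; ring.
have p34 : n3 * n4 = V * c4 by rewrite mulrC in o1; rewrite (adj _ _ _ _ _ o1 s4) eV; ring.
have p45 : n4 * n5 = W * c5 by rewrite mulrC in o2; rewrite (adj _ _ _ _ _ o2 s5) eW; ring.
have p50 : n5 * n0 = V * c0 by rewrite (adj _ _ _ _ _ o0 s0) eV; ring.
have wv : W * V = -1.
  by rewrite eW eV; transitivity ((n0 * n3) * (n1 * n4) * (n2 * n5)); [ring | rewrite o0 o1 o2; ring].
have w2 : W ^+ 2 = - V * c0 * c2 * c4.
  rewrite eW eV; transitivity (n0 ^+ 2 * n2 ^+ 2 * n4 ^+ 2); first ring.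
  by rewrite s0 s2 s4; ring.
have v2 : V ^+ 2 = - W * c1 * c3 * c5.
  rewrite eW eV; transitivity (n1 ^+ 2 * n3 ^+ 2 * n5 ^+ 2); first ring.
  by rewrite s1 s3 s5; ring.
have c024 : c0 * c2 * c4 = 1 - t + e by rewrite hc0 hc2 hc4; ring: he hr.
have c135 : c1 * c3 * c5 = - e by rewrite hc1 hc3 hc5; ring: he hr.
split=> //; last 2 first.
- rewrite exprS w2.
  have -> : W * (- V * c0 * c2 * c4) = - (W * V) * (c0 * c2 * c4) by ring.
  by rewrite wv c024; ring.
- rewrite exprS v2.
  have -> : V * (- W * c1 * c3 * c5) = - (W * V) * (c1 * c3 * c5) by ring.
  by rewrite wv c135; ring.
have AB : A * B = - 3 + W * (c1 + c3 + c5) + V * (c0 + c2 + c4).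
  rewrite eA eB; transitivity (n0 * n3 + n1 * n4 + n2 * n5 + (n0 * n1 + n2 * n3 + n4 * n5)
     + (n1 * n2 + n3 * n4 + n5 * n0)); first ring.
  by rewrite o0 o1 o2 p01 p12 p23 p34 p45 p50; ring.
have AA : A ^+ 3 = W * (c0 * c1 + c2 * c3 + c4 * c5) - 6 * W
   + 3 * (V * (c0 * c2 + c2 * c4 + c4 * c0)) - 3 * (c0 + c2 + c4).
  rewrite eA; transitivity (n0 ^+ 2 * n0 + n2 ^+ 2 * n2 + n4 ^+ 2 * n4
    + 3 * (n0 ^+ 2 * (n2 + n4) + n2 ^+ 2 * (n4 + n0) + n4 ^+ 2 * (n0 + n2))
    + 6 * (n0 * n2 * n4)); first ring.
  have -> : n0 * n2 * n4 = - W by rewrite eW; ring.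
  rewrite s0 s2 s4; transitivity (n0 * n1 * c0 + n2 * n3 * c2 + n4 * n5 * c4
     + 3 * (c0 * (n1 * n2 + n1 * n4) + c2 * (n3 * n4 + n0 * n3) + c4 * (n5 * n0 + n2 * n5)) - 6 * W); first ring.
  by rewrite o0 o1 o2 p01 p12 p23 p34 p45 p50; ring.
have BB : B ^+ 3 = V * (c1 * c2 + c3 * c4 + c5 * c0) - 6 * V
   + 3 * (W * (c1 * c3 + c3 * c5 + c5 * c1)) - 3 * (c1 + c3 + c5).
  rewrite eB; transitivity (n1 ^+ 2 * n1 + n3 ^+ 2 * n3 + n5 ^+ 2 * n5
    + 3 * (n1 ^+ 2 * (n3 + n5) + n3 ^+ 2 * (n5 + n1) + n5 ^+ 2 * (n1 + n3))
    + 6 * (n1 * n3 * n5)); first ring.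
  have -> : n1 * n3 * n5 = - V by rewrite eV; ring.
  rewrite s1 s3 s5; transitivity (n1 * n2 * c1 + n3 * n4 * c3 + n5 * n0 * c5
     + 3 * (c1 * (n2 * n3 + n2 * n5) + c3 * (n4 * n5 + n1 * n4) + c5 * (n0 * n1 + n0 * n3)) - 6 * V); first ring.
  by rewrite o0 o1 o2 p01 p12 p23 p34 p45 p50; ring.
clear eA eB eW eV nz0 o0 o1 o2 s0 s1 s2 s3 s4 s5 p01 p12 p23 p34 p45 p50 adj wv w2 v2 c024 c135.
have e0 : C0 e X = X ^+ 3 + 9 * X + 3 * (c0 + c2 + c4) + 3 * (c1 + c3 + c5).
  by rewrite /C0 hc0 hc2 hc4 hc1 hc3 hc5; ring: he hr.
have e1 : C1 e X = - 3 * (c1 + c3 + c5) * X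
  - (c0 * c1 + c2 * c3 + c4 * c5 - 6 + 3 * (c1 * c3 + c3 * c5 + c5 * c1)).
  by rewrite /C1 hc0 hc2 hc4 hc1 hc3 hc5; ring: he hr.
have e2 : C2 e X = - 3 * (c0 + c2 + c4) * X
  - (c1 * c2 + c3 * c4 + c5 * c0 - 6 + 3 * (c0 * c2 + c2 * c4 + c4 * c0)).
  by rewrite /C2 hc0 hc2 hc4 hc1 hc3 hc5; ring: he hr.
by rewrite e0 e1 e2 AB AA BB; ring.
Qed.

Lemma resolventE st :
  resolvent st = even_part st + even_part (step st).
Proof.
rewrite /resolvent !big_ord_recr big_ord0 /= /even_part -!iterSr /=; ring.
Qed.

Definition twist u (st : F * F * F) := (st.1, u * st.2).

Lemma kummer_state_twist u st : u ^+ 9 = 1 ->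
  kummer_state st -> kummer_state (twist u st).
Proof. by move=> hu [hm hh]; split => //=; rewrite exprMn hu mul1r. Qed.

Lemma iter_step_twist j u st :
  iter j step (twist u st) = twist (u ^+ (2 ^ j)) (iter j step st).
Proof.
elim: j => [|j IH]; first by rewrite expn0 expr1.
by rewrite iterS IH /step /twist /= exprMn -exprM -expnSr mulrA.
Qed.

Lemma resolvent_iter k st : kummer_state st ->
  resolvent (iter k step st) = resolvent st.
Proof.
move=> hs; elim: k => //= k <-.
have hk := iter_kummer_state k hs; move: (iter k step st) hk => s hk.
transitivity (\sum_(j < 5) (iter j.+1 step s).2 + s.2).
  rewrite /resolvent big_ord_recr; congr (_ + _).
    by apply: eq_bigr => j _; rewrite iterSr.
  by rewrite -iterSr step6.
by rewrite /resolvent [RHS]big_ord_recl addrC.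
Qed.

Definition nonic_value X :=
  X ^+ 9 + 27 * X ^+ 7
  + 9 * (t ^+ 3 - 5 * t ^+ 2 + 14 * t - 18) * X ^+ 6
  - 27 * (t - 1) * (t ^+ 2 - 2 * t + 5) * (t ^+ 2 - 3 * t + 9) * X ^+ 5
  + 9 * (t ^+ 2 - 2 * t + 5) * (t ^+ 2 - 3 * t + 9)
         * (t ^+ 3 - 2 * t ^+ 2 + 5 * t + 12) * X ^+ 4
  - 3 * (t ^+ 2 - 3 * t + 9) * (10 * t ^+ 2 - 33 * t + 90)
         * (t ^+ 2 - 2 * t + 5) ^+ 2 * X ^+ 3
  + 27 * (t ^+ 2 - 3 * t + 6) * (t ^+ 2 - 2 * t + 5) ^+ 2
          * (t ^+ 2 - 3 * t + 9) ^+ 2 * X ^+ 2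
  - 9 * (t ^+ 2 - 2 * t + 5) ^+ 3 * (t ^+ 2 - 3 * t + 9) ^+ 3 * X
  + (t ^+ 4 - 5 * t ^+ 3 + 27 * t ^+ 2 - 54 * t + 135)
         * (t ^+ 2 - 3 * t + 9) ^+ 2 * (t ^+ 2 - 2 * t + 5) ^+ 3.

(* The nonic is the norm C0^3 + W^3 C1^3 + V^3 C2^3 - 3 W V C0 C1 C2 of the cubic
   of [cubic_relation], under (W, V) |-> (w W, w^-1 V) with w^3 = 1. *)
Lemma nonic_value_factor z st X : kummer_state st ->
  z ^+ 6 + z ^+ 3 + 1 = 0 ->
  nonic_value X = \prod_(i < 9) (X - resolvent (twist (z ^+ i) st)).
Proof.
move=> hs hz.
have z9 : z ^+ 9 = 1.
  apply/eqP; rewrite -subr_eq0.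
  have -> : z ^+ 9 - 1 = (z ^+ 3 - 1) * (z ^+ 6 + z ^+ 3 + 1) by ring.
  by rewrite hz mulr0.
(* The nine factors are grouped by u = 1, z, z^2. Within a group the twist varies by a cube root of
   unity, which gives the cubic of [cubic_relation] with (W, V) replaced by (u^3 W, u^6 V). *)
have inner u : u ^+ 9 = 1 ->
  (X - resolvent (twist u st)) * (X - resolvent (twist (z ^+ 3 * u) st))
  * (X - resolvent (twist (z ^+ 6 * u) st))
  = C0 st.1.1 X + u ^+ 3 * even_prod st * C1 st.1.1 X + u ^+ 6 * even_prod (step st) * C2 st.1.1 X.
  move=> hu; have hsu := kummer_state_twist hu hs.
  have [eq _ _ _] := cubic_relation X hsu; rewrite /= in eq.
  have E1 : even_prod (twist u st) = u ^+ 3 * even_prod st.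
    rewrite /even_prod !iter_step_twist /=.
    have -> : u ^+ (2 ^ 2) = u ^+ 4 by [].
    have -> : u ^+ (2 ^ 4) = u ^+ 7 by rewrite -[(2 ^ 4)%N]/(9 + 7)%N exprD hu mul1r.
    have -> : u ^+ 3 = u ^+ 9 * u ^+ 3 by rewrite hu mul1r.
    by ring.
  have E2 : even_prod (step (twist u st)) = u ^+ 6 * even_prod (step st).
    rewrite -[step (twist u st)]/(iter 1 step (twist u st)) iter_step_twist.
    rewrite /even_prod !iter_step_twist /= -exprM -exprM.
    have -> : u ^+ (2 ^ 1 * 2 ^ 2) = u ^+ 8 by [].
    have -> : u ^+ (2 ^ 1 * 2 ^ 4) = u ^+ 5 by rewrite -[(2 ^ 1 * 2 ^ 4)%N]/(9 + (9 + (9 + 5)))%N !exprD hu !mul1r.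
    have -> : u ^+ (2 ^ 1) = u ^+ 2 by [].
    have -> : u ^+ 6 = u ^+ 9 * u ^+ 6 by rewrite hu mul1r.
    by ring.
  rewrite E1 E2 in eq; rewrite -eq.
  have T w : twist (w * u) st = twist w (twist u st) by rewrite /twist /= mulrA.
  rewrite !T; move: (twist u st) => s {eq E1 E2 T}.
  have T w : w ^+ 3 = 1 -> resolvent (twist w s) = w * even_part s + w ^+ 2 * even_part (step s).
    move=> hw; rewrite resolventE -[step (twist w s)]/(iter 1 step (twist w s)) iter_step_twist.
    rewrite /even_part !iter_step_twist /= -exprM -exprM.
    have -> : w ^+ (2 ^ 2) = w by rewrite -[(2 ^ 2)%N]/(3 + 1)%N exprD hw expr1 mul1r.
    have -> : w ^+ (2 ^ 4) = w by rewrite -[(2 ^ 4)%N]/(3 * 5 + 1)%N exprD exprM hw expr1n expr1 mul1r.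
    have -> : w ^+ (2 ^ 1 * 2 ^ 2) = w ^+ 2 by rewrite -[(2 ^ 1 * 2 ^ 2)%N]/(3 * 2 + 2)%N exprD exprM hw expr1n mul1r.
    have -> : w ^+ (2 ^ 1 * 2 ^ 4) = w ^+ 2 by rewrite -[(2 ^ 1 * 2 ^ 4)%N]/(3 * 10 + 2)%N exprD exprM hw expr1n mul1r.
    have -> : w ^+ (2 ^ 1) = w ^+ 2 by [].
    by ring.
  rewrite !T; last 2 first.
  - by rewrite -exprM -[(6 * 3)%N]/(9 * 2)%N exprM z9 expr1n.
  - by rewrite -exprM.
  rewrite resolventE; move: (even_part s) (even_part (step s)) => A B.
  have z6 : z ^+ 6 = - z ^+ 3 - 1.
    by apply/eqP; rewrite -subr_eq0 -hz; apply/eqP; ring.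
  have -> : z ^+ 6 ^+ 2 = z ^+ 3 by rewrite -exprM -[(6 * 2)%N]/(9 + 3)%N exprD z9 mul1r.
  have -> : z ^+ 3 ^+ 2 = z ^+ 6 by rewrite -exprM.
  rewrite z6; move: z6; rewrite -[6%N]/(3 * 2)%N exprM.
  move: (z ^+ 3) => w hw; ring: hw.
rewrite !big_ord_recr big_ord0 /= mul1r expr0.
have i0 := inner 1 (expr1n _ _).
have i1 := inner z z9.
have z29 : z ^+ 2 ^+ 9 = 1 by rewrite -exprM mulnC exprM z9 expr1n.
have := inner (z ^+ 2) z29; move: i0 i1.
rewrite !mulr1 -!exprM -!exprSr -!exprD !expr1n !mul1r.
rewrite -[(2 * 6)%N]/(9 + 3)%N (exprD z 9 3) z9 mul1r /= => i0 i1 i2.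
have [_ wv w3 v3] := cubic_relation X hs.
transitivity ((C0 st.1.1 X + even_prod st * C1 st.1.1 X +
     even_prod (step st) * C2 st.1.1 X) *
   (C0 st.1.1 X + z ^+ 3 * even_prod st * C1 st.1.1 X +
     z ^+ 6 * even_prod (step st) * C2 st.1.1 X) *
   (C0 st.1.1 X + z ^+ 6 * even_prod st * C1 st.1.1 X +
     z ^+ 3 * even_prod (step st) * C2 st.1.1 X)); last first.
  by rewrite -i0 -i1 -i2 expr1; ring.
have z6 : z ^+ 6 = - z ^+ 3 - 1.
  by apply/eqP; rewrite -subr_eq0 -hz; apply/eqP; ring.
clear inner i0 i1 i2 z29 z9 hz.
have [he _] := hs.1.
move: (even_prod st) (even_prod (step st)) wv w3 v3 => W V wv w3 v3.
move: st.1.1 he w3 v3 => e he w3 v3 {hs st}.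
move: z6; rewrite -[6%N]/(3 * 2)%N exprM.
move: (z ^+ 3) => w hw.
transitivity (C0 e X ^+ 3 + W ^+ 3 * C1 e X ^+ 3 + V ^+ 3 * C2 e X ^+ 3
   - 3 * (W * V) * C0 e X * C1 e X * C2 e X); last first.
  by move: (C0 e X) (C1 e X) (C2 e X) => c0 c1 c2; ring: hw.
by rewrite w3 v3 wv /nonic_value /C0 /C1 /C2; ring: he.
Qed.

End Resolvents.

(** * The roots of the cubic in terms of zeta and rho *)

Section Cubic.
Variables (F : fieldType) (t : F).
Implicit Types (m : F * F) (z : F).

Definition cubic_value Y :=
  Y ^+ 3 - 3 * (t ^+ 2 - 3 * t + 9) * Y + (t - 6) * (t ^+ 2 - 3 * t + 9).

(* Minus the sum over k < 3 of sigma^k(rho) (zeta^(4^k) + zeta^-(4^k)), invariant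
   under sigma combined with zeta |-> zeta^5. *)
Definition cubic_root z m :=
  - (m.2 * (z + z ^+ 8) + (sextic_conj t m).2 * (z ^+ 4 + z ^+ 5)
     + (iter 2 (sextic_conj t) m).2 * (z ^+ 7 + z ^+ 2)).

Lemma cubic_rootE z m : sextic_point t m -> cubic_root z m =
  - (m.2 * (z + z ^+ 8) + (m.2 ^+ 2 + (t - 1) * m.2 - 2) * (z ^+ 4 + z ^+ 5)
     + (- t - m.2 - (m.2 ^+ 2 + (t - 1) * m.2 - 2)) * (z ^+ 7 + z ^+ 2)).
Proof. by move=> hm; rewrite /cubic_root iter2_conj. Qed.

Lemma cubic_root1E z m : sextic_point t m -> cubic_root z (sextic_conj t m) =
  - ((m.2 ^+ 2 + (t - 1) * m.2 - 2) * (z + z ^+ 8)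
     + (- t - m.2 - (m.2 ^+ 2 + (t - 1) * m.2 - 2)) * (z ^+ 4 + z ^+ 5)
     + m.2 * (z ^+ 7 + z ^+ 2)).
Proof.
move=> hm; rewrite /cubic_root.
rewrite -[iter 2 _ (sextic_conj t m)]/(iter 3 (sextic_conj t) m) iter3_conj //.
by rewrite -[sextic_conj t (sextic_conj t m)]/(iter 2 (sextic_conj t) m) iter2_conj.
Qed.

Lemma cubic_root2E z m : sextic_point t m -> cubic_root z (iter 2 (sextic_conj t) m) =
  - ((- t - m.2 - (m.2 ^+ 2 + (t - 1) * m.2 - 2)) * (z + z ^+ 8)
     + m.2 * (z ^+ 4 + z ^+ 5)
     + (m.2 ^+ 2 + (t - 1) * m.2 - 2) * (z ^+ 7 + z ^+ 2)).
Proof.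
move=> hm; rewrite /cubic_root -[sextic_conj t (iter 2 _ _)]/(iter 3 (sextic_conj t) m).
rewrite -[iter 2 _ (iter 2 _ m)]/(sextic_conj t (iter 3 (sextic_conj t) m)).
by rewrite !iter3_conj // iter2_conj.
Qed.

Lemma cubic_value_factor z m Y : sextic_point t m -> z ^+ 6 + z ^+ 3 + 1 = 0 ->
  cubic_value Y = (Y - cubic_root z m) * (Y - cubic_root z (sextic_conj t m))
     * (Y - cubic_root z (iter 2 (sextic_conj t) m)).
Proof.
move=> hm hz; rewrite cubic_rootE // cubic_root1E // cubic_root2E //.
have z6 : z ^+ 6 = - z ^+ 3 - 1.
  by apply/eqP; rewrite -subr_eq0 -hz; apply/eqP; ring.
by case: m hm => e r [/= _ hr]; rewrite /cubic_value; ring: hr z6.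
Qed.

(** Separates the three roots: in characteristic zero they are distinct as soon as t and t^2 - 3 t +
    9 are nonzero. *)
Lemma cubic_root_disc z m : sextic_point t m -> z ^+ 6 + z ^+ 3 + 1 = 0 ->
  (cubic_root z m - cubic_root z (sextic_conj t m)) *
  (cubic_root z (sextic_conj t m) - cubic_root z (iter 2 (sextic_conj t) m)) *
  (cubic_root z (iter 2 (sextic_conj t) m) - cubic_root z m)
  = - (9 * (t ^+ 2 - 3 * t + 9) * t).
Proof.
move=> hm hz; rewrite cubic_rootE // cubic_root1E // cubic_root2E //.
have z6 : z ^+ 6 = - z ^+ 3 - 1.
  by apply/eqP; rewrite -subr_eq0 -hz; apply/eqP; ring.
by case: m hm => e r [/= _ hr]; ring: hr z6.
Qed.

Lemma cubic_root_conj z m : sextic_point t m -> z ^+ 6 + z ^+ 3 + 1 = 0 ->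
  cubic_root (z ^+ 5) (sextic_conj t m) = cubic_root z m.
Proof.
move=> hm hz; rewrite cubic_root1E // cubic_rootE //.
have z6 : z ^+ 6 = - z ^+ 3 - 1.
  by apply/eqP; rewrite -subr_eq0 -hz; apply/eqP; ring.
by ring: z6.
Qed.

End Cubic.

Lemma unity_root9 (F : fieldType) (z : F) : 9.-primitive_root z ->
  z ^+ 6 + z ^+ 3 + 1 = 0.
Proof.
move=> hz; have h1 : z ^+ 3 - 1 != 0.
  by rewrite subr_eq0 -(expr0 z) (eq_prim_root_expr hz).
apply: (mulfI h1); rewrite mulr0; apply/eqP.
have -> : (z ^+ 3 - 1) * (z ^+ 6 + z ^+ 3 + 1) = z ^+ 9 - 1 by ring.
by rewrite (prim_expr_order hz) subrr.
Qed.

Lemma sqrt_m3_sqr (F : fieldType) (z : F) : 9.-primitive_root z ->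
  (z ^+ 3 - z ^+ 6) ^+ 2 = - 3.
Proof.
move=> hz; have h0 := unity_root9 hz; have z9 := prim_expr_order hz.
transitivity ((z ^+ 6 + z ^+ 3 + 1) + z ^+ 9 * (z ^+ 3 - 2) - 1 - z ^+ 3); first ring.
by rewrite h0 z9; ring.
Qed.

(** * Compatibility of the construction with field morphisms *)

Section Morphism.
Variables (F F' : fieldType) (g : {rmorphism F -> F'}) (t : F) (t' : F').
Hypothesis gt : g t = t'.

Lemma rmorph_iter_conj k m : iter k (sextic_conj t') (g m.1, g m.2)
  = (g (iter k (sextic_conj t) m).1, g (iter k (sextic_conj t) m).2).
Proof.
elim: k => //= k ->; rewrite /sextic_conj /=.
by rewrite !(rmorphB, rmorphD, rmorphM, rmorphXn, rmorph1, rmorph_nat) /= gt.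
Qed.

Lemma rmorph_conj_unit k m : conj_unit t' k (g m.1, g m.2) = g (conj_unit t k m).
Proof. by rewrite /conj_unit rmorph_iter_conj rmorphN rmorphD. Qed.

Lemma rmorph_kummer_unit m : kummer_unit t' (g m.1, g m.2) = g (kummer_unit t m).
Proof.
rewrite /kummer_unit !rmorph_conj_unit.
move: (conj_unit t 0 m) (conj_unit t 1 m) (conj_unit t 2 m).
move: (conj_unit t 3 m) (conj_unit t 4 m) (conj_unit t 5 m) => *.
by rewrite !(rmorphXn, rmorphM).
Qed.

Lemma rmorph_sextic_point m : sextic_point t' (g m.1, g m.2) <-> sextic_point t m.
Proof.
have E1 : (t' - 1) * g m.1 + 1 = g ((t - 1) * m.1 + 1).
  by rewrite !(rmorphB, rmorphD, rmorphM, rmorph1) gt.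
have E2 : 1 - t' * g m.2 ^+ 2 - (t' - 3) * g m.2 = g (1 - t * m.2 ^+ 2 - (t - 3) * m.2).
  by rewrite !(rmorphB, rmorphD, rmorphM, rmorphXn, rmorph1, rmorph_nat) gt.
rewrite /sextic_point /= E1 E2 -!rmorphXn.
by split=> [[/(fmorph_inj g) -> /(fmorph_inj g) ->]|[-> ->]].
Qed.

Lemma rmorph_kummer_state st :
  kummer_state t' ((g st.1.1, g st.1.2), g st.2) <-> kummer_state t st.
Proof.
rewrite /kummer_state; split=> -[/rmorph_sextic_point hm hh]; split => //; move: hh.
  by rewrite rmorph_kummer_unit -[LHS]/(g st.2 ^+ 9) -rmorphXn => /(fmorph_inj g).
by rewrite rmorph_kummer_unit -[_ ^+ 9 in X in _ -> X]/(g st.2 ^+ 9) -rmorphXn => ->.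
Qed.

Lemma rmorph_step st : step t' ((g st.1.1, g st.1.2), g st.2)
  = ((g (step t st).1.1, g (step t st).1.2), g (step t st).2).
Proof.
rewrite /step; congr (_, _); first exact: (rmorph_iter_conj 5 st.1).
rewrite fmorph_div rmorphXn /step_unit -[((_, _), _).1]/(_, _) !rmorph_conj_unit.
congr (_ / _); move: (conj_unit t 3 _) (conj_unit t 4 _) (conj_unit t 5 _) => *.
by rewrite !rmorphM.
Qed.

Lemma rmorph_resolvent st : resolvent t' ((g st.1.1, g st.1.2), g st.2)
  = g (resolvent t st).
Proof.
rewrite /resolvent rmorph_sum; apply: eq_bigr => j _.
suff -> : iter j (step t') ((g st.1.1, g st.1.2), g st.2)
   = ((g (iter j (step t) st).1.1, g (iter j (step t) st).1.2), g (iter j (step t) st).2) by [].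
by elim: {j} (j : nat) => // j IH; rewrite !iterS IH rmorph_step.
Qed.

Lemma rmorph_cubic_root z m :
  g (cubic_root t z m) = cubic_root t' (g z) (g m.1, g m.2).
Proof.
rewrite /cubic_root -![sextic_conj _ _]/(iter 1 (sextic_conj _) _) !rmorph_iter_conj.
move: (iter 1 _ _) (iter 2 _ _) => m1 m2.
by rewrite rmorphN !rmorphD /= !rmorphM !rmorphD !rmorphXn.
Qed.

End Morphism.

(** * Action of automorphisms on the resolvents *)

Section Action.
Variables (F : fieldType) (t : F) (g : {rmorphism F -> F}).
Hypotheses (char0 : [pchar F] =i pred0) (gt : g t = t).
Variables (z : F) (m : F * F) (h : F).
Hypotheses (hz : 9.-primitive_root z) (hs : kummer_state t (m, h)).
Hypothesis (t0 : t * (t ^+ 2 - 3 * t + 9) != 0).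
(** A square root of -3 (t - 1)^2 - 12: the first factor squares to -3, the second to (t - 1)^2 +
    4. *)
Let d := (z ^+ 3 - z ^+ 6) * (2 * m.1 - (t - 1)).
Hypotheses (d0 : d != 0) (gd : g d = d).
Hypothesis gy : g (cubic_root t z m) = cubic_root t z m.

Let natr_neq0 n : n.+1%:R != 0 :> F.
Proof. by move/pcharf0P: char0 => ->. Qed.

Let hm : sextic_point t m. Proof. by case: hs. Qed.
Let z9 : z ^+ 9 = 1 := prim_expr_order hz.

Lemma conj_unity_root9 k : (z ^+ (5 ^ k)) ^+ 6 + (z ^+ (5 ^ k)) ^+ 3 + 1 = 0.
Proof.
apply: unity_root9; rewrite prim_root_exp_coprime //.
by rewrite coprimeXl.
Qed.

Lemma cubic_root_iter k :
  cubic_root t (z ^+ (5 ^ k)) (iter k (sextic_conj t) m) = cubic_root t z m.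
Proof.
elim: k => [|k IH] //=; rewrite expnSr exprM cubic_root_conj ?IH //.
  exact: iter_sextic_point.
exact: conj_unity_root9.
Qed.

(** 5 is a primitive root modulo 9, so its six powers reach all primitive ninth roots of unity. *)
Lemma aut_unity_root : exists2 k, (k < 6)%N & g z = z ^+ (5 ^ k).
Proof.
have /(prim_rootP hz)[i hi] : g z ^+ 9 = 1 by rewrite -rmorphXn z9 rmorph1.
have : 9.-primitive_root (g z) by rewrite fmorph_primitive_root.
rewrite hi prim_root_exp_coprime //.
have red n j : (n %% 9 = j)%N -> z ^+ j = z ^+ n by move=> <-; rewrite prim_expr_mod.
case: i {hi} => [[|[|[|[|[|[|[|[|[|//]]]]]]]]]] //= _ _.
- by exists 0%N.
- by exists 5%N => //; apply: red.
- by exists 4%N => //; apply: red.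
- by exists 1%N => //; apply: red.
- by exists 2%N => //; apply: red.
- by exists 3%N => //; apply: red.
Qed.

Lemma iter_conj1 k : (iter k (sextic_conj t) m).1 = if odd k then t - 1 - m.1 else m.1.
Proof. by elim: k => //= k ->; case: (odd k) => //=; ring. Qed.

Lemma exp_unity_root3 k : (k < 6)%N ->
  (z ^+ (5 ^ k)) ^+ 3 - (z ^+ (5 ^ k)) ^+ 6
  = if odd k then - (z ^+ 3 - z ^+ 6) else z ^+ 3 - z ^+ 6.
Proof.
have red n j : (n %% 9 = j)%N -> z ^+ n = z ^+ j by move=> <-; rewrite prim_expr_mod.
by case: k => [|[|[|[|[|[|//]]]]]] _; rewrite -!exprM opprB /=; congr (_ - _); apply: red.
Qed.

(** As g negates z^3 - z^6 exactly when k is odd, fixing d makes it conjugate epsilon exactly then.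
    It sends rho to some root of the simplest cubic; a root other than that of sigma^k m would make
    two of the roots in [cubic_root_disc] equal, because g fixes y. *)
Lemma aut_sextic : exists2 k, (k < 6)%N &
  g z = z ^+ (5 ^ k) /\ (g m.1, g m.2) = iter k (sextic_conj t) m.
Proof.
have [k lk gz] := aut_unity_root; exists k => //; split => //.
have n2 : 2%:R != 0 :> F := natr_neq0 1.
rewrite [RHS]surjective_pairing; congr (_, _).
  move: gd d0; rewrite iter_conj1 /d.
  rewrite !(rmorphB, rmorphD, rmorphM, rmorphXn, rmorph1, rmorph_nat) gt gz.
  rewrite exp_unity_root3 // mulf_eq0 negb_or => E /andP[s0 _].
  case: (odd k) E => E; last first.
    by have := mulfI s0 E => /addIr/(mulfI n2).
  rewrite mulNr -mulrN in E; have := mulfI s0 E => {}E.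
  apply: (mulfI n2); apply/eqP; rewrite -subr_eq0; apply/eqP.
  transitivity (- (- (2 * g m.1 - (t - 1)) - (2 * m.1 - (t - 1)))); first ring.
  by rewrite E; ring.
have hm' := iter_sextic_point k hm.
have hz' := conj_unity_root9 k.
have := cubic_root_disc hm' hz'; have := cubic_root_iter k.
rewrite -[in X in X -> _]gy (rmorph_cubic_root gt) gz.
move: (iter k _ m) hm' => m' hm'; move: (z ^+ (5 ^ k)) hz' => z' hz' E D.
have [_ hgr] : sextic_point t (g m.1, g m.2) by case: ((rmorph_kummer_state gt _).2 hs).
have nD : - (9 * (t ^+ 2 - 3 * t + 9) * t) != 0.
  by rewrite oppr_eq0 -mulrA mulf_neq0 ?(natr_neq0 8) // mulrC.
have cr m1 m2 : m1.2 = m2.2 -> cubic_root t z' m1 = cubic_root t z' m2.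
  by rewrite /cubic_root /= => ->.
have : (g m.2 - m'.2) * (g m.2 - (sextic_conj t m').2)
       * (g m.2 - (iter 2 (sextic_conj t) m').2) == 0.
  rewrite iter2_conj //; case: hm' hgr; case: (m') => e' r' /= _ hr' hg.
  by apply/eqP; ring: hr' hg.
rewrite !mulf_eq0 !subr_eq0 => /orP[/orP[]|] /eqP H //.
  by move: nD; rewrite -D E (cr _ (sextic_conj t m')) // subrr !mul0r eqxx.
by move: nD; rewrite -D E (cr _ (iter 2 (sextic_conj t) m')) // subrr mulr0 eqxx.
Qed.

(** A step moves the point by sigma^-1, so 6 - k steps lead to sigma^k m = g m. The second
    coordinate reached there and g h have the same ninth power. *)
Lemma aut_kummer_root : exists k l,
  [/\ (k < 6)%N, g z = z ^+ (5 ^ k), (g m.1, g m.2) = iter k (sextic_conj t) m,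
      (iter (6 - k) (step t) (m, h)).1 = (g m.1, g m.2)
    & g h = z ^+ l * (iter (6 - k) (step t) (m, h)).2].
Proof.
have [k lk [gz gm']] := aut_sextic.
set st := iter (6 - k) (step t) (m, h).
have hst : kummer_state t st := iter_kummer_state _ hs.
have st1 : st.1 = (g m.1, g m.2).
  rewrite /st step1 gm' -[in RHS](subKn (ltnW lk)).
  have : (6 - k <= 6)%N by rewrite leq_subr.
  move: (6 - k)%N => [|[|[|[|[|[|[|//]]]]]]] _; rewrite ?mul0n ?subn0 ?iter6_conj //.
  - by rewrite -[(2 * 5)%N]/(4 + 6)%N iterD iter6_conj.
  - by rewrite -[(3 * 5)%N]/(3 + (6 + 6))%N !iterD !iter6_conj.
  - by rewrite -[(4 * 5)%N]/(2 + (6 + (6 + 6)))%N !iterD !iter6_conj.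
  - by rewrite -[(5 * 5)%N]/(1 + (6 + (6 + (6 + 6))))%N !iterD !iter6_conj.
  - by rewrite -[(6 * 5)%N]/(6 + (6 + (6 + (6 + 6))))%N !iterD !iter6_conj.
have [l gh] : exists l, g h = z ^+ l * st.2.
  have [_ g9] := (rmorph_kummer_state gt _).2 hs; have [_ h9] := hst.
  have n0 := kummer_neq0 hst.
  have /(prim_rootP hz)[l hl] : (g h / st.2) ^+ 9 = 1.
    by rewrite expr_div_n g9 /= -st1 -h9 divff // expf_neq0.
  by exists l; rewrite -hl divfK.
by exists k, l; split.
Qed.

(** Since 5 is the inverse of 2 modulo 9, g multiplies the exponent i by 5^k = 2^(6 - k), exactly
    the factor that 6 - k steps put on a twist. Invariance of the resolvent under [step] absorbs it
    and leaves the translation by c = 2^k l. *)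
Lemma aut_resolvent : exists c, forall i,
  g (resolvent t (twist (z ^+ i) (m, h))) = resolvent t (twist (z ^+ (i + c)) (m, h)).
Proof.
have [k [l [lk gz gm' st1 gh]]] := aut_kummer_root.
set st := iter (6 - k) (step t) (m, h) in st1 gh.
exists (2 ^ k * l)%N => i.
rewrite -(rmorph_resolvent gt) /= rmorphM rmorphXn /= gz gh -exprM mulrA -exprD.
rewrite -[RHS](resolvent_iter (6 - k)); last first.
  by apply: kummer_state_twist => //; rewrite exprAC z9 expr1n.
rewrite iter_step_twist -/st /twist -st1; congr (resolvent t (_, _ * _)).
apply/eqP; rewrite -exprM (eq_prim_root_expr hz) mulnDl -mulnA (mulnC l) mulnA -expnD.
rewrite (subnKC (ltnW lk)).
have e52 : (5 ^ k = 2 ^ (6 - k) %[mod 9])%N by case: k lk {gz gm' st st1 gh} => [|[|[|[|[|[|//]]]]]].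
rewrite -modnDml -modnMml e52 modnMml modnDml (mulnC i).
rewrite eqn_modDl -[(2 ^ 6)%N]/(7 * 9 + 1)%N mulnDl mul1n mulnAC.
by rewrite -modnDml modnMl.
Qed.

End Action.

(** * Rings of integers *)

Section Integers.
Variable L : fieldExtType rat.
Implicit Types (E : {subfield L}) (P W : L -> Prop) (x y : L).

Lemma integral_int (n : int) : integralOver (intr : int -> L) n%:~R.
Proof. exact: integral_id. Qed.

Lemma integral_aut (L' : fieldExtType rat) (g : {rmorphism L -> L'}) x :
  integralOver (intr : int -> L) x -> integralOver (intr : int -> L') (g x).
Proof.
case=> p mon_p rp; exists p => //.
rewrite (_ : map_poly intr p = map_poly g (map_poly (intr : int -> L) p)) ?rmorph_root //.
by rewrite -map_poly_comp; apply: eq_map_poly => n /=; rewrite rmorph_int.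
Qed.

Lemma ring_of_integersB E x y : ring_of_integers E x -> ring_of_integers E y ->
  ring_of_integers E (x - y).
Proof. by case=> Ex ix [Ey iy]; split; [rewrite rpredB | apply: integral_sub]. Qed.

Lemma ring_of_integersM E x y : ring_of_integers E x -> ring_of_integers E y ->
  ring_of_integers E (x * y).
Proof. by case=> Ex ix [Ey iy]; split; [rewrite rpredM | apply: integral_mul]. Qed.

Lemma ring_of_integers_int E n : ring_of_integers E n%:~R.
Proof. by split; [rewrite rpred_int | apply: integral_int]. Qed.

Lemma ring_of_integers1 E : ring_of_integers E 1.
Proof. exact: (ring_of_integers_int _ 1). Qed.

Lemma ring_of_integers0 E : ring_of_integers E 0.
Proof. exact: (ring_of_integers_int _ 0). Qed.

Lemma ring_of_integersN E x : ring_of_integers E x -> ring_of_integers E (- x).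
Proof. by move=> hx; rewrite -sub0r; apply/ring_of_integersB/hx/ring_of_integers0. Qed.

Lemma ring_of_integersD E x y : ring_of_integers E x -> ring_of_integers E y ->
  ring_of_integers E (x + y).
Proof. by move=> hx hy; rewrite -[y]opprK; apply/ring_of_integersB/ring_of_integersN. Qed.

Lemma ring_of_integers_sum E (I : Type) (r : seq I) (p : pred I) (f : I -> L) :
  (forall i, p i -> ring_of_integers E (f i)) ->
  ring_of_integers E (\sum_(i <- r | p i) f i).
Proof.
move=> hf; apply: big_ind => //; first exact: ring_of_integers0.
exact: ring_of_integersD.
Qed.

Lemma ring_of_integers_prod E (I : Type) (r : seq I) (p : pred I) (f : I -> L) :
  (forall i, p i -> ring_of_integers E (f i)) ->
  ring_of_integers E (\prod_(i <- r | p i) f i).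
Proof.
move=> hf; apply: big_ind => //; first exact: ring_of_integers1.
exact: ring_of_integersM.
Qed.

Lemma ring_of_integersX E x n : ring_of_integers E x -> ring_of_integers E (x ^+ n).
Proof.
move=> hx; elim: n => [|n IH]; first exact: ring_of_integers1.
by rewrite exprS; apply: ring_of_integersM.
Qed.

Lemma ring_of_integersS E (F : {subfield L}) x : (E <= F)%VS -> ring_of_integers E x -> ring_of_integers F x.
Proof. by move=> /subvP sEF [Ex ix]; split => //; apply: sEF. Qed.

Lemma ideal_opp E P x : integral_ideal E P -> P x -> P (- x).
Proof.
by move=> [_ _ _ mP] Px; rewrite -mulN1r; apply: mP => //; apply/ring_of_integersN/ring_of_integers1.
Qed.

Lemma idealB E P x y : integral_ideal E P -> P x -> P y -> P (x - y).
Proof. by move=> iP Px Py; have [_ _ aP _] := iP; apply: aP => //; apply: (ideal_opp iP). Qed.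

Lemma ideal_sum E P (I : Type) (r : seq I) (p : pred I) (f : I -> L) :
  integral_ideal E P -> (forall i, p i -> P (f i)) -> P (\sum_(i <- r | p i) f i).
Proof. by case=> _ P0 aP _ hf; apply: big_ind. Qed.

Lemma ideal_mulr E P x y : integral_ideal E P -> P x -> ring_of_integers E y -> P (x * y).
Proof. by case=> _ _ _ mP Px hy; rewrite mulrC; apply: mP. Qed.

End Integers.

Section RationalIntegers.

Lemma rational_integer (L : fieldExtType rat) (a : rat) :
  integralOver (intr : int -> L) a%:A -> exists n : int, a = n%:~R.
Proof.
case=> p mon_p rp.
have ra : root (map_poly (intr : int -> rat) p) a.
  rewrite -(fmorph_root (in_alg L)) -map_poly_comp.
  by rewrite (eq_map_poly (g := intr)) // => n; apply: (rmorph_int (in_alg L)).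
have : (ratr a : algC) \in Num.int.
  apply: Cint_rat_Aint; first exact: Crat_rat.
  apply: (@root_monic_Aint (map_poly intr p)).
  - rewrite (_ : map_poly _ p = map_poly ratr (map_poly (intr : int -> rat) p)) ?fmorph_root //.
    by rewrite -map_poly_comp; apply: eq_map_poly => n /=; rewrite ratr_int.
  - by rewrite monic_map.
  - by apply/polyOverP => i; rewrite coef_map intr_int.
case/intrP=> n Dn; exists n; apply: (fmorph_inj (ratr : {rmorphism rat -> algC})).
by rewrite /= Dn rmorph_int.
Qed.

End RationalIntegers.

(** * Finite generation of groups of algebraic integers *)

Section FinitelyGenerated.
Variable V : zmodType.

Lemma subgroup_mulz (W : V -> Prop) : W 0 -> (forall x y, W x -> W y -> W (x - y)) ->
  forall x n, W x -> W (x *~ n).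
Proof.
move=> W0 WB x n Wx.
have Wn m : W (x *+ m).
  elim: m => // m IH; rewrite mulrS -[x *+ m]opprK -(sub0r (x *+ m)).
  by apply: (WB) => //; apply: (WB).
case: n => m; first exact: Wn.
by rewrite NegzE mulrNz -sub0r; apply: (WB) => //; apply: Wn.
Qed.

Lemma additive_mulz (W : V -> Prop) (f : V -> int) :
  W 0 -> (forall x y, W x -> W y -> W (x - y)) ->
  (forall x y, W x -> W y -> f (x - y) = f x - f y) ->
  forall x n, W x -> f (x *~ n) = f x * n.
Proof.
move=> W0 WB fB x n Wx.
have f0 : f 0 = 0 by rewrite -(subr0 0) fB // subrr.
have Wz := subgroup_mulz W0 WB.
have fn m : f (x *+ m) = f x *+ m.
  elim: m => // m IH; rewrite !mulrS -IH -[x *+ m in LHS]opprK -(sub0r (x *+ m)).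
  have Wm : W (x *+ m) := Wz x m Wx.
  have Wo : W (0 - x *+ m) by apply: (WB).
  by rewrite fB // fB // f0 sub0r opprK.
case: n => m; first by rewrite -[x *~ m]/(x *+ m) fn -mulr_natr natz.
rewrite NegzE mulrNz -sub0r fB //; last by apply: (Wz x m.+1).
by rewrite f0 sub0r -[x *~ m.+1]/(x *+ m.+1) fn mulrN -mulr_natr natz.
Qed.

(** The values of f on W form a subgroup of the integers. The generator is found by Euclidean
    descent on |f w|, with excluded middle because W is not decidable. *)
Lemma subgroup_generator (W : V -> Prop) (f : V -> int) :
  W 0 -> (forall x y, W x -> W y -> W (x - y)) ->
  (forall x y, W x -> W y -> f (x - y) = f x - f y) ->
  exists2 w, W w & forall x, W x -> exists q, f x = f w * q.
Proof.
move=> W0 WB fB.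
have Wz := subgroup_mulz W0 WB; have fz := additive_mulz W0 WB fB.
have main (k : nat) w : W w -> f w != 0 -> (`|f w| <= k)%N ->
    exists2 w, W w & forall x, W x -> exists q, f x = f w * q.
  elim: k w => [|k IH] w Ww nz le_k; first by rewrite leqn0 absz_eq0 (negPf nz) in le_k.
  case: (classic (forall x, W x -> exists q, f x = f w * q)) => [|nw]; first by exists w.
  have [x nx] := not_all_ex_not _ _ nw; have {nx} [Wx nx] := imply_to_and _ _ nx.
  pose y := x - w *~ (f x %/ f w)%Z.
  have Wy : W y by apply: (WB) => //; apply: (Wz).
  have fy : f y = (f x %% f w)%Z.
    rewrite /y fB //; last exact: Wz.
    by rewrite fz // {1}(divz_eq (f x) (f w)) mulrC addrAC subrr add0r.
  apply: (IH y) => //.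
    apply/eqP => fy0; apply: nx; exists (f x %/ f w)%Z.
    by rewrite {1}(divz_eq (f x) (f w)) -fy fy0 addr0 mulrC.
  rewrite -ltnS; apply: leq_trans le_k; rewrite -ltz_nat fy.
  by rewrite !abszE (ger0_norm (modz_ge0 _ nz)) ltz_mod.
case: (classic (exists2 w, W w & f w != 0)) => [[w Ww nz]|none]; first exact: (main `|f w|%N w).
exists 0 => // x Wx; exists 0; rewrite mulr0; apply/eqP/negPn/negP => nz.
by apply: none; exists x.
Qed.

(** The f i embed W into Z^n; the induction splits off a generator for the last one and continues in
    its kernel. Additivity is asked on W only, since the functionals used later are numerators of
    traces, additive only where these traces are integers. *)
Lemma finitely_generated (n : nat) (f : nat -> V -> int) (W : V -> Prop) :
  W 0 -> (forall x y, W x -> W y -> W (x - y)) ->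
  (forall i x y, W x -> W y -> f i (x - y) = f i x - f i y) ->
  (forall x, W x -> (forall i, (i < n)%N -> f i x = 0) -> x = 0) ->
  exists2 ws : seq V, forall w, w \in ws -> W w &
    forall x, W x -> exists c : nat -> int, x = \sum_(i < size ws) ws`_i *~ c i.
Proof.
elim: n W => [|n IH] W W0 WB fB fW.
  by exists [::] => // x Wx; exists (fun=> 0); rewrite big_ord0 (fW x).
have Wz := subgroup_mulz W0 WB; have fz := additive_mulz W0 WB (fB n).
have [w Ww gw] := subgroup_generator W0 WB (fB n).
have f0 : f n 0 = 0 by rewrite -(subr0 0) fB // subrr.
have [|x y [Wx fx] [Wy fy]|i x y [Wx _] [Wy _]|x [Wx fx] hx|ws Wws gws] :=
  IH (fun x => W x /\ f n x = 0).
- by split.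
- by split; [apply: (WB) | rewrite fB // fx fy subrr].
- exact: fB.
- by apply: fW => // i; rewrite ltnS leq_eqVlt => /orP[/eqP->|/hx].
exists (w :: ws) => [v|x Wx].
  by rewrite inE => /orP[/eqP->|/Wws[]].
have [q fxq] := gw x Wx.
have [|c Dc] := gws (x - w *~ q).
  split; first by apply: (WB) => //; apply: (Wz).
  by rewrite fB // ?fz ?fxq ?subrr //; apply: (Wz).
exists (fun i => if i is j.+1 then c j else q).
by rewrite big_ord_recl /= -Dc addrC subrK.
Qed.

End FinitelyGenerated.

Lemma alg_int_eq0 (L : fieldExtType rat) (n : int) : (n%:~R == 0 :> L) = (n == 0).
Proof. by rewrite -(rmorph_int (in_alg L)) fmorph_eq0 intr_eq0. Qed.

Lemma integral_denominator (L : fieldExtType rat) (x : L) :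
  exists2 N : int, N != 0 & integralOver (intr : int -> L) (N%:~R * x).
Proof.
have [p Dp] : exists p : {poly rat}, minPoly 1%AS x = map_poly (in_alg L) p.
  by have /polyOver1P[p ->] := minPolyOver 1%AS x; exists p.
have [q [a nz_a Dq]] := rat_poly_scale p.
have nz_p : p != 0.
  by apply: contraTneq (monic_minPoly 1%AS x) => p0; rewrite Dp p0 rmorph0 monicE lead_coef0 eq_sym oner_eq0.
have nz_q : q != 0 by apply: contraNneq nz_p => q0; rewrite Dq q0 rmorph0 scaler0.
have qx : (map_poly (intr : int -> L) q).[x] = 0.
  have := root_minPoly 1%AS x; rewrite Dp Dq /root map_polyZ hornerZ mulf_eq0.
  rewrite fmorph_eq0 invr_eq0 intr_eq0 (negPf nz_a) /= -map_poly_comp => /eqP <-.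
  congr _.[x]; apply: eq_map_poly => n; exact/esym/(rmorph_int (in_alg L)).
set l := lead_coef q; have nz_l : l != 0 by rewrite lead_coef_eq0.
exists l => //.
have [n Dn] : exists n, size q = n.+1 by exists (size q).-1; rewrite prednK // lt0n size_poly_eq0.
case: n Dn => [|n] Dn.
  case/eqP/size_poly1P: Dn => c nz_c Dc; move: qx.
  by rewrite Dc map_polyC hornerC => /eqP; rewrite alg_int_eq0 (negPf nz_c).
(* This is l^n q(X / l), where q has degree n + 1 and leading coefficient l: it is monic with
   integer coefficients and vanishes at l x. *)
pose r : {poly int} := 'X^(n.+1) + \poly_(i < n.+1) (q`_i * l ^+ (n - i)).
exists r.
  by rewrite monicE lead_coefDl ?lead_coefXn // size_polyXn ltnS size_poly.
have le_r : (size (map_poly (intr : int -> L) r) <= n.+2)%N.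
  apply: leq_trans (size_poly _ _) _; rewrite size_polyDl size_polyXn //.
  by rewrite ltnS size_poly.
apply/eqP; transitivity (l%:~R ^+ n * (map_poly (intr : int -> L) q).[x]); last by rewrite qx mulr0.
rewrite (horner_coef_wide _ le_r) (@horner_coef_wide _ n.+2); last first.
  by rewrite (leq_trans (size_poly _ _)) ?Dn.
rewrite [LHS]big_ord_recr [in RHS]big_ord_recr /= mulrDr mulr_sumr; congr (_ + _).
  apply: eq_bigr => i _; rewrite !coef_map coefD coefXn coef_poly ltn_ord.
  rewrite (ltn_eqF (ltn_ord i)) add0r /= rmorphM rmorphXn /= exprMn.
  have le_i : (i <= n)%N by rewrite -ltnS.
  by rewrite -[in X in _ = X * _](subnK le_i) exprD; ring.
rewrite !coef_map coefD coefXn eqxx coef_poly ltnn addr0 /= mul1r exprMn exprSr.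
by rewrite -[q`_n.+1]/(q`_(n.+2).-1) -Dn -lead_coefE mulrA.
Qed.

Section Trace.
Variable L : splittingFieldType rat.

Lemma galois_number_field (K : {subfield L}) : galois K {:L}.
Proof.
apply/and3P; split; [exact: subvf | | exact: normalFieldf].
apply/separableP => x _; apply: pcharf0_separable => p.
by rewrite pchar_lalg pchar_num.
Qed.

Lemma number_field_char0 : [pchar L] =i pred0.
Proof. by move=> p; rewrite pchar_lalg pchar_num. Qed.

Let tr (x : L) : L := galTrace 1 {:L} x.
Let co (x : L) : rat := coord [tuple 1] ord0 x.

Lemma trace_rational x : tr x = (co (tr x))%:A.
Proof.
have : tr x \in 1%VS by rewrite mem_galTrace ?memvf // galois_number_field.
have free1 : free [tuple (1 : L)] by rewrite seq1_free oner_eq0.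
have := coord_free ord0 ord0 free1; rewrite /= => co1.
by case/vlineP=> k ->; rewrite /co linearZ /= co1 mulr1.
Qed.

(** The trace form against a rational basis scaled to integers takes integer values on W. It is
    nondegenerate: if x were orthogonal to everything, then x x^-1 = 1 would have trace 0, while its
    trace is the order of the Galois group. *)
Lemma integers_finitely_generated (W : L -> Prop) :
  W 0 -> (forall x y, W x -> W y -> W (x - y)) ->
  (forall x, W x -> integralOver (intr : int -> L) x) ->
  exists2 ws : seq L, forall w, w \in ws -> W w &
    forall x, W x -> exists c : nat -> int, x = \sum_(i < size ws) ws`_i *~ c i.
Proof.
move=> W0 WB Wi.
have [N nzN iN] := fin_all_exists2 (fun i : 'I_(\dim {:L}) => integral_denominator (vbasis {:L})`_i).
pose c (i : nat) : L := if insub i is Some j then (N j)%:~R * (vbasis {:L})`_j else 0.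
have ic i : integralOver (intr : int -> L) (c i).
  by rewrite /c; case: insubP => // _; apply: integral0.
have itr x : integralOver (intr : int -> L) x -> exists n : int, co (tr x) = n%:~R.
  move=> ix; apply: (@rational_integer L); rewrite -trace_rational /tr /galTrace.
  apply: (big_ind (integralOver (intr : int -> L))) => [||s _]; first exact: integral0.
    exact: integral_add.
  exact: (integral_aut (gal_repr s)).
pose f (i : nat) (w : L) : int := numq (co (tr (w * c i))).
have fE i w : W w -> co (tr (w * c i)) = (f i w)%:~R.
  move=> Ww; have [|n Dn] := itr (w * c i); first by apply: integral_mul => //; apply: Wi.
  by rewrite /f Dn numq_int.
apply: (@finitely_generated _ (\dim {:L}) f) => // [i x y Wx Wy|x Wx fx0].
  apply: (@intr_inj rat); rewrite rmorphB /= -!fE //; last exact: WB.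
  by rewrite mulrBl /tr /co !raddfB.
apply/eqP/negPn/negP => nzx.
have trZ a u : tr (a *: u) = a *: tr u.
  by rewrite /tr /galTrace scaler_sumr; apply: eq_bigr => s _; rewrite linearZ.
have trb (i : 'I_(\dim {:L})) : tr (x * (vbasis {:L})`_i) = 0.
  have : tr (x * c i) = 0 by rewrite trace_rational fE // fx0 // scale0r.
  rewrite /c valK mulrCA -(rmorph_int (in_alg L)) mulr_algl trZ => /eqP.
  by rewrite scaler_eq0 intr_eq0 (negPf (nzN i)) => /eqP.
have tr0 v : tr (x * v) = 0.
  rewrite (coord_vbasis (memvf v)) mulr_sumr.
  transitivity (\sum_i tr (x * (coord (vbasis {:L}) i v *: (vbasis {:L})`_i))); first exact: raddf_sum.
  by apply: big1 => i _; rewrite -scalerAr trZ trb scaler0.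
have := tr0 x^-1; rewrite divff // /tr /galTrace.
rewrite (eq_bigr (fun=> 1)) => [|s _]; last exact: rmorph1.
rewrite sumr_const => /eqP; rewrite -mulr_natr mul1r.
by move/pcharf0P: number_field_char0 => ->; rewrite eqn0Ngt cardG_gt0.
Qed.

End Trace.

(** * Nakayama's lemma for ideals of integers *)

Section Nakayama.
Variables (L : splittingFieldType rat) (E : {subfield L}) (P : L -> Prop).
Hypotheses (iP : integral_ideal E P) (P1 : ~ P 1).

Let P0 : P 0. Proof. by case: iP. Qed.
Let PD x y : P x -> P y -> P (x + y). Proof. by case: iP => _ _ + _; apply. Qed.
Let PO x : P x -> ring_of_integers E x. Proof. by case: iP => + _ _ _; apply. Qed.
Let PM x y : ring_of_integers E x -> P y -> P (x * y). Proof. by case: iP => _ _ _; apply. Qed.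

Lemma det_sub_ideal n (A : 'M[L]_n) : (forall i j, P (A i j)) -> P (\det (1%:M - A) - 1).
Proof.
move=> PA; have OA i j : ring_of_integers E ((1%:M - A) i j).
  rewrite !mxE; apply: ring_of_integersB; last exact/PO/PA.
  by case: (i == j); [exact: ring_of_integers1 | exact: ring_of_integers0].
rewrite /determinant (bigD1 1%g) //= addrAC; apply: PD; last first.
  apply: (ideal_sum _ iP) => s s1.
  have [i si] : exists i, s i != i.
    apply/existsP; rewrite -negb_forall; apply: contra s1 => /forallP h.
    by apply/eqP/permP => i; rewrite perm1; apply/eqP.
  apply: PM; first by apply: ring_of_integersX; apply/ring_of_integersN/ring_of_integers1.
  rewrite (bigD1 i) //= mulrC; apply: PM; first by apply: ring_of_integers_prod.
  by rewrite !mxE eq_sym (negPf si) sub0r; apply: (ideal_opp iP).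
rewrite odd_perm1 expr0 mul1r.
have : ring_of_integers E (\prod_i (1%:M - A) i ((1%g : 'S_n) i)) /\
   P (\prod_i (1%:M - A) i ((1%g : 'S_n) i) - 1); last by case.
apply: (big_ind (fun x => ring_of_integers E x /\ P (x - 1))).
- by rewrite subrr; split; [exact: ring_of_integers1|].
- move=> x y [Ox Px] [Oy Py]; split; first exact: ring_of_integersM.
  by have -> : x * y - 1 = x * (y - 1) + (x - 1) by [ring]; apply: PD => //; apply: PM.
move=> i _; rewrite perm1; split; first exact: OA.
by rewrite !mxE eqxx addrAC subrr add0r; apply: (ideal_opp iP).
Qed.

(** The determinant trick: det (1 - A) annihilates all the w i, and it is nonzero because it is 1
    modulo P. *)
Lemma nakayama_span n (w : 'I_n -> L) :
  (forall i, exists2 a : 'I_n -> L, forall j, P (a j) & w i = \sum_j a j * w j) ->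
  forall i, w i = 0.
Proof.
move=> hw; have [a Pa wa] := fin_all_exists2 hw.
pose A := \matrix_(i, j) a i j; pose v := \col_i w i.
have Av : (1%:M - A) *m v = 0.
  apply/colP => i; rewrite mulmxBl mul1mx !mxE {1}wa.
  by apply/eqP; rewrite subr_eq0; apply/eqP; apply: eq_bigr => j _; rewrite !mxE.
have Pd : P (\det (1%:M - A) - 1) by apply: det_sub_ideal => i j; rewrite mxE.
have nd : \det (1%:M - A) != 0.
  apply/eqP => d0; apply: P1; rewrite -[1]opprK.
  by apply: (ideal_opp iP); rewrite -[-1]add0r -d0.
have : \det (1%:M - A) *: v = 0.
  by rewrite -mul_scalar_mx -mul_adj_mx -mulmxA Av mulmx0.
move/eqP; rewrite scaler_eq0 (negPf nd) /= => /eqP/colP v0 i.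
by have := v0 i; rewrite !mxE.
Qed.

(** W is a group of algebraic integers contained in P W, not necessarily inside E: it is applied to
    P itself and to the integers of a larger field. *)
Lemma nakayama (W : L -> Prop) : W 0 ->
  (forall x y, W x -> W y -> W (x - y)) ->
  (forall x, W x -> integralOver (intr : int -> L) x) ->
  (forall x, W x -> exists2 s : seq (L * L),
     forall ab, ab \in s -> P ab.1 /\ W ab.2 & x = \sum_(ab <- s) ab.1 * ab.2) ->
  forall x, W x -> x = 0.
Proof.
move=> W0 WB Wi WP; have [ws Wws gws] := integers_finitely_generated W0 WB Wi.
have ws0 : forall i : 'I_(size ws), ws`_i = 0.
  apply: nakayama_span => i; have [s hs ->] := WP _ (Wws _ (mem_nth 0 (ltn_ord i))).
  rewrite big_seq.
  apply: (big_ind (fun x => exists2 a : 'I_(size ws) -> L, forall j, P (a j) & x = \sum_j a j * ws`_j)).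
  - exists (fun=> 0) => //; by rewrite big1 // => j _; rewrite mul0r.
  - move=> _ _ [a Pa ->] [b Pb ->]; exists (fun j => a j + b j) => [j|]; first exact: PD (Pa j) (Pb j).
    by rewrite -big_split; apply: eq_bigr => j _; rewrite mulrDl.
  move=> ab /hs[Pa Wb]; have [c ->] := gws _ Wb.
  exists (fun j => ab.1 * (c j)%:~R) => [j|].
    by rewrite mulrC; apply: PM => //; apply: ring_of_integers_int.
  by rewrite mulr_sumr; apply: eq_bigr => j _; rewrite -mulrzr mulrA mulrAC.
move=> x Wx; have [c ->] := gws x Wx.
by rewrite big1 // => i _; rewrite ws0 mul0rz.
Qed.

(** The form of lying over that the criterion needs: if P generated the unit ideal of the integers O
    of F, then O = P O and O would vanish by [nakayama]. *)
Lemma extended_ideal_proper (F : {subfield L}) (s : seq (L * L)) :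
  (E <= F)%VS ->
  (forall ab, ab \in s -> ring_of_integers F ab.1 /\ P ab.2) ->
  \sum_(ab <- s) ab.1 * ab.2 <> 1.
Proof.
move=> sEF hs s1; suff /eqP : (1 : L) = 0 by rewrite oner_eq0.
apply: (nakayama (W := ring_of_integers F)); last exact: ring_of_integers1.
- exact: ring_of_integers0.
- exact: ring_of_integersB.
- by move=> x [].
move=> x Ox; exists [seq (ab.2, x * ab.1) | ab <- s].
  move=> _ /mapP[ab /hs[Oa Pb] ->] /=; split => //; exact: ring_of_integersM.
rewrite big_map -[x in LHS]mulr1 -s1 mulr_sumr; apply: eq_bigr => ab _ /=.
by ring.
Qed.

End Nakayama.

(** * Nonzero prime ideals are maximal *)

Section PrimeIdeal.
Variables (L : splittingFieldType rat) (E : {subfield L}) (P : L -> Prop).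
Hypotheses (pP : prime_ideal E P) (nzP : nonzero_ideal P).

Let iP : integral_ideal E P. Proof. by case: pP. Qed.
Let P1 : ~ P 1. Proof. by case: pP. Qed.
Let P0 : P 0. Proof. by case: iP. Qed.
Let PO x : P x -> ring_of_integers E x. Proof. by case: iP => + _ _ _; apply. Qed.
Let PM x y : ring_of_integers E x -> P y -> P (x * y). Proof. by case: iP => _ _ _; apply. Qed.
Let Pprime x y : ring_of_integers E x -> ring_of_integers E y -> P (x * y) -> P x \/ P y.
Proof. by case: pP => _ _; apply. Qed.

Lemma ring_of_integers_horner (q : {poly int}) x :
  ring_of_integers E x -> ring_of_integers E (map_poly intr q).[x].
Proof.
move=> Ox; rewrite horner_coef; apply: ring_of_integers_sum => i _.
apply: ring_of_integersM; last exact: ring_of_integersX.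
by rewrite coef_map; apply: ring_of_integers_int.
Qed.

Lemma monic_mulX_addC (p : {poly int}) : p \is monic -> p != 1 ->
  exists q c, [/\ p = q * 'X + c%:P, q \is monic & (size q < size p)%N].
Proof.
elim/poly_ind: p => [|q c _]; first by rewrite monicE lead_coef0.
have [->|nzq] := eqVneq q 0.
  by rewrite mul0r add0r monicE lead_coefC => /eqP->; rewrite eqxx.
have szq : size (q * 'X) = (size q).+1 by rewrite size_mulX.
move=> mon_p _; exists q, c; split => //; last by rewrite size_MXaddC (negPf nzq).
by move: mon_p; rewrite !monicE lead_coefDl ?lead_coefMX // szq ltnS (leq_trans (size_polyC_leq1 c)) // lt0n size_poly_eq0.
Qed.

(** Factors X of a monic integer polynomial with root x can be divided out, x being nonzero; the
    constant coefficient that remains is nonzero and a multiple of x. *)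
Lemma prime_ideal_nat : exists2 n : nat, (0 < n)%N & P n%:R.
Proof.
have [x Px nzx] := nzP; have [Ex [p mon_p px]] := PO Px.
have Ox := PO Px.
have [k le_k] : exists k, (size p <= k)%N by exists (size p).
elim: k p mon_p px le_k => [|k IH] p mon_p px le_k.
  by move: mon_p; rewrite leqn0 size_poly_eq0 in le_k; rewrite (eqP le_k) monicE lead_coef0.
have [p1|np1] := eqVneq p 1; first by move: px; rewrite p1 rmorph1 (negPf (root1 x)).
have [q [c [Dp mon_q lt_q]]] := monic_mulX_addC mon_p np1.
move: px; rewrite /root Dp rmorphD rmorphM /= map_polyX map_polyC hornerD hornerMX hornerC.
have [->|nzc] := eqVneq c 0.
  rewrite addr0 mulf_eq0 (negPf nzx) orbF => qx; apply: (IH q) => //.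
  by rewrite -ltnS (leq_trans lt_q).
rewrite addrC addr_eq0 => /eqP Dc.
have Pc : P c%:~R.
  by rewrite Dc; apply: (ideal_opp iP); apply: PM => //; apply: ring_of_integers_horner.
exists `|c|%N; first by rewrite absz_gt0.
rewrite -[_%:R]/((`|c|%N : int)%:~R) abszE; case: (ger0P c) => _ //.
by rewrite mulrNz; apply: (ideal_opp iP).
Qed.

Lemma prime_ideal_char : exists n : nat,
  [/\ (0 < n)%N, P n%:R & forall m, (0 < m < n)%N -> ~ P m%:R].
Proof.
have [n] := prime_ideal_nat; elim/ltn_ind: n => n IH n0 Pn.
case: (classic (exists2 m, (0 < m < n)%N & P m%:R)) => [[m /andP[m0 lt_m] Pm]|none].
  exact: (IH m).
by exists n; split => // m hm Pm; apply: none; exists m.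
Qed.

(** The least positive integer n of P acts as a prime number. With g the gcd of c and n, g = n would
    put c in P, and 1 < g < n would put g or n / g in P; hence g = 1, and Bezout's relation gives
    u. *)
Lemma invert_int (c : int) : ~ P c%:~R -> exists u : int, P (c%:~R * u%:~R - 1).
Proof.
have [n [n0 Pn min_n]] := prime_ideal_char => nPc.
have [u [v Duv]] := Bezoutz c n.
have [g Dg] : exists g : nat, gcdz c n = g :> int by exists (gcdn `|c| `|n|).
have dvd_gn : (g %| n)%N by have := dvdz_gcdr c n; rewrite Dg dvdzE.
have g0 : (0 < g)%N by rewrite (dvdn_gt0 _ dvd_gn).
have g1 : g = 1%N.
  have [k Dn] := dvdnP dvd_gn.
  have k0 : (0 < k)%N by move: n0; rewrite Dn muln_gt0 => /andP[].
  have [gn|ltgn] := leqP n g.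
    have {}gn : g = n by apply/eqP; rewrite eqn_leq gn dvdn_leq.
    case: nPc; have /dvdzP[w ->] : (n %| c)%Z by rewrite -gn -Dg dvdz_gcdl.
    by rewrite rmorphM /=; apply: PM => //; apply: ring_of_integers_int.
  case: (ltnP 1 g) => [g1|g1]; last by apply/eqP; rewrite eqn_leq g1.
  have ltkn : (k < n)%N by rewrite Dn ltn_Pmulr.
  have [] : P k%:R \/ P g%:R.
    apply: Pprime; try exact: (ring_of_integers_int _ (Posz _)).
    by rewrite -natrM -Dn.
  - by move/(min_n k); rewrite k0 ltkn; case.
  - by move/(min_n g); rewrite g0 ltgn; case.
exists u; have -> : (c%:~R * u%:~R - 1 : L) = - v%:~R * n%:R.
  apply/eqP; rewrite -subr_eq0; apply/eqP.
  have := congr1 (fun z : int => z%:~R : L) Duv; rewrite Dg g1 rmorphD !rmorphM /= => D1.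
  have D2 : u%:~R * c%:~R = 1 - v%:~R * n%:R :> L by apply/eqP; rewrite eq_sym subr_eq; apply/eqP/esym.
  by rewrite [c%:~R * _]mulrC D2; ring.
by apply: PM => //; apply/ring_of_integersN/ring_of_integers_int.
Qed.

(** Descent on the degree of a monic integer polynomial q X + c whose value at z lies in P. If c is
    in P, so is q(z), by primality; otherwise c is invertible modulo P, and z (- q(z)) is c modulo
    P. *)
Lemma prime_ideal_maximal z : ring_of_integers E z -> ~ P z ->
  exists2 u, ring_of_integers E u & P (z * u - 1).
Proof.
move=> Oz nPz; have [_ [p mon_p pz]] := Oz.
have {pz} : P (map_poly intr p).[z] by rewrite (eqP pz).
have [k le_k] : exists k, (size p <= k)%N by exists (size p).
elim: k p mon_p le_k => [|k IH] p mon_p le_k pz.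
  by move: mon_p; rewrite leqn0 size_poly_eq0 in le_k; rewrite (eqP le_k) monicE lead_coef0.
have [p1|np1] := eqVneq p 1; first by case: P1; move: pz; rewrite p1 rmorph1 hornerC.
have [q [c [Dp mon_q lt_q]]] := monic_mulX_addC mon_p np1.
move: pz; rewrite Dp rmorphD rmorphM /= map_polyX map_polyC hornerD hornerMX hornerC /= => pz.
have Oq := ring_of_integers_horner q Oz.
case: (classic (P c%:~R)) => [Pc|/invert_int[u Pu]].
  have : P ((map_poly intr q).[z] * z).
    by rewrite -[_ * z](addrK c%:~R); apply: (idealB iP).
  case/Pprime => // Pq; apply: (IH q) => //.
  by rewrite -ltnS (leq_trans lt_q).
exists (- (map_poly intr q).[z] * u%:~R).
  by apply: ring_of_integersM; [apply: ring_of_integersN | apply: ring_of_integers_int].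
move: pz Pu; set Q := (map_poly intr q).[z] in Oq * => pz Pu.
have -> : z * (- Q * u%:~R) - 1 = (c%:~R * u%:~R - 1) - u%:~R * (Q * z + c%:~R) by ring.
by apply: (idealB iP) => //; apply: PM => //; apply: ring_of_integers_int.
Qed.

End PrimeIdeal.

(** * A criterion for unramifiedness *)

(* The differences b - g b generate the unit ideal of the integers of F, that is,
   no nonzero prime has g in its inertia group. *)
Definition unit_difference (L : splittingFieldType rat) (F : {subfield L}) (g : gal_of F) :=
  exists2 s : seq (L * L),
    forall ab, ab \in s -> ring_of_integers F ab.1 /\ ring_of_integers F ab.2
    & \sum_(ab <- s) ab.1 * (ab.2 - g ab.2) = 1.

Section Criterion.
Variable L : splittingFieldType rat.
Implicit Types (K E F : {subfield L}) (x y : L).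

Lemma ring_of_integers_gal F (g : gal_of F) x :
  ring_of_integers F x -> ring_of_integers F (g x).
Proof.
by case=> Fx ix; split; [apply: memv_gal | apply: (integral_aut (gal_repr g))].
Qed.

Lemma ring_of_integers_trace K F x : galois K F ->
  ring_of_integers F x -> ring_of_integers K (galTrace K F x).
Proof.
move=> gKF Ox; split; first by apply: mem_galTrace => //; case: Ox.
suff [] : ring_of_integers F (galTrace K F x) by [].
by apply: ring_of_integers_sum => g _; apply: ring_of_integers_gal.
Qed.

(* A relation sum a (b - g b) = 1 for each g <> 1 yields, by multiplying over g,
   pairs with sum a (g b) = [g = 1] for all g at once. *)
Lemma separating_pairs K F :
  (forall g : gal_of F, g \in 'Gal(F / K)%g -> g != 1%g -> unit_difference g) ->
  exists2 s : seq (L * L),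
    forall ab, ab \in s -> ring_of_integers F ab.1 /\ ring_of_integers F ab.2
    & forall g : gal_of F, g \in 'Gal(F / K)%g ->
        \sum_(ab <- s) ab.1 * g ab.2 = (g == 1%g)%:R.
Proof.
move=> ud.
suff [s Os [s1 sl]] : exists2 s : seq (L * L),
    forall ab, ab \in s -> ring_of_integers F ab.1 /\ ring_of_integers F ab.2
    & \sum_(ab <- s) ab.1 * (1%g : gal_of F) ab.2 = 1 /\
      forall g : gal_of F, g \in enum ('Gal(F / K)%g :\ 1%g) ->
        \sum_(ab <- s) ab.1 * g ab.2 = 0.
  exists s => // g Gg; have [->|ng] := eqVneq g 1%g; first by rewrite s1.
  by apply: sl; rewrite mem_enum !inE ng.
have : {subset enum ('Gal(F / K)%g :\ 1%g) <= 'Gal(F / K)%g :\ 1%g}.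
  by move=> g; rewrite mem_enum.
elim: (enum _) => [|g l IH] sub.
  exists [:: (1, 1)]; last by rewrite big_seq1 gal_id mulr1; split.
  by move=> ab; rewrite inE => /eqP->; split; apply: ring_of_integers1.
have [|s Os [s1 sl]] := IH; first by move=> h hl; apply: sub; rewrite inE hl orbT.
have /setD1P[ng Gg] := sub g (mem_head _ _).
have [||r Or r1] := ud g^-1%g; [by rewrite groupV | by rewrite invg_eq1 |].
(* At an automorphism h, the pairs of r' give the sum of a (b - (g^-1 h) b): this is 1 for h = 1 and
   0 for h = g. *)
pose r' := [seq (ab.1 * ab.2, 1) | ab <- r] ++ [seq (- ab.1, g^-1%g ab.2) | ab <- r].
have Or' ab : ab \in r' -> ring_of_integers F ab.1 /\ ring_of_integers F ab.2.
  rewrite mem_cat => /orP[] /mapP[cd /Or[Oc Od] ->] /=; split.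
  - exact: ring_of_integersM.
  - exact: ring_of_integers1.
  - exact: ring_of_integersN.
  - exact: ring_of_integers_gal.
have r'E (h : gal_of F) : \sum_(ab <- r') ab.1 * h ab.2
    = \sum_(ab <- r) ab.1 * (ab.2 - (g^-1 * h)%g ab.2).
  rewrite big_cat !big_map /= -big_split; rewrite !big_seq; apply: eq_bigr => ab /Or[_ [Fb _]].
  by rewrite rmorph1 galM // mulr1 mulrBr mulNr.
exists [seq (ab.1 * cd.1, ab.2 * cd.2) | ab <- s, cd <- r'].
  move=> _ /allpairsP[[ab cd] [/Os[Oa Ob] /Or'[Oc Od] ->]] /=.
  by split; apply: ring_of_integersM.
have sE (h : gal_of F) : \sum_(ab <- [seq (ab.1 * cd.1, ab.2 * cd.2) | ab <- s, cd <- r']) ab.1 * h ab.2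
   = (\sum_(ab <- s) ab.1 * h ab.2) * (\sum_(ab <- r') ab.1 * h ab.2).
  rewrite big_allpairs_dep mulr_suml; apply: eq_bigr => ab _.
  by rewrite mulr_sumr; apply: eq_bigr => cd _ /=; rewrite rmorphM mulrACA.
split; first by rewrite sE s1 mul1r r'E mulg1 r1.
move=> h; rewrite inE => /orP[/eqP->|hl]; rewrite sE; last by rewrite sl // mul0r.
by rewrite r'E mulVg [X in _ * X]big1 ?mulr0 // => ab _; rewrite gal_id subrr mulr0.
Qed.

Lemma gal_fixed K F (g : gal_of F) x : (K <= F)%VS -> g \in 'Gal(F / K)%g -> x \in K -> g x = x.
Proof. by move=> sKF Gg Kx; apply: (fixed_gal sKF Gg). Qed.

Section Unramified.
Variables K E F : {subfield L}.
Hypotheses (sKE : (K <= E)%VS) (sEF : (E <= F)%VS).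
Hypotheses (gKF : galois K F) (gKE : galois K E).
Hypothesis ud : forall g : gal_of F, g \in 'Gal(F / K)%g -> g != 1%g -> unit_difference g.

Let sKF : (K <= F)%VS := subv_trans sKE sEF.
Let gEF : galois E F. Proof. by apply: galoisS gKF; rewrite sKE. Qed.

Lemma gal_normal (g : gal_of F) x : g \in 'Gal(F / K)%g -> x \in E -> g x \in E.
Proof.
move=> Gg Ex; have nKE : normalField K E by case/and3P: gKE.
have sKEF : (K <= E <= F)%VS by rewrite sKE.
have : kAut K F (gal_repr g) by rewrite -gal_kAut.
move/(normalField_kAut sKEF nKE) => /andP[_ /eqP <-].
exact: memv_img.
Qed.

Lemma normal_gal_ring (g : gal_of F) x : g \in 'Gal(F / K)%g ->
  ring_of_integers E x -> ring_of_integers E (g x).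
Proof.
move=> Gg [Ex ix]; split; first exact: gal_normal.
exact: (integral_aut (gal_repr g)).
Qed.

Variable P : L -> Prop.
Hypotheses (pP : prime_ideal E P) (nzP : nonzero_ideal P).

Let iP : integral_ideal E P. Proof. by case: pP. Qed.
Let P1 : ~ P 1. Proof. by case: pP. Qed.
Let PO x : P x -> ring_of_integers E x. Proof. by case: iP => + _ _ _; apply. Qed.
Let PM x y : ring_of_integers E x -> P y -> P (x * y). Proof. by case: iP => _ _ _; apply. Qed.

(* When g P differs from P take c outside P with g c in P; otherwise c = 1. *)
Lemma conjugate_multiplier (g : gal_of F) : g \in 'Gal(F / K)%g ->
  exists c, [/\ ring_of_integers E c, ~ P c & forall x, P x -> P (g (x * c))].
Proof.
move=> Gg.
case: (classic (exists c, [/\ ring_of_integers E c, ~ P c & P (g c)])) => [[c [Oc nPc Pgc]]|none].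
  exists c; split => // x Px; rewrite rmorphM /=; apply: PM => //.
  by apply: normal_gal_ring => //; apply: PO.
exists 1; split=> [||x Px]; [exact: ring_of_integers1 | by [] |].
rewrite mulr1.
have Ok k : ring_of_integers E ((g ^+ k)%g x).
  by apply: normal_gal_ring; [rewrite groupX | apply: PO].
(* Without such a c, membership of g^(k+1) x in P passes to g^k x. Starting from the order of g,
   where the power acts trivially, this descends to g x. *)
have down k : P ((g ^+ k.+1)%g x) -> P ((g ^+ k)%g x).
  rewrite expgSr galM; last by apply: (subvP sEF); case: (PO Px).
  move=> Pgk; apply: NNPP => nPk; apply: none; exists ((g ^+ k)%g x); split => //.
have : P ((g ^+ #[g]%g)%g x) by rewrite expg_order gal_id.
rewrite -[g in X in _ -> X](expg1 g).
have : (0 < #[g]%g)%N by exact: order_gt0.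
elim: (#[g]%g) => // -[|n] IH // _ Pn; apply: IH => //; exact: down.
Qed.

Lemma conjugates_multiplier : exists c, [/\ ring_of_integers E c, ~ P c &
  forall x (g : gal_of F), g \in 'Gal(F / K)%g -> P x -> P (g (x * c))].
Proof.
have ex (g : gal_of F) : exists c, [/\ ring_of_integers E c, ~ P c &
    g \in 'Gal(F / K)%g -> forall x, P x -> P (g (x * c))].
  have [Gg|nGg] := boolP (g \in 'Gal(F / K)%g).
    by have [c [Oc nPc Pc]] := conjugate_multiplier Gg; exists c.
  by exists 1; split => //; exact: ring_of_integers1.
have [c hc] := fin_all_exists ex.
have [Oc nPc] : ring_of_integers E (\prod_(g in 'Gal(F / K)%g) c g) /\
    ~ P (\prod_(g in 'Gal(F / K)%g) c g).
  apply: (big_ind (fun x => ring_of_integers E x /\ ~ P x)) => [|x y [Ox nx] [Oy ny]|g _].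
  - by split; [exact: ring_of_integers1|].
  - split; first exact: ring_of_integersM.
    by have [_ _ prP] := pP; case/prP.
  by have [] := hc g.
exists (\prod_(g in 'Gal(F / K)%g) c g); split=> // x g Gg Px.
rewrite (bigD1 g) //= mulrCA mulrC; have [_ _ Pc] := hc g; apply: Pc => //.
apply: (ideal_mulr iP) => //.
by apply: ring_of_integers_prod => h _; case: (hc h).
Qed.

(* P is finitely generated, so P = P^2 would contradict Nakayama's lemma. *)
Lemma square_ideal_proper : exists2 x, P x & ~ ideal_exp E P 2 x.
Proof.
apply: NNPP => none; have [x Px /eqP nzx] := nzP; apply: nzx.
apply: (nakayama iP P1 (W := P)) => // [|y z Py Pz|y /PO[]//|y Py].
- by case: iP.
- exact: (idealB iP).
have [s hs ->] : ideal_exp E P 2 y.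
  by apply: NNPP => nPy; apply: none; exists y.
exists s => // ab /hs[Pa [r hr Db]]; split => //.
rewrite Db big_seq; apply: (ideal_sum _ iP) => cd /hr[Pc Od].
exact: (ideal_mulr iP).
Qed.

Lemma ideal_square_sum (I : eqType) (r : seq I) (f : I -> L) :
  (forall i, i \in r -> ideal_exp E P 2 (f i)) -> ideal_exp E P 2 (\sum_(i <- r) f i).
Proof.
move=> hf; rewrite big_seq; apply: (big_ind (ideal_exp E P 2)) => //.
  by exists [::] => //; rewrite big_nil.
move=> _ _ [s hs ->] [r' hr' ->]; exists (s ++ r'); last by rewrite big_cat.
by move=> ab; rewrite mem_cat => /orP[/hs|/hr'].
Qed.

Lemma ideal_squareM x y : P x -> P y -> ideal_exp E P 2 (x * y).
Proof.
move=> Px Py; exists [:: (x, y)]; last by rewrite big_seq1.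
move=> ab; rewrite inE => /eqP->; split => //; exists [:: (y, 1)].
  by move=> cd; rewrite inE => /eqP->; split => //; apply: ring_of_integers1.
by rewrite big_seq1 mulr1.
Qed.

Lemma ideal_square_mulr x y : ideal_exp E P 2 x -> ring_of_integers E y ->
  ideal_exp E P 2 (x * y).
Proof.
move=> [s hs ->] Oy; rewrite mulr_suml; apply: ideal_square_sum => ab /hs[Pa [r hr ->]].
rewrite mulr_sumr mulr_suml; apply: ideal_square_sum => cd /hr[Pc Od].
rewrite -!mulrA; apply: ideal_squareM => //; apply: (ideal_mulr iP) => //.
exact: ring_of_integersM.
Qed.

(* If p in P has all its conjugates over K in P, then Tr_{F/K}(b p) lies in P and
   p = sum a Tr_{F/K}(b p) over the separating pairs. Multiplying by u and taking
   traces down to E would put p Tr_{F/E}(u) in P^2 if P^2 contained the ideal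
   generated by the intersection of P with K. *)
Lemma unramified_at : ramification_index E K P 1.
Proof.
split.
  move=> x [s hs ->]; exists s => // ab /hs[[_ Pa] Ob]; split=> //.
move=> sub2; have [x Px nP2x] := square_ideal_proper; apply: nP2x.
have [s Os sE] := separating_pairs ud.
have [c [Oc nPc conjP]] := conjugates_multiplier.
have [p Dp] : {p | p = x * c} by exists (x * c).
have Pp : P p by rewrite Dp; apply: (ideal_mulr iP).
have Op := PO Pp; have Fp : p \in F by apply: (subvP sEF); case: Op.
have OF y : ring_of_integers E y -> ring_of_integers F y by apply: ring_of_integersS.
have H1 : (1%g : gal_of F) \in 'Gal(F / K)%g by exact: group1.
have pE : \sum_(ab <- s) ab.1 * galTrace K F (ab.2 * p) = p.
  transitivity (\sum_(g in 'Gal(F / K)%g) (\sum_(ab <- s) ab.1 * g ab.2) * g p).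
    rewrite [RHS](eq_bigr (fun g : gal_of F => \sum_(ab <- s) ab.1 * g (ab.2 * p))).
      by rewrite exchange_big /=; apply: eq_bigr => ab _; rewrite mulr_sumr.
    by move=> g _; rewrite mulr_suml; apply: eq_bigr => ab _; rewrite rmorphM /= mulrA.
  rewrite (bigD1 1%g) //= sE // eqxx mul1r gal_id big1 ?addr0 // => g /andP[Gg ng].
  by rewrite sE // (negPf ng) mul0r.
(* If all traces to E lay in P, the relation sum a Tr(b) = 1 given by the separating pairs would
   contradict [extended_ideal_proper]. *)
have [u Ou nPu] : exists2 u, ring_of_integers F u & ~ P (galTrace E F u).
  apply: NNPP => none; have := @extended_ideal_proper _ _ _ iP P1 F
    [seq (ab.1, galTrace E F ab.2) | ab <- s] sEF; case.
    move=> _ /mapP[ab /Os[Oa Ob] ->] /=; split => //.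
    by apply: NNPP => nPb; apply: none; exists ab.2.
  rewrite big_map /= ; transitivity (\sum_(g in 'Gal(F / E)%g) (\sum_(ab <- s) ab.1 * g ab.2)).
    rewrite exchange_big /=; apply: eq_bigr => ab _; rewrite mulr_sumr //.
  rewrite (bigD1 1%g) //= sE // eqxx big1 ?addr0 // => g /andP[Gg ng].
  by rewrite sE ?(negPf ng) //; apply: (subsetP (galS F sKE)).
(* The trace combines the conjugates g p, all in P, but with coefficients g b that need not be in E.
   Were it outside P, it would be invertible modulo P, and P would generate the unit ideal in F. *)
have Ptr b : ring_of_integers F b -> P (galTrace K F (b * p)).
  move=> Ob; have Ot : ring_of_integers E (galTrace K F (b * p)).
    by apply: (ring_of_integersS sKE); apply: ring_of_integers_trace => //; apply: ring_of_integersM => //; apply: OF.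
  apply: NNPP => nPt; have [w Ow Pw] := prime_ideal_maximal pP nzP Ot nPt.
  have := @extended_ideal_proper _ _ _ iP P1 F
    ((1, - (galTrace K F (b * p) * w - 1)) ::
     [seq (w * (g : gal_of F) b, g p) | g <- enum 'Gal(F / K)%g]) sEF; case.
    move=> ab; rewrite inE => /orP[/eqP->|/mapP[g]] /=.
      by split; [exact: ring_of_integers1 | apply: (ideal_opp iP)].
    rewrite mem_enum => Gg -> /=; split; last by rewrite Dp; apply: conjP.
    by apply: ring_of_integersM; [exact: OF | exact: ring_of_integers_gal].
  rewrite big_cons big_map /= -/(index_enum _) big_enum /=.
  rewrite (eq_bigr (fun g : gal_of F => w * g (b * p))); last first.
    by move=> g _; rewrite rmorphM mulrA.
  by rewrite -mulr_sumr -/(galTrace K F (b * p)); ring.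
have P2 : ideal_exp E P 2 (p * galTrace E F u).
  suff -> : p * galTrace E F u =
     \sum_(ab <- s) galTrace K F (ab.2 * p) * galTrace E F (ab.1 * u).
    apply: ideal_square_sum => ab /Os[Oa Ob]; apply: sub2.
    exists [:: (galTrace K F (ab.2 * p), galTrace E F (ab.1 * u))]; last by rewrite big_seq1.
    move=> cd; rewrite inE => /eqP-> /=; split; last first.
      by apply: ring_of_integers_trace => //; apply: ring_of_integersM.
    split; last exact: Ptr.
    apply: mem_galTrace => //; apply: rpredM => //; by case: Ob.
  have trE z v : z \in E -> galTrace E F (z * v) = z * galTrace E F v.
    move=> Ez; rewrite /galTrace mulr_sumr; apply: eq_bigr => g Gg.
    by rewrite rmorphM /= (gal_fixed sEF Gg).
  rewrite -trE; last by case: Op.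
  rewrite -{1}pE mulr_suml raddf_sum big_seq [RHS]big_seq; apply: eq_bigr => ab /Os[Oa [Fb _]].
  rewrite -trE; first by congr galTrace; ring.
  by apply/(subvP sKE)/mem_galTrace => //; apply: rpredM.
have [w Ow Pw] : exists2 w, ring_of_integers E w & P (c * galTrace E F u * w - 1).
  have Ot := ring_of_integers_trace gEF Ou.
  apply: (prime_ideal_maximal pP nzP); first exact: ring_of_integersM.
  by have [_ _ prP] := pP; case/prP.
(* Here c Tr(u) is outside P with inverse w modulo P, so x is recovered from x c Tr(u) in P^2 up to
   a product of two elements of P. *)
have -> : x = \sum_(i <- [:: x * c * galTrace E F u * w; (- x) * (c * galTrace E F u * w - 1)]) i.
  by rewrite big_cons big_seq1; ring.
apply: ideal_square_sum => i; rewrite !inE => /orP[] /eqP->.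
  by rewrite -Dp; apply: ideal_square_mulr.
by apply: ideal_squareM => //; apply: (ideal_opp iP).
Qed.

End Unramified.

Lemma unramified_of_unit_difference K E F : (K <= E)%VS -> (E <= F)%VS ->
  galois K F -> galois K E ->
  (forall g : gal_of F, g \in 'Gal(F / K)%g -> g != 1%g -> unit_difference g) ->
  unramified_finite K E.
Proof. by move=> sKE sEF gKF gKE ud P pP nzP; apply: unramified_at ud _ pP nzP. Qed.

End Criterion.

(** * Embeddings into the algebraic numbers *)

Lemma rmorphism_of_graph (R S T : fieldType) (f : {rmorphism R -> T}) (j : {rmorphism S -> T}) :
  (forall x, exists y, j y = f x) -> exists i : {rmorphism R -> S}, forall x, j (i x) = f x.
Proof.
move=> ex; pose i x := sval (sig_eqW (ex x)).
have iE x : j (i x) = f x by rewrite /i; case: (sig_eqW _).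
have iB : zmod_morphism i.
  by move=> x y; apply: (fmorph_inj j); rewrite rmorphB /= !iE rmorphB.
have iM : monoid_morphism i.
  by split=> [|x y]; apply: (fmorph_inj j); rewrite ?rmorphM /= ?iE ?rmorph1 ?rmorphM.
pose ib := GRing.isZmodMorphism.Build R S i iB.
pose im := GRing.isMonoidMorphism.Build R S i iM.
pose ir : {rmorphism R -> S} := HB.pack i ib im.
by exists ir.
Qed.

(** A primitive element x is sent to a complex root z of its minimal polynomial, and p(x) to p(z).
    The choice of p does not matter, because the minimal polynomial divides the difference of two
    choices. *)
Lemma algC_embedding (L : splittingFieldType rat) : exists f : {rmorphism L -> algC}, True.
Proof.
have sepL : separable 1 {:L}.
  by apply/separableP => x _; apply: pcharf0_separable => p; rewrite pchar_lalg pchar_num.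
set x := separable_generator 1%VS {:L}.
have Lx : {:L}%VS = <<1; x>>%VS by apply: eq_adjoin_separable_generator sepL (sub1v _).
have /polyOver1P[q Dq] := minPolyOver 1%AS x.
have [z qz] : exists z : algC, root (map_poly ratr q) z.
  apply/closed_rootP; rewrite size_map_poly -(size_map_poly (in_alg L)) -Dq.
  by rewrite size_minPoly eqSS -lt0n.
have hx (u : L) : exists p : {poly rat}, (map_poly (in_alg L) p).[x] = u.
  have /Fadjoin_polyP[p /polyOver1P[p0 ->] ->] : u \in <<1; x>>%VS by rewrite -Lx memvf.
  by exists p0.
pose P u := sval (sig_eqW (hx u)).
have PE u : (map_poly (in_alg L) (P u)).[x] = u by rewrite /P; case: (sig_eqW _).
pose f u : algC := (map_poly ratr (P u)).[z].
have fE p : f (map_poly (in_alg L) p).[x] = (map_poly ratr p).[z].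
  apply/eqP; rewrite -subr_eq0 -hornerN -hornerD -rmorphN -rmorphD /= -/(root _ _).
  have : minPoly 1%AS x %| map_poly (in_alg L) (P (map_poly (in_alg L) p).[x] - p).
    apply: minPoly_dvdp; first by apply/polyOver1P; exists (P (map_poly (in_alg L) p).[x] - p).
    by rewrite /root rmorphB hornerD hornerN PE subrr.
  rewrite Dq dvdp_map -(dvdp_map (ratr : {rmorphism rat -> algC})) => /dvdpP[r ->].
  by rewrite rootM qz orbT.
have fB : zmod_morphism f.
  by move=> u v; rewrite -{1}(PE u) -{1}(PE v) -hornerN -hornerD -rmorphN -rmorphD fE rmorphB hornerD hornerN.
have fM : monoid_morphism f.
  split=> [|u v]; first by have := fE 1; rewrite !rmorph1 !hornerC.
  by rewrite -{1}(PE u) -{1}(PE v) -hornerM -rmorphM fE rmorphM hornerM.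
pose fb := GRing.isZmodMorphism.Build L algC f fB.
pose fm := GRing.isMonoidMorphism.Build L algC f fM.
pose fr : {rmorphism L -> algC} := HB.pack f fb fm.
by exists fr.
Qed.

Lemma algC_splitting_field (zs : seq algC) :
  exists (L : splittingFieldType rat) (j : {rmorphism L -> algC}),
    forall z, z \in zs -> exists x, j x = z.
Proof.
have [f0 nz_f0 f0zs] : exists2 f : {poly rat}, f \is monic &
    forall z, z \in zs -> root (map_poly ratr f) z.
  elim: zs => [|z zs [f nzf hf]]; first by exists 1; rewrite ?monic1.
  have [p [_ mon_p] dv_p] := minCpolyP z.
  exists (p * f) => [|w]; first by rewrite rpredM.
  rewrite inE rmorphM /= rootM => /orP[/eqP->|/hf->]; last by rewrite orbT.
  by rewrite dv_p dvdpp.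
have [rs Drs] := closed_field_poly_normal (map_poly (ratr : rat -> algC) f0).
have mon_f0 : lead_coef (map_poly (ratr : rat -> algC) f0) = 1.
  by apply/monicP; rewrite monic_map.
rewrite mon_f0 scale1r in Drs.
have [Qs [j [s1 Ds1 gen]]] := num_field_exists rs.
have split1 : SplittingField.axiom Qs.
  exists (map_poly (in_alg Qs) f0); first by apply/polyOver1P; exists f0.
  exists s1 => //; rewrite (_ : map_poly _ _ = \prod_(z <- s1) ('X - z%:P)) ?eqpxx //.
  apply: (map_poly_inj j); rewrite -map_poly_comp.
  rewrite (eq_map_poly (g := ratr)) => [|a]; last by rewrite /= alg_num_field fmorph_rat.
  rewrite Drs -Ds1 big_map rmorph_prod; apply: eq_bigr => z _.
  by rewrite /= map_polyXsubC.
pose mix := FieldExt_isSplittingField.Build rat Qs split1.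
pose L : splittingFieldType rat := HB.pack Qs mix.
exists L, (j : {rmorphism L -> algC}) => z /f0zs.
rewrite Drs root_prod_XsubC -Ds1 => /mapP[x _ ->]; by exists x.
Qed.

(** Yields one ambient number field containing a copy of L together with prescribed algebraic
    numbers; it is applied to zeta, epsilon, rho and eta. *)
Lemma common_splitting_field (L : splittingFieldType rat) (f : {rmorphism L -> algC}) (zs : seq algC) :
  exists (L' : splittingFieldType rat) (j : {rmorphism L' -> algC}) (i : 'AHom(L, L')),
    (forall x, j (i x) = f x) /\ forall z, z \in zs -> exists x, j x = z.
Proof.
have [L' [j jP]] := algC_splitting_field (map f (vbasis {:L}) ++ zs).
have [i iE] : exists i : {rmorphism L -> L'}, forall x, j (i x) = f x.
  apply: rmorphism_of_graph => x.
  have hb k : exists y, j y = f (vbasis {:L})`_k.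
    have [lt_k|ge_k] := ltnP k (size (vbasis {:L})).
      by apply: jP; rewrite mem_cat map_f ?mem_nth.
    by exists 0; rewrite nth_default // !rmorph0.
  have [y yE] := fin_all_exists (fun k : 'I_(\dim {:L}) => hb k).
  exists (\sum_k coord (vbasis {:L}) k x *: y k).
  rewrite {2}(coord_vbasis (memvf x)) !rmorph_sum; apply: eq_bigr => k _.
  by rewrite !rmorphZ_num yE.
pose ib := GRing.isZmodMorphism.Build L L' i (rmorphB i).
pose im := GRing.isMonoidMorphism.Build L L' i (rmorph1 i, rmorphM i).
pose isc := GRing.isScalable.Build rat L L' *:%R i (fmorph_numZ i).
pose il : {lrmorphism L -> L'} := HB.pack (GRing.RMorphism.sort i) ib im isc.
exists L', j, (linfun_ahom il); split=> [x|z zsz]; first by rewrite lfunE /= iE.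
by apply: jP; rewrite mem_cat zsz orbT.
Qed.

(** * Change of the ambient field *)

Section Transfer.
Variables (L L' : splittingFieldType rat) (i : 'AHom(L, L')).
Implicit Types (K E : {subfield L}) (P : L -> Prop).

Lemma memv_aimg K x : (i x \in (i @: K)%AS) = (x \in K).
Proof.
apply/idP/idP => [/memv_imgP[y Ky]|]; last exact: memv_img.
by move/(fmorph_inj i) => ->.
Qed.

Definition image_ideal P (y : L') : Prop := exists2 x, P x & y = i x.

Lemma image_idealE P x : image_ideal P (i x) <-> P x.
Proof. by split=> [[y Py /(fmorph_inj i)->]|Px]; [|exists x]. Qed.

Lemma ring_of_integers_aimg E x :
  ring_of_integers (i @: E)%AS (i x) <-> ring_of_integers E x.
Proof.
rewrite /ring_of_integers memv_aimg; split=> -[Ex [p mon_p px]]; split => //.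
  exists p => //; rewrite -(fmorph_root i) -map_poly_comp.
  by rewrite (eq_map_poly (g := intr)) // => n; rewrite /= rmorph_int.
by apply: integral_aut; exists p.
Qed.

Lemma ring_of_integers_image E y : ring_of_integers (i @: E)%AS y ->
  exists2 x, ring_of_integers E x & y = i x.
Proof.
move=> Oy; have [/memv_imgP[x Ex Dy] _] := Oy.
by exists x => //; apply/ring_of_integers_aimg; rewrite -Dy.
Qed.

Lemma image_ideal_mul P (Q : L -> Prop) x :
  ideal_mul P Q x -> ideal_mul (image_ideal P) (image_ideal Q) (i x).
Proof.
move=> [s hs ->]; exists [seq (i ab.1, i ab.2) | ab <- s].
  by move=> _ /mapP[ab /hs[Pa Qb] ->]; split; [exists ab.1 | exists ab.2].
by rewrite big_map rmorph_sum; apply: eq_bigr => ab _; rewrite rmorphM.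
Qed.

Lemma ideal_mulS (P P' Q Q' : L' -> Prop) : sub_ideal P P' -> sub_ideal Q Q' ->
  sub_ideal (ideal_mul P Q) (ideal_mul P' Q').
Proof.
by move=> sP sQ x [s hs ->]; exists s => // ab /hs[Pa Qb]; split; [apply: sP | apply: sQ].
Qed.

Lemma image_ideal_exp E P n x : ideal_exp E P n x ->
  ideal_exp (i @: E)%AS (image_ideal P) n (i x).
Proof.
elim: n x => [|n IH] x /=; first by move/ring_of_integers_aimg.
move=> /image_ideal_mul; apply: ideal_mulS => // _ [y Py ->]; exact: IH.
Qed.

(** Products of ideals are only carried forward along i: generators of the extended contraction in
    the image lift pair by pair, so a containment in the square of P would hold in the image too. *)
Lemma unramified_finite_image K E :
  unramified_finite (i @: K)%AS (i @: E)%AS -> unramified_finite K E.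
Proof.
move=> unr P pP [x0 Px0 nz0]; have [iP P1 prP] := pP; have [PO P0 PD PM] := iP.
have [] := unr (image_ideal P).
- split; first split.
  + by move=> _ [x Px ->]; apply/ring_of_integers_aimg/PO.
  + by exists 0; rewrite ?rmorph0.
  + by move=> _ _ [x Px ->] [y Py ->]; exists (x + y); rewrite ?rmorphD //; apply: PD.
  + move=> x' _ /ring_of_integers_image[x Ox ->] [y Py ->].
    by exists (x * y); rewrite ?rmorphM //; apply: PM.
  + by rewrite -(rmorph1 i) => /image_idealE.
  + move=> _ _ /ring_of_integers_image[x Ox ->] /ring_of_integers_image[y Oy ->].
    by rewrite -rmorphM => /image_idealE/prP[]// ?; [left|right]; apply/image_idealE.
- by exists (i x0); [exists x0 | rewrite fmorph_eq0].
move=> _ nsub2; split.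
  by move=> x [s hs ->]; exists s => // ab /hs[[_ Pa] Ob]; split.
move=> sub2; apply: nsub2 => _ [s hs ->].
have {hs} [r hr ->] : exists2 r : seq (L * L),
    (forall ab, ab \in r -> (ab.1 \in K /\ P ab.1) /\ ring_of_integers E ab.2)
    & s = [seq (i ab.1, i ab.2) | ab <- r].
  elim: s hs => [|[a b] s IH] hs; first by exists [::].
  have [|r hr ->] := IH; first by move=> ab sab; apply: hs; rewrite inE sab orbT.
  have [[Ka [a' Pa Da]] /ring_of_integers_image[b' Ob Db]] := hs (a, b) (mem_head _ _).
  rewrite /= in Ka Da Db; exists ((a', b') :: r); last by rewrite /= Da Db.
  move=> ab; rewrite inE => /orP[/eqP->|/hr] //=; split => //; split => //.
  by rewrite -memv_aimg -Da.
have -> : \sum_(ab <- [seq (i ab.1, i ab.2) | ab <- r]) ab.1 * ab.2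
   = i (\sum_(ab <- r) ab.1 * ab.2).
  by rewrite big_map rmorph_sum; apply: eq_bigr => ab _; rewrite rmorphM.
by apply: image_ideal_exp; apply: sub2; exists r.
Qed.

End Transfer.

(** * The Kummer generator modulo 27 *)

Section Integrality.
Variable L : fieldExtType rat.
Notation integral := (integralOver (intr : int -> L)).

Lemma integral_monic_relation n (c : nat -> L) (x : L) : (0 < n)%N ->
  (forall i, (i < n)%N -> integral (c i)) -> x ^+ n = \sum_(i < n) c i * x ^+ i -> integral x.
Proof.
move=> n0 ic Dx; pose p := 'X^n - \poly_(i < n) c i.
have sz : (size (- \poly_(i < n) c i) < size ('X^n : {poly L}))%N.
  by rewrite size_polyN size_polyXn ltnS size_poly.
apply: (@integral_root_monic _ _ _ _ p).
- by rewrite monicE lead_coefDl // lead_coefXn.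
- by rewrite /root hornerD hornerN hornerXn horner_poly Dx subrr.
apply/integral_poly => i; rewrite coefB coefXn coef_poly.
apply: integral_sub; first by case: eqP => _; [apply: integral1 | apply: integral0].
by case: ltnP => [/ic|_] //; apply: integral0.
Qed.

Lemma integral_exp (x : L) n : integral x -> integral (x ^+ n).
Proof.
by move=> ix; elim: n => [|n IH]; [exact: integral1 | rewrite exprS; apply: integral_mul].
Qed.

Lemma integral_of_exp n (x : L) : (0 < n)%N -> integral (x ^+ n) -> integral x.
Proof.
case: n => // n _ ix; apply: (@integral_monic_relation n.+1 (fun i => if i is 0 then x ^+ n.+1 else 0)) => //.
  by case=> [|i] _ //; apply: integral0.
by rewrite big_ord_recl mulr1 big1 ?addr0 // => i _; rewrite mul0r.
Qed.

(* With w = v - 1, e = (1 + v + ... + v^8)/9 satisfies e w = 3 gamma; dividing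
   the relation (1 + w)^9 = 1 + 27 gamma by w^9 makes it monic in e. *)
Lemma integral_ninth_average (v gamma : L) : integral gamma ->
  v ^+ 9 = 1 + 27 * gamma -> integral (9^-1 * \sum_(k < 9) v ^+ k).
Proof.
move=> ig v9.
have char0 n : n.+1%:R != 0 :> L.
  by have /pcharf0P-> : [pchar L] =i pred0 by move=> p; rewrite pchar_lalg pchar_num.
have [->|nv] := eqVneq v 1.
  rewrite (eq_bigr (fun=> 1)) => [|i _]; last by rewrite expr1n.
  by rewrite sumr_const card_ord mulVf ?(char0 8); [exact: integral1|].
set e := _ * _; pose w := v - 1.
have nw : w != 0 by rewrite subr_eq0.
have ew : e * w = 3 * gamma.
  apply: (mulfI (char0 8)); rewrite /e mulrA mulrA divff ?mul1r ?(char0 8) //.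
  by rewrite mulrC -subrX1 v9 addrAC subrr add0r; ring.
have w9 : (1 + w) ^+ 9 = 1 + 27 * gamma by rewrite /w addrC subrK.
(* The coefficient of e^i is binom(9, i) 3^(6 - i) gamma^(8 - i). It is integral also for i = 7 and
   8, because 3 divides binom(9, 7) and 9 divides binom(9, 8). *)
pose c (i : nat) : L := nth 0 [:: 729 * gamma ^+ 8; 2187 * gamma ^+ 7; 2916 * gamma ^+ 6;
  2268 * gamma ^+ 5; 1134 * gamma ^+ 4; 378 * gamma ^+ 3; 84 * gamma ^+ 2; 12 * gamma; 1] i.
apply: (@integral_monic_relation 9 c) => //.
  have ign a n : integral (a%:R * gamma ^+ n).
    by apply: integral_mul; [apply: integral_nat | apply: integral_exp].
  have ig1 a : integral (a%:R * gamma) by rewrite -[gamma]expr1.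
  by case=> [|[|[|[|[|[|[|[|[|//]]]]]]]]] _; rewrite /c /=;
    first [exact: ign | exact: ig1 | exact: integral1].
apply: (mulIf (expf_neq0 9 nw)); apply/eqP; rewrite -subr_eq0 -mulrBl; apply/eqP.
rewrite !big_ord_recr big_ord0 /c /=.
transitivity ((e * w) ^+ 9 - ((e * w) ^+ 8 * w + 12 * gamma * (e * w) ^+ 7 * w ^+ 2
  + 84 * gamma ^+ 2 * (e * w) ^+ 6 * w ^+ 3 + 378 * gamma ^+ 3 * (e * w) ^+ 5 * w ^+ 4
  + 1134 * gamma ^+ 4 * (e * w) ^+ 4 * w ^+ 5 + 2268 * gamma ^+ 5 * (e * w) ^+ 3 * w ^+ 6
  + 2916 * gamma ^+ 6 * (e * w) ^+ 2 * w ^+ 7 + 2187 * gamma ^+ 7 * (e * w) * w ^+ 8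
  + 729 * gamma ^+ 8 * w ^+ 9)); first ring.
rewrite ew.
transitivity (729 * gamma ^+ 8 * (1 + 27 * gamma - (1 + w) ^+ 9)); first ring.
by rewrite w9 subrr mulr0.
Qed.

End Integrality.

Section SexticCoordinates.

(* Coordinates on the basis 1, e, r, e r, r^2, e r^2. *)
Definition sextic_coord (R : Type) : Type := (R * R * R * R * R * R)%type.

(** Stated over any commutative ring, so that one formula is computed in ['Z_27] and interpreted in
    L, both through the integers. Here p and q are the coordinates of a product in R[e], and (x3,
    y3), (x4, y4) are the coefficients of r^3 and r^4 before reduction. *)
Definition sextic_mul (R : comPzRingType) (t : R) (u v : sextic_coord R) : sextic_coord R :=
  let: (u0, u1, u2, u3, u4, u5) := u in let: (v0, v1, v2, v3, v4, v5) := v in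
  let p a b c d := a * c + b * d in
  let q a b c d := a * d + b * c + (t - 1) * (b * d) in
  let x3 := p u2 u3 v4 v5 + p u4 u5 v2 v3 in let y3 := q u2 u3 v4 v5 + q u4 u5 v2 v3 in
  let x4 := p u4 u5 v4 v5 in let y4 := q u4 u5 v4 v5 in
  (p u0 u1 v0 v1 + x3 - t * x4, q u0 u1 v0 v1 + y3 - t * y4,
   p u0 u1 v2 v3 + p u2 u3 v0 v1 - (t - 3) * x3 + (1 + t * (t - 3)) * x4,
   q u0 u1 v2 v3 + q u2 u3 v0 v1 - (t - 3) * y3 + (1 + t * (t - 3)) * y4,
   p u0 u1 v4 v5 + p u2 u3 v2 v3 + p u4 u5 v0 v1 - t * x3 + (t ^+ 2 - t + 3) * x4,
   q u0 u1 v4 v5 + q u2 u3 v2 v3 + q u4 u5 v0 v1 - t * y3 + (t ^+ 2 - t + 3) * y4).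

Definition sextic_eval (R : comPzRingType) (m : R * R) (u : sextic_coord R) : R :=
  let: (u0, u1, u2, u3, u4, u5) := u in
  u0 + u1 * m.1 + (u2 + u3 * m.1) * m.2 + (u4 + u5 * m.1) * m.2 ^+ 2.

Definition sextic_map (R S : Type) (f : R -> S) (u : sextic_coord R) : sextic_coord S :=
  let: (u0, u1, u2, u3, u4, u5) := u in (f u0, f u1, f u2, f u3, f u4, f u5).

Lemma sextic_evalM (F : fieldType) (t : F) m u v : sextic_point t m ->
  sextic_eval m (sextic_mul t u v) = sextic_eval m u * sextic_eval m v.
Proof.
case: m => e r [/= he hr].
case: u => [[[[[u0 u1] u2] u3] u4] u5]; case: v => [[[[[v0 v1] v2] v3] v4] v5].
by rewrite /sextic_eval /=; ring: he hr.
Qed.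

Lemma sextic_mapM (R S : comPzRingType) (f : {rmorphism R -> S}) t u v :
  sextic_map f (sextic_mul t u v) = sextic_mul (f t) (sextic_map f u) (sextic_map f v).
Proof.
case: u => [[[[[u0 u1] u2] u3] u4] u5]; case: v => [[[[[v0 v1] v2] v3] v4] v5].
by rewrite /sextic_map /sextic_mul; congr (_, _, _, _, _, _); ring.
Qed.

Definition unit_coord (R : comPzRingType) (t : R) (k : nat) : sextic_coord R :=
  match k with
  | 0 => (0, -1, -1, 0, 0, 0)
  | 1 => (3 - t, 1, 1 - t, 0, -1, 0)
  | 2 => (t - 2, -1, t, 0, 1, 0)
  | 3 => (1 - t, 1, -1, 0, 0, 0)
  | 4 => (2, -1, 1 - t, 0, -1, 0)
  | _ => (-1, 1, t, 0, 1, 0)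
  end.

(* Square-and-multiply form of kummer_unit * b^9. *)
Definition kummer_coord (R : comPzRingType) (t : R) (b : sextic_coord R) :=
  let M := sextic_mul t in let u := unit_coord t in
  let a3 := M (u 3) b in
  let a2 := M (M a3 a3) (M (u 2) (M (u 4) (u 5))) in
  let a1 := M (M a2 a2) (M (u 1) (u 4)) in
  M (M a1 a1) (M (u 0) (M (u 4) (M (u 5) b))).

Lemma unit_coordE (F : fieldType) (t : F) m k : sextic_point t m -> (k < 6)%N ->
  sextic_eval m (unit_coord t k) = conj_unit t k m.
Proof.
move=> hm; have [[u0 u1 u2] [u3 u4 u5]] := conj_unitE hm.
case: k => [|[|[|[|[|[|//]]]]]] _; rewrite ?u0 ?u1 ?u2 ?u3 ?u4 ?u5 /sextic_eval /=; ring.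
Qed.

Lemma kummer_coordE (F : fieldType) (t : F) m b : sextic_point t m ->
  sextic_eval m (kummer_coord t b) = kummer_unit t m * sextic_eval m b ^+ 9.
Proof.
move=> hm; rewrite /kummer_coord !sextic_evalM // !unit_coordE //.
rewrite /kummer_unit; move: (conj_unit t 0 m) (conj_unit t 1 m) (conj_unit t 2 m).
move: (conj_unit t 3 m) (conj_unit t 4 m) (conj_unit t 5 m) (sextic_eval m b) => *.
by ring.
Qed.

Lemma kummer_coord_map (R S : comPzRingType) (f : {rmorphism R -> S}) t b :
  sextic_map f (kummer_coord t b) = kummer_coord (f t) (sextic_map f b).
Proof.
have U k : sextic_map f (unit_coord t k) = unit_coord (f t) k.
  by case: k => [|[|[|[|[|k]]]]]; rewrite /sextic_map /=; congr (_, _, _, _, _, _); ring.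
by rewrite /kummer_coord !sextic_mapM !U.
Qed.

Lemma int_Zp27 (n : int) : n%:~R = 0 :> 'Z_27 -> exists q, n = 27 * q.
Proof.
move=> n0; exists (n %/ 27)%Z; rewrite mulrC {1}(divz_eq n 27).
suff -> : (n %% 27)%Z = 0 by rewrite addr0.
have [k Dk] : exists k : nat, (n %% 27)%Z = k by exists `|(n %% 27)%Z|%N; rewrite gez0_abs ?modz_ge0.
have lt_k : (k < 27)%N by have := @ltz_pmod n 27 isT; rewrite Dk.
rewrite Dk; move: n0; rewrite (divz_eq n 27) rmorphD rmorphM /= Dk.
have -> : (27%Z)%:~R = 0 :> 'Z_27 by apply/eqP.
rewrite mulr0 add0r => k0; have : (k%:R : 'Z_27) = 0 by [].
by rewrite Zp_nat => /(congr1 val) /=; rewrite modn_small // => ->.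
Qed.

(* The only place where t is needed modulo 27 and not just modulo 3; the two
   witnesses were found by computer search. *)
Lemma kummer_congruence (L : fieldExtType rat) (t : int) (m : L * L) :
  (t = 5 %[mod 27])%Z \/ (t = 10 %[mod 27])%Z -> sextic_point t%:~R m ->
  exists b c : sextic_coord int,
    kummer_unit t%:~R m * sextic_eval m (sextic_map intr b) ^+ 9
    = 1 + 27 * sextic_eval m (sextic_map intr c).
Proof.
move=> ht hm.
have [b Zb] : exists b : sextic_coord int,
    kummer_coord (t%:~R : 'Z_27) (sextic_map intr b) = (1, 0, 0, 0, 0, 0).
  have tZ a : (t = a %[mod 27])%Z -> (t%:~R = a%:~R :> 'Z_27).
    move=> ta; rewrite (divz_eq t 27) (divz_eq a 27) ta !rmorphD !rmorphM /=.
    have -> : (27%Z)%:~R = 0 :> 'Z_27 by apply/eqP.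
    by rewrite !mulr0.
  case: ht => /tZ ->.
    by exists (-1, -1, 1, 1, -1, 0); apply/eqP; vm_compute.
  by exists (-1, 1, 0, -1, -1, 1); apply/eqP; vm_compute.
have := kummer_coord_map (intr : {rmorphism int -> 'Z_27}) t b; rewrite {}Zb.
have := kummer_coord_map (intr : {rmorphism int -> L}) t b.
case: (kummer_coord t b) => [[[[[u0 u1] u2] u3] u4] u5] E [z0 z1 z2 z3 z4 z5].
have [c0 D0] : exists q, u0 - 1 = 27 * q by apply: int_Zp27; rewrite rmorphB /= z0 subrr.
have [c1 D1] := int_Zp27 z1; have [c2 D2] := int_Zp27 z2; have [c3 D3] := int_Zp27 z3.
have [c4 D4] := int_Zp27 z4; have [c5 D5] := int_Zp27 z5.
exists b, (c0, c1, c2, c3, c4, c5); rewrite -kummer_coordE // -E.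
have {}D0 : u0 = 27 * c0 + 1 by rewrite -D0 subrK.
by rewrite D0 D1 D2 D3 D4 D5 /sextic_eval /sextic_map /=; ring.
Qed.

End SexticCoordinates.

(** * Differences of integers in the Kummer field *)

Section DifferenceIdeal.
Variables (L : splittingFieldType rat) (F : {subfield L}) (g : gal_of F).
Notation OF := (ring_of_integers F).

(** For x = 1 this is [unit_difference g]. *)
Definition difference_ideal (x : L) := exists2 s : seq (L * L),
  forall ab, ab \in s -> OF ab.1 /\ OF ab.2 & \sum_(ab <- s) ab.1 * (ab.2 - g ab.2) = x.

Lemma difference_ideal_diff x : OF x -> difference_ideal (x - g x).
Proof.
move=> Ox; exists [:: (1, x)]; last by rewrite big_seq1 mul1r.
by move=> ab; rewrite inE => /eqP->; split; [exact: ring_of_integers1|].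
Qed.

Lemma difference_idealD x y : difference_ideal x -> difference_ideal y ->
  difference_ideal (x + y).
Proof.
move=> [s hs <-] [r hr <-]; exists (s ++ r); last by rewrite big_cat.
by move=> ab; rewrite mem_cat => /orP[/hs|/hr].
Qed.

Lemma difference_idealM x y : OF x -> difference_ideal y -> difference_ideal (x * y).
Proof.
move=> Ox [s hs <-]; exists [seq (x * ab.1, ab.2) | ab <- s].
  by move=> _ /mapP[ab /hs[Oa Ob] ->]; split => //; apply: ring_of_integersM.
by rewrite big_map mulr_sumr; apply: eq_bigr => ab _; rewrite mulrA.
Qed.

Lemma difference_idealMr x y : difference_ideal x -> OF y -> difference_ideal (x * y).
Proof. by rewrite mulrC => ? ?; apply: difference_idealM. Qed.

Lemma difference_ideal_sub x : OF x -> difference_ideal (g x - x).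
Proof.
move=> Ox; rewrite -opprB -mulN1r; apply: difference_idealM.
  exact/ring_of_integersN/ring_of_integers1.
exact: difference_ideal_diff.
Qed.

Lemma difference_ideal_sum (I : eqType) (r : seq I) (f : I -> L) :
  (forall i, i \in r -> difference_ideal (f i)) -> difference_ideal (\sum_(i <- r) f i).
Proof.
move=> hf; rewrite big_seq; apply: (big_ind difference_ideal) => //.
  by exists [::] => //; rewrite big_nil.
exact: difference_idealD.
Qed.

Lemma difference_ideal_exp k x : OF x -> difference_ideal (x - (g ^+ k)%g x).
Proof.
move=> Ox; elim: k => [|k IH].
  by exists [::] => //; rewrite big_nil expg0 gal_id subrr.
have Ok : OF ((g ^+ k)%g x) by apply: ring_of_integers_gal.
have -> : x - (g ^+ k.+1)%g x = (x - (g ^+ k)%g x) + ((g ^+ k)%g x - g ((g ^+ k)%g x)).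
  by rewrite expgSr galM ?addrA ?subrK //; case: Ox.
by apply: difference_idealD => //; apply: difference_ideal_diff.
Qed.

Lemma difference_ideal_coprime (a b : int) : coprimez a b ->
  difference_ideal a%:~R -> difference_ideal b%:~R -> difference_ideal 1.
Proof.
move=> /coprimezP[[u v] /= Duv] Ia Ib.
have -> : 1 = u%:~R * a%:~R + v%:~R * b%:~R :> L.
  by rewrite -!rmorphM -rmorphD /= Duv.
by apply: difference_idealD; apply: difference_idealM => //; apply: ring_of_integers_int.
Qed.

End DifferenceIdeal.

Section Residues.
Variable t : int.
Hypothesis ht : (t = 5 %[mod 27])%Z \/ (t = 10 %[mod 27])%Z.

Lemma residue3 : exists q : int, t = 3 * q + 1 \/ t = 3 * q + 2.
Proof.
rewrite (divz_eq t 27); case: ht => ->; set q := (t %/ 27)%Z.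
  by exists (9 * q + 1); right; rewrite (_ : (5 %% 27)%Z = 5) //; ring.
by exists (9 * q + 3); left; rewrite (_ : (10 %% 27)%Z = 10) //; ring.
Qed.

Lemma coprime3_conductor : coprimez 3 (t ^+ 2 - 3 * t + 9).
Proof.
apply/coprimezP; have [q [->|->]] := residue3.
  by exists (- (3 * q ^+ 2 - q + 2), 1); rewrite /=; ring.
by exists (- (3 * q ^+ 2 + q + 2), 1); rewrite /=; ring.
Qed.

Lemma coprime3_quadratic : coprimez 3 (t ^+ 2 - 2 * t + 5).
Proof.
apply/coprimezP; have [q [->|->]] := residue3.
  by exists (- (3 * q ^+ 2 + 1), 1); rewrite /=; ring.
by exists (3 * q ^+ 2 + 2 * q + 2, - 1); rewrite /=; ring.
Qed.

Lemma t_conductor_neq0 : t * (t ^+ 2 - 3 * t + 9) != 0.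
Proof.
rewrite mulf_neq0 //; apply/eqP => t0; last by move: coprime3_conductor; rewrite t0.
by move: ht; rewrite t0; case.
Qed.

End Residues.

Section Concrete.
Variables (L : splittingFieldType rat) (K : {subfield L}) (t : int) (z h : L) (m : L * L).
Hypotheses (ht : (t = 5 %[mod 27])%Z \/ (t = 10 %[mod 27])%Z)
  (hz : 9.-primitive_root z) (hs : kummer_state t%:~R (m, h)).
Let F : {subfield L} := <<K & [:: z; m.1; m.2; h]>>%AS.
Hypotheses (Kd : (z ^+ 3 - z ^+ 6) * (2 * m.1 - (t%:~R - 1)) \in K)
  (Ky : cubic_root t%:~R z m \in K).
Notation OF := (ring_of_integers F).

Let hm : sextic_point t%:~R m. Proof. by case: hs. Qed.

Let Fgen x : x \in [:: z; m.1; m.2; h] -> x \in F.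
Proof. by move=> sx; apply: seqv_sub_adjoin. Qed.

Let sKF : (K <= F)%VS := subv_adjoin_seq _ _.

Lemma ring_of_integers_zeta : OF z.
Proof.
split; first by rewrite Fgen ?mem_head.
by apply: (@integral_of_exp _ 9) => //; rewrite (prim_expr_order hz); apply: integral1.
Qed.

Lemma ring_of_integers_epsilon : OF m.1.
Proof.
split; first by rewrite Fgen ?inE ?eqxx ?orbT.
case: hm => he _.
apply: (@integral_monic_relation _ 2 (nth 0 [:: 1; (t - 1)%:~R])) => //.
  by case=> [|[|//]] _ /=; [apply: integral1 | apply: integral_int].
by rewrite !big_ord_recr big_ord0 /= he rmorphB /=; ring.
Qed.

Lemma ring_of_integers_rho : OF m.2.
Proof.
split; first by rewrite Fgen ?inE ?eqxx ?orbT.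
case: hm => _ hr.
apply: (@integral_monic_relation _ 3 (nth 0 [:: 1; (- (t - 3))%:~R; (- t)%:~R])) => //.
  by case=> [|[|[|//]]] _ /=; [apply: integral1 | apply: integral_int | apply: integral_int].
by rewrite !big_ord_recr big_ord0 /= hr !(rmorphB, rmorphN) /=; ring.
Qed.

Lemma ring_of_integers_sextic_eval b : OF (sextic_eval m (sextic_map intr b)).
Proof.
have Oe := ring_of_integers_epsilon; have Or := ring_of_integers_rho.
have Oi n : OF n%:~R := ring_of_integers_int F n.
have Or2 := ring_of_integersX 2 Or.
case: b => [[[[[b0 b1] b2] b3] b4] b5]; rewrite /sextic_eval /sextic_map.
by do ?[apply: ring_of_integersD | apply: ring_of_integersM | exact: Oi].
Qed.

Lemma ring_of_integers_conj k : (k < 6)%N -> OF (conj_unit t%:~R k m).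
Proof.
move=> lk; rewrite -unit_coordE //.
have U : unit_coord (t%:~R : L) k = sextic_map intr (unit_coord t k).
  by case: k lk => [|[|[|[|[|[|//]]]]]] _; rewrite /sextic_map /=;
    congr (_, _, _, _, _, _); rewrite ?rmorphB ?rmorphN ?rmorph1.
by rewrite U; apply: ring_of_integers_sextic_eval.
Qed.

Lemma ring_of_integers_h : OF h.
Proof.
split; first by rewrite Fgen ?inE ?eqxx ?orbT.
case: hs => _ /= h9; apply: (@integral_of_exp _ 9) => //; rewrite h9.
suff [] : OF (kummer_unit t%:~R m) by [].
rewrite /kummer_unit; have O := ring_of_integers_conj.
by do ?apply: ring_of_integersM; try apply: ring_of_integersX; apply: O.
Qed.

Lemma h_unit : exists2 w, OF w & w * h = 1.
Proof.
have O := ring_of_integers_conj; have Oh := ring_of_integers_h.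
(* The cofactor completes the exponents of [kummer_unit] to 8 everywhere, and (-1)^8 = 1. *)
exists (h ^+ 8 * (conj_unit t%:~R 0 m ^+ 7 * conj_unit t%:~R 1 m ^+ 6 * conj_unit t%:~R 2 m ^+ 4
   * conj_unit t%:~R 4 m * conj_unit t%:~R 5 m ^+ 3)).
  apply: ring_of_integersM; first exact: ring_of_integersX.
  by do ?apply: ring_of_integersM; try apply: ring_of_integersX; apply: O.
rewrite mulrAC -exprSr; case: hs => _ /= ->; rewrite /kummer_unit.
transitivity ((conj_unit t%:~R 0 m * conj_unit t%:~R 1 m * conj_unit t%:~R 2 m
   * conj_unit t%:~R 3 m * conj_unit t%:~R 4 m * conj_unit t%:~R 5 m) ^+ 8).
  move: (conj_unit _ 0 m) (conj_unit _ 1 m) (conj_unit _ 2 m).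
  by move: (conj_unit _ 3 m) (conj_unit _ 4 m) (conj_unit _ 5 m) => *; ring.
by rewrite prod_conj_unit // -[8%N]/(2 * 4)%N exprM sqrrN !expr1n.
Qed.

Lemma natr_neq0 n : n.+1%:R != 0 :> L.
Proof. by move/pcharf0P: (number_field_char0 L) => ->. Qed.

Lemma zeta3_mul : (1 - z ^+ 3) * (1 - z ^+ 6) = 3.
Proof.
have h0 := unity_root9 hz; have z9 := prim_expr_order hz.
transitivity (2 - (z ^+ 6 + z ^+ 3 + 1) + z ^+ 9); first ring.
by rewrite h0 z9; ring.
Qed.

Lemma epsilon_sqr : (2 * m.1 - (t%:~R - 1)) ^+ 2 = (t ^+ 2 - 2 * t + 5)%:~R.
Proof.
case: hm => he _; rewrite !(rmorphB, rmorphD, rmorphM, rmorphXn) /=.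
by ring: he.
Qed.

Lemma d_neq0 : (z ^+ 3 - z ^+ 6) * (2 * m.1 - (t%:~R - 1)) != 0.
Proof.
apply/eqP => /(congr1 (fun x => x ^+ 2)).
rewrite exprMn (sqrt_m3_sqr hz) epsilon_sqr expr0n /=; apply/eqP.
rewrite mulf_neq0 ?oppr_eq0 ?(natr_neq0 2) // alg_int_eq0.
by apply/eqP => b0; move: (coprime3_quadratic ht); rewrite b0.
Qed.

Lemma t_neq0 : (t%:~R : L) * (t%:~R ^+ 2 - 3 * t%:~R + 9) != 0.
Proof.
have -> : (t%:~R : L) * (t%:~R ^+ 2 - 3 * t%:~R + 9) = (t * (t ^+ 2 - 3 * t + 9))%:~R.
  by rewrite !(rmorphB, rmorphD, rmorphM, rmorphXn) /=; ring.
by rewrite alg_int_eq0; apply: t_conductor_neq0.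
Qed.

Lemma mem_sextic_conj k m' : m'.1 \in F -> m'.2 \in F ->
  (iter k (sextic_conj t%:~R) m').1 \in F /\ (iter k (sextic_conj t%:~R) m').2 \in F.
Proof.
move=> F1 F2; elim: k => [|k [IH1 IH2]] //=; rewrite /sextic_conj /=; split.
  by rewrite !rpredB ?rpred_int ?rpred1.
by rewrite rpredB ?rpredD ?rpredX ?rpredM ?rpredB ?rpred_int ?rpred1 ?rpred_nat.
Qed.

Lemma mem_conj_unit k m' : m'.1 \in F -> m'.2 \in F -> conj_unit t%:~R k m' \in F.
Proof.
move=> F1 F2; have [G1 G2] := mem_sextic_conj k F1 F2.
by rewrite /conj_unit rpredN rpredD.
Qed.

Lemma mem_step j : let st := iter j (step t%:~R) (m, h) in
  [/\ st.1.1 \in F, st.1.2 \in F & st.2 \in F].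
Proof.
rewrite /=; elim: j => [|j [F1 F2 F3]] /=.
  by split; apply: Fgen; rewrite !inE eqxx ?orbT.
have [G1 G2] := mem_sextic_conj 5 F1 F2; split => //.
by rewrite rpred_div ?rpredX // /step_unit !rpredM // mem_conj_unit.
Qed.

Lemma mem_resolvent i : resolvent t%:~R (twist (z ^+ i) (m, h)) \in F.
Proof.
rewrite /resolvent rpred_sum // => j _; rewrite iter_step_twist /=.
have [_ _ Fj] := mem_step j; rewrite rpredM ?rpredX //.
by apply: Fgen; rewrite mem_head.
Qed.

Lemma aut_kummer_data (f : {rmorphism L -> L}) : (forall x, x \in K -> f x = x) ->
  exists k l, [/\ (k < 6)%N, f z = z ^+ (5 ^ k),
      (f m.1, f m.2) = iter k (sextic_conj t%:~R) m
    & f h = z ^+ l * (iter (6 - k) (step t%:~R) (m, h)).2].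
Proof.
move=> fK; have [||k [l [lk fz fm _ fh]]] :=
  aut_kummer_root (number_field_char0 L) (rmorph_int f t) hz hs t_neq0 d_neq0.
- exact: fK.
- exact: fK.
by exists k, l; split.
Qed.

(** Gives normality of F over K: an automorphism fixing K sends the four generators to expressions
    in these same generators. *)
Lemma aut_image (f : 'AEnd(L)) : (forall x, x \in K -> f x = x) -> (f @: F <= F)%VS.
Proof.
move=> fK; have [k [l [_ fz fm fh]]] := aut_kummer_data fK.
have Fz : z \in F by apply: Fgen; rewrite mem_head.
have [F1 F2 F3] := mem_step (6 - k).
have [Fe _] := ring_of_integers_epsilon; have [Fr _] := ring_of_integers_rho.
have [G1 G2] := mem_sextic_conj k Fe Fr; rewrite -fm /= in G1 G2.
rewrite aimg_adjoin_seq; apply/Fadjoin_seqP; split.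
  apply/subvP => _ /memv_imgP[x Kx ->]; rewrite fK //; exact: (subvP sKF).
move=> x; rewrite /= !inE => /or4P[] /eqP-> //; first by rewrite fz rpredX.
by rewrite fh rpredM ?rpredX.
Qed.

Lemma galois_kummer_field : galois K F.
Proof.
apply/and3P; split; first exact: sKF.
  by apply/separableP => x _; apply: pcharf0_separable; apply: number_field_char0.
apply/forallP => f; apply/implyP; rewrite inE kAutfE => kf.
have : kAut K F f.
  rewrite kAutE (kHomSr (subvf _)) //=; apply: aut_image => x Kx.
  by apply/(kAHomP kf).
by case/andP.
Qed.

Lemma fixed_generators (g : gal_of F) : g \in 'Gal(F / K)%g ->
  (forall x, x \in [:: z; m.1; m.2; h] -> g x = x) -> g = 1%g.
Proof.
move=> Gg gx; apply/eqP/gal_eqP => x Fx; rewrite gal_id.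
suff : (F <= fixedSpace (gal_repr g))%VS by move/subvP/(_ x Fx)/fixedSpaceP.
apply/Fadjoin_seqP; split => [|y sy]; last exact/fixedSpaceP/gx.
by apply/subvP => v Kv; apply/fixedSpaceP/(gal_fixed sKF Gg).
Qed.

Section UnitDifference.
Variable g : gal_of F.
Hypotheses (Gg : g \in 'Gal(F / K)%g) (ng : g != 1%g).
Notation I := (difference_ideal g).

Let gK x : x \in K -> g x = x. Proof. exact: (gal_fixed sKF Gg). Qed.
Let Oz : OF z := ring_of_integers_zeta.
Let Oe : OF m.1 := ring_of_integers_epsilon.
Let Or : OF m.2 := ring_of_integers_rho.
Let z9 : z ^+ 9 = 1 := prim_expr_order hz.
Let Ozn n : OF (z ^+ n). Proof. exact: ring_of_integersX. Qed.
Let O1z n : OF (1 - z ^+ n).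
Proof. by apply: ring_of_integersB => //; apply: ring_of_integers1. Qed.

Lemma three_difference c : (c = 3 \/ c = 6)%N -> I (1 - z ^+ c) -> I (3%:~R).
Proof.
move=> hc Ic; rewrite -[3%:~R]/(3%:R : L) -zeta3_mul.
by case: hc Ic => -> Ic; [apply: difference_idealMr | apply: difference_idealM].
Qed.

(** For odd k, g exchanges z^3 and z^6 and conjugates epsilon; the differences z^3 - z^6 and 2
    epsilon - (t - 1) have squares -3 and t^2 - 2 t + 5. *)
Lemma unit_difference_odd k : odd k -> (k < 6)%N -> g z = z ^+ (5 ^ k) ->
  (g m.1, g m.2) = iter k (sextic_conj t%:~R) m -> I 1.
Proof.
move=> ok lk gz gm.
have I3 : I 3%:~R.
  have := difference_ideal_diff g (Ozn 3).
  have -> : g (z ^+ 3) = z ^+ 6.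
    rewrite rmorphXn /= gz -exprM -(prim_expr_mod hz).
    by case: k ok lk {gz gm} => [|[|[|[|[|[|//]]]]]].
  move=> Is; have -> : (3%:~R : L) = - (z ^+ 3 - z ^+ 6) * (z ^+ 3 - z ^+ 6).
    by rewrite mulNr -expr2 (sqrt_m3_sqr hz) opprK.
  by apply: difference_idealM => //; apply/ring_of_integersN/ring_of_integersB.
apply: (difference_ideal_coprime (coprime3_quadratic ht)) I3 _.
have := difference_ideal_diff g Oe.
have -> : g m.1 = t%:~R - 1 - m.1 by move: (iter_conj1 t%:~R m k); rewrite -gm ok.
have -> : m.1 - (t%:~R - 1 - m.1) = 2 * m.1 - (t%:~R - 1) by ring.
move=> Is; rewrite -epsilon_sqr expr2; apply: difference_idealM => //.
rewrite (_ : 2 * m.1 = m.1 + m.1); last by ring.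
apply: ring_of_integersB; first exact: ring_of_integersD.
by apply: ring_of_integersB; [apply: ring_of_integers_int | apply: ring_of_integers1].
Qed.

(** A square root of the discriminant of the simplest cubic. *)
Lemma rho_difference : (m.2 - (sextic_conj t%:~R m).2)
  * ((sextic_conj t%:~R m).2 - (iter 2 (sextic_conj t%:~R) m).2)
  * ((iter 2 (sextic_conj t%:~R) m).2 - m.2) = - (t ^+ 2 - 3 * t + 9)%:~R.
Proof.
rewrite iter2_conj //; case: m hm => e r [/= _ hr].
by rewrite !(rmorphB, rmorphD, rmorphM, rmorphXn) /=; ring: hr.
Qed.

(** Here g z is z^7 or z^4, so z - g z is associate to 1 - z^6 or 1 - z^3, a divisor of 3, while rho
    - g rho is up to sign a factor in [rho_difference]. *)
Lemma unit_difference_even k : (k = 2 \/ k = 4)%N -> g z = z ^+ (5 ^ k) ->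
  (g m.1, g m.2) = iter k (sextic_conj t%:~R) m -> I 1.
Proof.
move=> hk gz gm.
have I3 : I 3%:~R.
  have := difference_ideal_diff g Oz; rewrite gz => Iz.
  have : I (z ^+ 8 * (z - z ^+ (5 ^ k))) by apply: difference_idealM.
  rewrite mulrBr -exprSr z9 -exprD -(prim_expr_mod hz).
  by case: hk => ->; apply: three_difference; [right | left].
have hm1 := sextic_point_conj hm; have Oi := ring_of_integers_int F.
have Or1 : OF (sextic_conj t%:~R m).2.
  apply: ring_of_integersB; last exact: (Oi 2).
  apply: ring_of_integersD; first exact: ring_of_integersX.
  by apply: ring_of_integersM => //; apply: ring_of_integersB => //; apply: (Oi 1).
have Or2 : OF (iter 2 (sextic_conj t%:~R) m).2.
  rewrite iter2_conj //=; apply: ring_of_integersB => //; apply: ring_of_integersB => //.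
  exact: ring_of_integersN.
apply: (difference_ideal_coprime (coprime3_conductor ht)) I3 _.
rewrite -[X in I X]opprK -rho_difference.
have -> : (m.2 - (sextic_conj t%:~R m).2)
  * ((sextic_conj t%:~R m).2 - (iter 2 (sextic_conj t%:~R) m).2)
  * ((iter 2 (sextic_conj t%:~R) m).2 - m.2)
  = ((sextic_conj t%:~R m).2 - (iter 2 (sextic_conj t%:~R) m).2) *
    ((m.2 - (sextic_conj t%:~R m).2) * ((iter 2 (sextic_conj t%:~R) m).2 - m.2)) by ring.
rewrite -mulrN; apply: difference_idealM; first exact: ring_of_integersB.
have Im := difference_ideal_diff g Or; have Im' := difference_ideal_sub g Or.
case: hk gm => -> gm.
  rewrite -mulNr; apply: difference_idealM; first exact/ring_of_integersN/ring_of_integersB.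
  by rewrite -gm.
rewrite -mulrN mulrC; apply: difference_idealM; first exact/ring_of_integersN/ring_of_integersB.
move: Im; suff -> : g m.2 = (sextic_conj t%:~R m).2 by [].
by move: gm; rewrite (iterD 1 3) iter3_conj //= => -[_ ->].
Qed.

(* With u^9 = 1 + 27 gamma, the integers e_j = (1/9) sum_i (zeta^j u)^i for j < 9
   have sum 1, and e_j - e_(j+c) lies in the difference ideal for c = 3 or 6. So
   1 = 3 (e_0 + e_1 + e_2) modulo that ideal, which also contains 3. *)
Lemma unit_difference_kummer l : g z = z -> (g m.1, g m.2) = m -> g h = z ^+ l * h -> I 1.
Proof.
move=> gz gm gh.
have nl : (l %% 9 != 0)%N.
  apply: contraNneq ng => l0; apply/eqP/fixed_generators => // x.
  rewrite !inE => /or4P[] /eqP-> //; try by case: (m) gm => a b [].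
  by rewrite gh -(prim_expr_mod hz) l0 mul1r.
have [[[[Fz _] [Fh _]] [Fe _]] [Fr _]] := (Oz, ring_of_integers_h, Oe, Or).
have [ge gr] : g m.1 = m.1 /\ g m.2 = m.2 by case: (m) gm => a b [].
have gX k : [/\ (g ^+ k)%g z = z, (g ^+ k)%g m.1 = m.1, (g ^+ k)%g m.2 = m.2
    & (g ^+ k)%g h = z ^+ (l * k) * h].
  elim: k => [|k [IHz IHe IHr IHh]]; first by rewrite expg0 !gal_id muln0 mul1r.
  rewrite !expgSr !galM // IHz IHe IHr IHh gz ge gr; split => //.
  by rewrite rmorphM rmorphXn /= gz gh mulrA -exprD mulnS addnC.
(* Since l is nonzero modulo 9, some power of g multiplies h by a primitive cube root of unity. *)
have [k [c [hc Gz Ge Gr Gh]]] : exists k c, [/\ (c = 3 \/ c = 6)%N, (g ^+ k)%g z = z,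
    (g ^+ k)%g m.1 = m.1, (g ^+ k)%g m.2 = m.2 & (g ^+ k)%g h = z ^+ c * h].
  have [k hk] : exists k, ((l * k) %% 9 = 3 \/ (l * k) %% 9 = 6)%N.
    have : exists k, (((l %% 9) * k) %% 9 = 3 \/ ((l %% 9) * k) %% 9 = 6)%N.
      case: (l %% 9)%N (ltn_pmod l (isT : 0 < 9)%N) nl => [|[|[|[|[|[|[|[|[|//]]]]]]]]] // _ _;
      first [by exists 1%N; left | by exists 1%N; right | by exists 3%N; left | by exists 3%N; right].
    by case=> k; rewrite !modnMml; exists k.
  exists k, ((l * k) %% 9)%N; have [Gz Ge Gr Gh] := gX k.
  by split => //; rewrite (prim_expr_mod hz).
have Oh := ring_of_integers_h.
have I1 : I (1 - z ^+ c).
  have [w Ow wh] := h_unit; have := difference_idealM Ow (difference_ideal_exp g k Oh).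
  by rewrite Gh mulrBr mulrCA wh mulr1.
have I3 := three_difference hc I1.
have [b [c0 Dc]] := kummer_congruence ht hm.
case: hs => _ /= h9; rewrite -h9 -exprMn in Dc.
set u := h * _ in Dc; set gamma := sextic_eval m _ in Dc.
have Ou : OF u by apply: ring_of_integersM => //; apply: ring_of_integers_sextic_eval.
have Og : OF gamma := ring_of_integers_sextic_eval c0.
have Gu : (g ^+ k)%g u = z ^+ c * u.
  rewrite /u rmorphM /= Gh mulrA; congr (_ * _).
  case: (b) => [[[[[b0 b1] b2] b3] b4] b5]; rewrite /sextic_eval /sextic_map.
  by rewrite !(rmorphD, rmorphM, rmorphXn, rmorph_int) /= Ge Gr.
pose e j := 9^-1 * \sum_(i < 9) (z ^+ j * u) ^+ i.
have Oe' j : OF (e j).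
  split.
    rewrite rpredM ?rpredV ?rpred_nat // rpred_sum // => i _.
    by rewrite rpredX // rpredM ?rpredX //; case: Ou.
  apply: (@integral_ninth_average _ _ gamma); first by case: Og.
  by rewrite exprMn -exprM mulnC exprM z9 expr1n mul1r.
have GE j : (g ^+ k)%g (e j) = e (j + c)%N.
  rewrite /e rmorphM fmorphV rmorph_nat rmorph_sum; congr (_ * _).
  by apply: eq_bigr => i _; rewrite rmorphXn rmorphM rmorphXn /= Gz Gu mulrA -exprD.
have ID j : I (e j - e (j + c)%N) by rewrite -GE; apply: difference_ideal_exp.
have e9 j : e (j + 9)%N = e j by rewrite /e exprD z9 mulr1.
have sum_e : \sum_(j < 9) e j = 1.
  rewrite -mulr_sumr; apply: (mulfI (natr_neq0 8)).
  rewrite mulrA mulfV ?natr_neq0 // mul1r.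
  have z6 : z ^+ 6 = - z ^+ 3 - 1.
    by apply/eqP; rewrite -subr_eq0 -(unity_root9 hz); apply/eqP; ring.
  rewrite !big_ord_recr !big_ord0 /=; ring: z6.
(* Each j contributes e_j + e_(j+c) + e_(j+2c), and for c = 3 or 6 these indices run once through
   all residues modulo 9, so the total is the sum of all e_j. *)
have -> : (1 : L) = 3%:~R * (e 0 + e 1 + e 2) - (\sum_(j <- [:: 0; 1; 2]%N) (2%:~R * (e j - e (j + c)%N)
    + (e (j + c)%N - e (j + c + c)%N))).
  rewrite -[LHS]sum_e !big_cons big_nil !big_ord_recr big_ord0.
  have e12 : e 12 = e 3 by apply: (e9 3%N).
  have e13 : e 13 = e 4 by apply: (e9 4%N).
  have e14 : e 14 = e 5 by apply: (e9 5%N).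
  clearbody e; case: hc => ->; last rewrite -[(0 + 6 + 6)%N]/12%N -[(1 + 6 + 6)%N]/13%N
    -[(2 + 6 + 6)%N]/14%N e12 e13 e14; rewrite /= ?addSn ?add0n; ring.
rewrite -mulN1r; apply: difference_idealD.
  by apply: difference_idealMr => //; do ?apply: ring_of_integersD; apply: Oe'.
apply: difference_idealM; first exact/ring_of_integersN/ring_of_integers1.
apply: difference_ideal_sum => j _; apply: difference_idealD => //.
by apply: difference_idealM => //; apply: ring_of_integers_int.
Qed.

Lemma kummer_unit_difference : I 1.
Proof.
have [k [l [lk gz gm gh]]] := aut_kummer_data (f := gal_repr g) gK.
case: k lk gz gm gh => [|[|[|[|[|[|//]]]]]] lk gz gm gh.
- apply: (unit_difference_kummer (l := l)) => //.
  by rewrite gh -[(6 - 0)%N]/6%N step6.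
- exact: (unit_difference_odd (k := 1)).
- by apply: (unit_difference_even (k := 2)) => //; left.
- exact: (unit_difference_odd (k := 3)).
- by apply: (unit_difference_even (k := 4)) => //; right.
- exact: (unit_difference_odd (k := 5)).
Qed.

End UnitDifference.

End Concrete.

Lemma separable_irreducible (p : {poly rat}) : irreducible_poly p -> separable_poly p.
Proof.
move=> [sz_p irr_p]; rewrite unlock /coprimep.
have nz_p : p != 0 by rewrite -size_poly_gt0 (ltn_trans _ sz_p).
apply: contraT => sz_g; have := irr_p _ sz_g (dvdp_gcdl _ _).
rewrite /eqp => /andP[_ /(dvdp_trans)/(_ (dvdp_gcdr _ _)) dv_p].
have nz_p' : p^`() != 0.
  apply/eqP => /(congr1 (coefp (size p).-2)) /= /eqP; rewrite coef0 coef_deriv.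
  have -> : (size p).-2.+1 = (size p).-1 by case: (size p) sz_p => [|[]].
  rewrite mulrn_eq0 -lead_coefE lead_coef_eq0 (negPf nz_p) orbF.
  by case: (size p) sz_p => [|[]].
have := dvdp_leq nz_p' dv_p; rewrite leqNgt lt_size_deriv //.
Qed.

Lemma nonic_polyE (F : fieldType) (f : {rmorphism rat -> F}) (t : int) X :
  (map_poly f (nonic_poly t)).[X] = nonic_value t%:~R X.
Proof.
have gen a7 a6 a5 a4 a3 a2 a1 a0 :
    (map_poly f ('X^9 + a7%:P * 'X^7 + a6%:P * 'X^6 - a5%:P * 'X^5 + a4%:P * 'X^4
      - a3%:P * 'X^3 + a2%:P * 'X^2 - a1%:P * 'X + a0%:P)).[X]
    = X ^+ 9 + f a7 * X ^+ 7 + f a6 * X ^+ 6 - f a5 * X ^+ 5 + f a4 * X ^+ 4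
      - f a3 * X ^+ 3 + f a2 * X ^+ 2 - f a1 * X + f a0.
  rewrite !mul_polyC !rmorphD !rmorphN /= !map_polyZ /= !(map_polyXn, map_polyX) map_polyC.
  by rewrite !(hornerD, hornerN, hornerZ, hornerX, hornerXn, hornerC) ?expr1.
rewrite gen -(rmorph_int f) /nonic_value; move: (t%:~R) => a.
by ring.
Qed.

Lemma map_cubic_poly (F : fieldType) (f : {rmorphism rat -> F}) (t : int) (T := t%:~R : F) :
  map_poly f (cubic_poly t)
  = 'X^3 - (3 * (T ^+ 2 - 3 * T + 9))%:P * 'X + ((T - 6) * (T ^+ 2 - 3 * T + 9))%:P.
Proof.
rewrite /cubic_poly !mul_polyC !rmorphD !rmorphN /= !map_polyZ /= !(map_polyXn, map_polyX) map_polyC.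
rewrite /T -(rmorph_int f); move: (t%:~R) => a.
by congr (_ - _ *: _ + _%:P); ring.
Qed.

Lemma cubic_polyE (F : fieldType) (f : {rmorphism rat -> F}) (t : int) X :
  (map_poly f (cubic_poly t)).[X] = cubic_value t%:~R X.
Proof. by rewrite map_cubic_poly !(hornerD, hornerN, hornerCM, hornerX, hornerXn, hornerC). Qed.

(** * The cubic and the nonic over the rationals *)

Section CyclicCubic.
Variables (t : int) (L : splittingFieldType rat) (y : L).
Hypotheses (ht : (t = 5 %[mod 27])%Z \/ (t = 10 %[mod 27])%Z)
  (hq : irreducible_poly (cubic_poly t))
  (hy : root (map_poly (in_alg L) (cubic_poly t)) y).

Lemma size_cubic_poly : size (cubic_poly t) = 4%N.
Proof.
rewrite /cubic_poly -addrA size_polyDl size_polyXn //.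
apply: leq_ltn_trans (size_polyD _ _) _; rewrite gtn_max size_polyN; apply/andP; split.
  apply: leq_ltn_trans (size_polyMleq _ _) _; rewrite size_polyX addn2 /= ltnS.
  by apply: leq_trans (size_polyC_leq1 _) _.
by apply: leq_ltn_trans (size_polyC_leq1 _) _.
Qed.

Lemma minPoly_cubic : minPoly 1%AS y %= map_poly (in_alg L) (cubic_poly t).
Proof.
have /polyOver1P[p Dp] := minPolyOver 1%AS y.
have : minPoly 1%AS y %| map_poly (in_alg L) (cubic_poly t).
  by apply: minPoly_dvdp => //; apply/polyOver1P; exists (cubic_poly t).
rewrite Dp dvdp_map eqp_map => dv_p; case: hq => _; apply => //.
by rewrite -(size_map_poly (in_alg L)) -Dp size_minPoly eqSS -lt0n.
Qed.

(** The discriminant is the square (9 a T)^2, because 4 a - (T - 6)^2 = 3 T^2. Adjoining one root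
    thus adjoins all, and the Galois group has prime order 3. *)
Lemma cyclic_cubic : cyclic_extension 1%AS <<1; y>>%AS.
Proof.
set E : {subfield L} := <<1; y>>%AS.
have Ey : y \in E by apply: memv_adjoin.
have t0 := t_conductor_neq0 ht.
pose T : L := t%:~R; pose a : L := T ^+ 2 - 3 * T + 9.
have nat0 n : n.+1%:R != 0 :> L by move/pcharf0P: (number_field_char0 L) => ->.
have [nT na] : T != 0 /\ a != 0.
  have : T * a != 0.
    rewrite (_ : T * a = (t * (t ^+ 2 - 3 * t + 9))%:~R) ?alg_int_eq0 //.
    by rewrite !(rmorphB, rmorphD, rmorphM, rmorphXn) /=.
  by rewrite mulf_eq0 negb_or => /andP.
have cy : y ^+ 3 = 3 * a * y - (T - 6) * a.
  have := hy; rewrite /root cubic_polyE /cubic_value -/T -/a => /eqP cy.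
  by apply/eqP; rewrite -subr_eq0 -cy; apply/eqP; ring.
have nw : y ^+ 2 - a != 0.
  rewrite subr_eq0; apply/eqP => ya.
  have y2 : 2 * y = T - 6.
    apply: (mulfI na); apply/eqP; rewrite -subr_eq0; apply/eqP.
    transitivity (3 * a * y - (T - 6) * a - a * y); first ring.
    by rewrite -cy exprS ya; ring.
  have : 3 * T ^+ 2 = 0.
    transitivity (4 * a - (T - 6) ^+ 2); first by rewrite /a; ring.
    by rewrite -y2 -ya; ring.
  by move/eqP; rewrite mulf_eq0 expf_eq0 /= (negPf nT) (negPf (nat0 2)).
(* The difference of the other two roots: the square root 9 a T of the discriminant divided by the
   derivative 3 (y^2 - a) of the cubic at y. *)
pose d := 3 * a * T / (y ^+ 2 - a).
have dd : d ^+ 2 = 12 * a - 3 * y ^+ 2.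
  apply: (mulIf (expf_neq0 2 nw)); rewrite -exprMn divfK //.
  transitivity (3 * a ^+ 2 * (4 * a - (T - 6) ^+ 2)); first by rewrite /a; ring.
  transitivity (12 * a ^+ 3 - 3 * (3 * a * y - y ^+ 3) ^+ 2); last by ring.
  by rewrite cy; ring.
pose r1 := (- y + d) / 2; pose r2 := (- y - d) / 2.
have fac : map_poly (in_alg L) (cubic_poly t) = ('X - y%:P) * ('X - r1%:P) * ('X - r2%:P).
  have s12 : r1 + r2 = - y.
    by apply: (mulIf (nat0 1)); rewrite mulrDl !divfK ?nat0 //; ring.
  have p12 : r1 * r2 = y ^+ 2 - 3 * a.
    apply: (mulIf (mulf_neq0 (nat0 1) (nat0 1))); rewrite mulrACA !divfK ?nat0 //.
    transitivity (y ^+ 2 - d ^+ 2); first ring.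
    by rewrite dd; ring.
  have -> : map_poly (in_alg L) (cubic_poly t)
      = 'X^3 - (3 * a)%:P * 'X + (3 * a * y - y ^+ 3)%:P.
    by rewrite cy (_ : 3 * a * y - _ = (T - 6) * a) ?map_cubic_poly //; ring.
  transitivity (('X - y%:P) * ('X^2 - (r1 + r2)%:P * 'X + (r1 * r2)%:P)).
    by rewrite s12 p12; ring.
  by ring.
have [E1 E2] : r1 \in E /\ r2 \in E.
  have Ed : d \in E.
    have ET : T \in E by rewrite rpred_int.
    have Ea : a \in E by rewrite rpredD ?rpredB ?rpredX ?rpredM ?rpred_nat.
    by rewrite rpred_div ?rpredM ?rpredB ?rpredX ?rpred_nat.
  by split; rewrite rpred_div ?rpred_nat // ?rpredB ?rpredD ?rpredN.
have gal1 : galois 1%AS E.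
  apply/splitting_galoisField; exists (map_poly (in_alg L) (cubic_poly t)); split.
  - by apply/polyOver1P; exists (cubic_poly t).
  - by rewrite separable_map separable_irreducible.
  exists [:: y; r1; r2]; first by rewrite fac !big_cons big_nil mulr1 mulrA eqpxx.
  apply/eqP; rewrite eqEsubv; apply/andP; split.
    apply/Fadjoin_seqP; split; first exact: subv_adjoin.
    by move=> x; rewrite !inE => /or3P[] /eqP->.
  apply/FadjoinP; split; first exact: subv_adjoin_seq.
  by apply: seqv_sub_adjoin; rewrite mem_head.
split => //; apply: prime_cyclic; rewrite -galois_dim // dimv1 divn1.
have -> : \dim E = adjoin_degree 1%AS y by rewrite adjoin_degreeE dimv1 divn1.
have := eqp_size minPoly_cubic; rewrite size_minPoly size_map_poly size_cubic_poly.
by move/succn_inj => ->.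
Qed.

End CyclicCubic.

Lemma unramified_infinite_imaginary (L : fieldExtType rat) (K E : {subfield L}) (d : L) (n : int) :
  (K <= E)%VS -> d \in K -> d ^+ 2 = n%:~R -> n < 0 -> unramified_infinite K E.
Proof.
move=> sKE Kd dn n0 s sK u0; exfalso.
have Ed : d \in E := subvP sKE d Kd.
pose u : subvs_of E := Subvs Ed.
have su : s u \is Num.real by apply: sK.
have : 0 <= s u ^+ 2 by apply: real_exprn_even_ge0.
have -> : s u ^+ 2 = n%:~R.
  rewrite -rmorphXn /= -(rmorph_int s); congr (s _); apply: val_inj.
  by rewrite -[LHS]/(vsval (u ^+ 2)) -[RHS]/(vsval n%:~R) rmorphXn rmorph_int.

by rewrite ler0z leNgt n0.
Qed.

(** After a choice of z, d determines epsilon. Any root rho of the simplest cubic is then replaced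
    by a conjugate, epsilon being kept, so that the given y is the root attached to it by
    [cubic_value_factor]. *)
Lemma kummer_data (L : splittingFieldType rat) (f : {rmorphism L -> algC}) (t : int) (d y : L) :
  d ^+ 2 = (- 3 * (t - 1) ^+ 2 - 12)%:~R -> root (map_poly (in_alg L) (cubic_poly t)) y ->
  exists (z : algC) (m : algC * algC) (h : algC),
    [/\ 9.-primitive_root z, kummer_state t%:~R (m, h),
        (z ^+ 3 - z ^+ 6) * (2 * m.1 - (t%:~R - 1)) = f d & cubic_root t%:~R z m = f y].
Proof.
move=> hd; rewrite /root cubic_polyE => /eqP hy.
have [z hz] := C_prim_root_exists (isT : 0 < 9)%N.
pose T : algC := t%:~R; pose s := z ^+ 3 - z ^+ 6.
have z0 := unity_root9 hz.
have s2 : s ^+ 2 = - 3 := sqrt_m3_sqr hz.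
have ns : s != 0.
  by apply/eqP => s0; move/eqP: s2; rewrite s0 expr0n /= eq_sym oppr_eq0 pnatr_eq0.
have n2 : (2 : algC) != 0 by rewrite pnatr_eq0.
pose e := (f d / s + (T - 1)) / 2.
have de : s * (2 * e - (T - 1)) = f d.
  by rewrite /e mulrC [2 * _]mulrC divfK // addrK divfK.
have he : e ^+ 2 = (T - 1) * e + 1.
  have E : (2 * e - (T - 1)) ^+ 2 = (T - 1) ^+ 2 + 4.
    apply: (mulfI (expf_neq0 2 ns)); rewrite -exprMn de -rmorphXn hd rmorph_int s2.
    by rewrite !(rmorphB, rmorphN, rmorphM, rmorphXn) /= -/T; ring.
  apply: (mulfI (mulf_neq0 n2 n2)); apply/eqP; rewrite -subr_eq0; apply/eqP.
  by transitivity ((2 * e - (T - 1)) ^+ 2 - ((T - 1) ^+ 2 + 4)); [ring | rewrite E subrr].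
have [r hr] := @solve_monicpoly algC 3 (nth 0 [:: 1; - (T - 3); - T]) isT.
have {}hr : r ^+ 3 = 1 - T * r ^+ 2 - (T - 3) * r.
  by rewrite hr !big_ord_recr big_ord0 /=; ring.
have hm : sextic_point T (e, r) by split.
have hyC : cubic_value T (f y) = 0.
  have <- : f (cubic_value t%:~R y) = cubic_value T (f y).
    rewrite /T -(rmorph_int f) /cubic_value; move: (t%:~R) => b; ring.
  by rewrite hy rmorph0.
have [m hm' [me my]] : exists2 m, sextic_point T m & m.1 = e /\ cubic_root T z m = f y.
  have hp k := iter_sextic_point k hm.
  have cr m' : sextic_point T m' -> sextic_point T (e, m'.2) by case.
  move: (cubic_value_factor (f y) hm z0); rewrite hyC => /esym/eqP.
  rewrite !mulf_eq0 !subr_eq0 => /orP[/orP[]|] /eqP ->.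
  - by exists (e, r).
  - by exists (e, (sextic_conj T (e, r)).2) => //; apply/cr/(hp 1%N).
  - by exists (e, (iter 2 (sextic_conj T) (e, r)).2) => //; apply/cr/(hp 2%N).
exists z, m, (9.-root (kummer_unit T m)); split => //; last by rewrite me.
by split => //=; rewrite rootCK.
Qed.

(** * The splitting field of the nonic over K *)

Section Main.
Variables (t : int) (L : splittingFieldType rat) (y d : L) (E : {subfield L}).
Hypotheses (ht : (t = 5 %[mod 27])%Z \/ (t = 10 %[mod 27])%Z)
  (hy : root (map_poly (in_alg L) (cubic_poly t)) y)
  (hn : irreducible_poly (nonic_poly t))
  (hd : d ^+ 2 = (- 3 * (t - 1) ^+ 2 - 12)%:~R).
Let K : {subfield L} := <<1 & [:: d; y]>>%AS.
Hypothesis hE : splittingFieldFor K (map_poly (in_alg L) (nonic_poly t)) E.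

Lemma discriminant_lt0 : (- 3 * (t - 1) ^+ 2 - 12 : int) < 0.
Proof. by rewrite mulNr -opprD oppr_lt0 ltr_wpDl // mulr_ge0 // sqr_ge0. Qed.

Let Kd : d \in K. Proof. by apply: seqv_sub_adjoin; rewrite mem_head. Qed.
Let Ky : y \in K. Proof. by apply: seqv_sub_adjoin; rewrite !inE eqxx orbT. Qed.
Let sKE : (K <= E)%VS. Proof. by case: hE => rs _ <-; apply: subv_adjoin_seq. Qed.

Lemma galois_nonic (L' : splittingFieldType rat) (K' E' : {subfield L'}) :
  splittingFieldFor K' (map_poly (in_alg L') (nonic_poly t)) E' -> galois K' E'.
Proof.
move=> sp; apply/splitting_galoisField.
exists (map_poly (in_alg L') (nonic_poly t)); split => //.
  by apply: (polyOverSv (sub1v _)); apply/polyOver1P; exists (nonic_poly t).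
by rewrite separable_map separable_irreducible.
Qed.

Lemma size_nonic_poly : size (nonic_poly t) = 10%N.
Proof.
have gen (a7 a6 a5 a4 a3 a2 a1 a0 : rat) :
    size ('X^9 + a7%:P * 'X^7 + a6%:P * 'X^6 - a5%:P * 'X^5 + a4%:P * 'X^4
      - a3%:P * 'X^3 + a2%:P * 'X^2 - a1%:P * 'X + a0%:P) = 10%N.
  rewrite -!addrA size_polyDl size_polyXn //.
  have S (a : rat) n : (n <= 7)%N -> (size (a%:P * 'X^n)%R <= 9)%N.
    move=> le_n; apply: leq_trans (size_polyMleq _ _) _.
    rewrite size_polyXn addnS /= (leq_trans (leq_add (size_polyC_leq1 a) le_n)) //.
  do 7!(apply: leq_ltn_trans (size_polyD _ _) _; rewrite gtn_max ?size_polyN;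
    apply/andP; split; [by rewrite ltnS; first [apply: S | apply: (S _ 1%N)] |]).
  by apply: leq_ltn_trans (size_polyC_leq1 _) _.
exact: gen.
Qed.

Section Roots.
Variables (f : {rmorphism L -> algC}) (z : algC) (m : algC * algC) (h : algC).
Hypotheses (hz : 9.-primitive_root z) (hs : kummer_state t%:~R (m, h))
  (hfd : (z ^+ 3 - z ^+ 6) * (2 * m.1 - (t%:~R - 1)) = f d)
  (hfy : cubic_root t%:~R z m = f y).
Let x i := resolvent t%:~R (twist (z ^+ i) (m, h)).

Lemma resolvent_mod i : x (i %% 9) = x i.
Proof. by rewrite /x (prim_expr_mod hz). Qed.

(** The nonic is separable, so nine distinct roots are sent injectively into the nine values x 0,
    ..., x 8; hence these are distinct and all attained, and a root determines its index modulo
    9. *)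
Lemma roots_resolvents : exists rs : seq L, [/\ <<K & rs>>%VS = E :> {vspace L},
  (forall r, r \in rs -> exists i : 'I_9, f r = x i),
  (forall i, exists2 r, r \in rs & f r = x i) &
  forall i j, x i = x j -> (i = j %[mod 9])%N].
Proof.
have [rs Drs gE] := hE.
have xs i : i \in rs -> exists j : 'I_9, f i = x j.
  move=> rsi; have : root (map_poly (in_alg L) (nonic_poly t)) i.
    by rewrite (eqp_root Drs) root_prod_XsubC.
  move/(rmorph_root f); rewrite -map_poly_comp /root nonic_polyE => /eqP.
  rewrite (nonic_value_factor _ hs (unity_root9 hz)) => /eqP/prodf_eq0[j _].
  by rewrite subr_eq0 => /eqP; exists j.
have urs : uniq rs.
  by rewrite -separable_prod_XsubC -(eqp_separable Drs) separable_map separable_irreducible.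
have szrs : size rs = 9%N.
  have := eqp_size Drs; rewrite size_map_poly size_nonic_poly size_prod_XsubC => -[//].
pose s2 := [seq x j | j <- iota 0 9].
have urs' : uniq (map f rs) by rewrite map_inj_uniq //; apply: fmorph_inj.
have sub : {subset map f rs <= s2}.
  by move=> _ /mapP[r /xs[j ->] ->]; apply: map_f; rewrite mem_iota /= ltn_ord.
have sz2 : (size s2 <= size (map f rs))%N by rewrite !size_map size_iota szrs.
have [_ eqs] := uniq_min_size urs' sub sz2.
have us2 : uniq s2 by apply: leq_size_uniq urs' sub sz2.
exists rs; split => // [i|i j].
  have : x (i %% 9)%N \in s2 by apply: map_f; rewrite mem_iota /= ltn_pmod.
  by rewrite -eqs => /mapP[r rsr Dr]; exists r; rewrite // -Dr resolvent_mod.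
rewrite -(resolvent_mod i) -(resolvent_mod j) => xij.
have nthx k : (k < 9)%N -> nth 0 s2 k = x k.
  by move=> lk; rewrite (nth_map 0%N) ?size_iota // nth_iota.
apply/eqP; rewrite -(nth_uniq 0 _ _ us2) ?size_map ?size_iota ?ltn_pmod //.
by rewrite !nthx ?ltn_pmod // xij.
Qed.

(** g acts on E only, whereas zeta, epsilon, rho and eta lie in [algC]; it is extended along f to an
    endomorphism of [algC], to which [aut_resolvent] applies. *)
Lemma gal_shift (g : gal_of E) : g \in 'Gal(E / K)%g ->
  exists c, forall r i, r \in E -> f r = x i -> f (g r) = x (i + c)%N.
Proof.
move=> Gg; have [nu nuE] := extend_algC_subfield_aut f (gal_repr g).
have gK v : v \in K -> nu (f v) = f v.
  by move=> Kv; rewrite -nuE; congr (f _); apply: (fixed_gal sKE Gg).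
have char0 : [pchar algC] =i pred0 by apply: pchar_num.
have dne : (z ^+ 3 - z ^+ 6) * (2 * m.1 - (t%:~R - 1)) != 0.
  rewrite hfd fmorph_eq0; apply/eqP => d0; have := discriminant_lt0.
  by move/eqP: hd; rewrite d0 expr0n /= eq_sym alg_int_eq0 => /eqP->; rewrite ltxx.
have tne : (t%:~R : algC) * (t%:~R ^+ 2 - 3 * t%:~R + 9) != 0.
  have -> : (t%:~R : algC) * (t%:~R ^+ 2 - 3 * t%:~R + 9) = (t * (t ^+ 2 - 3 * t + 9))%:~R.
    by rewrite !(rmorphB, rmorphD, rmorphM, rmorphXn) /=; ring.
  by rewrite intr_eq0 t_conductor_neq0.
have [||c hc] := aut_resolvent char0 (rmorph_int nu t) hz hs tne dne.
- by rewrite hfd gK.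
- by rewrite hfy gK.
by exists c => r i Er fr; rewrite nuE fr hc.
Qed.

Lemma cyclic_nonic : cyclic 'Gal(E / K)%g.
Proof.
have [rs [gE rsx xrs xinj]] := roots_resolvents.
have Ers r : r \in rs -> r \in E by move=> rsr; rewrite -gE; apply: seqv_sub_adjoin.
have [r0 rs0 fr0] := xrs 0%N.
pose phi (g : gal_of E) : 'Z_9 := odflt ord0 [pick j : 'I_9 | f (g r0) == x j].
have xD i j k : x i = x j -> x (i + k)%N = x (j + k)%N.
  move/xinj => ij; rewrite -(resolvent_mod (i + k)) -(resolvent_mod (j + k)).
  by rewrite -(modnDml i) ij modnDml.
have phiE (g : gal_of E) : g \in 'Gal(E / K)%g ->
    forall r i, r \in E -> f r = x i -> f (g r) = x (i + phi g)%N.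
  move=> Gg r i Er fr; have [c hc] := gal_shift Gg; rewrite (hc r i) //.
  rewrite addnC [in RHS]addnC; apply: xD.
  have fc : f (g r0) = x c by rewrite (hc r0 0%N) ?Ers.
  rewrite /phi -fc; case: pickP => [j /eqP <- //|/(_ (inord (c %% 9)))].
  by rewrite inordK ?ltn_pmod // resolvent_mod fc eqxx.
have Er0 := Ers _ rs0.
have phi0 (g : gal_of E) : g \in 'Gal(E / K)%g -> f (g r0) = x (phi g).
  by move=> Gg; rewrite (phiE g Gg r0 0%N).
have phiM : {in 'Gal(E / K)%g &, {morph phi : g g' / (g * g')%g}}.
  move=> g g' Gg Gg'; apply: val_inj => /=.
  have /xinj <- : x (phi (g * g')%g) = x (phi g + phi g')%N.
    by rewrite -phi0 ?groupM // galM // (phiE g' Gg' _ (phi g)) ?memv_gal // phi0.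
  by rewrite modn_small // ltn_ord.
pose phi_m := Morphism phiM.
have inj_phi : ('injm phi_m)%g.
  apply/injmP => g g' Gg Gg' /= eq_phi; apply/eqP/gal_eqP => v Ev.
  have Gq : (g * g'^-1)%g \in 'Gal(E / K)%g by rewrite groupM ?groupV.
  have phi_q : phi (g * g'^-1)%g = 1%g.
    by apply: (mulIg (phi g')); rewrite -phiM // mulgKV mul1g.
  suff fixq : (E <= fixedSpace (gal_repr (g * g'^-1)%g))%VS.
    by rewrite -[in LHS](mulgKV g' g) galM // (fixedSpaceP (subvP fixq v Ev)).
  suff : (<<K & rs>> <= fixedSpace (gal_repr (g * g'^-1)%g))%VS by rewrite gE.
  apply/Fadjoin_seqP; split.
    by apply/subvP => w Kw; apply/fixedSpaceP/(fixed_gal sKE Gq).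
  move=> r rsr; apply/fixedSpaceP/(fmorph_inj f); have [i fr] := rsx r rsr.
  by rewrite (phiE _ Gq r i) ?Ers // phi_q addn0 fr.
rewrite -(injm_cyclic inj_phi) //; apply: cyclicS (subsetT _) _.
by apply/cyclicP; exists (Zp1 : 'Z_9); apply: (Zp_cycle 8).
Qed.

End Roots.

(** The criterion is applied to the image of E in an ambient field that also contains zeta, epsilon,
    rho and eta. This image lies in F because its generators, the roots of the nonic, are
    resolvents. *)
Lemma unramified_nonic : unramified_finite K E.
Proof.
have [f _] := algC_embedding L.
have [z [m [h [hz hs hfd hfy]]]] := kummer_data f hd hy.
have [L' [j [i [ji jz]]]] := common_splitting_field f [:: z; m.1; m.2; h].
have [z' Dz] := jz z (mem_head _ _).
have [e' De] : exists v, j v = m.1 by apply: jz; rewrite !inE eqxx ?orbT.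
have [r' Dr] : exists v, j v = m.2 by apply: jz; rewrite !inE eqxx ?orbT.
have [h' Dh] : exists v, j v = h by apply: jz; rewrite !inE eqxx ?orbT.
pose m' := (e', r').
have Dm : (j m'.1, j m'.2) = m by rewrite /= De Dr -surjective_pairing.
have jt : j t%:~R = t%:~R by rewrite rmorph_int.
have hz' : 9.-primitive_root z' by rewrite -(fmorph_primitive_root j) Dz.
have hs' : kummer_state t%:~R (m', h').
  by apply/(rmorph_kummer_state jt); rewrite [(m', h').1]/= Dm /= Dh.
have Dd : (z' ^+ 3 - z' ^+ 6) * (2 * m'.1 - (t%:~R - 1)) = i d.
  apply: (fmorph_inj j); rewrite ji -hfd -Dz -De.
  by rewrite -jt /=; ring.
have Dy : cubic_root t%:~R z' m' = i y.
  by apply: (fmorph_inj j); rewrite ji -hfy -Dz -Dm (rmorph_cubic_root jt).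
apply: (@unramified_finite_image _ _ i).
have Kd' : (z' ^+ 3 - z' ^+ 6) * (2 * m'.1 - (t%:~R - 1)) \in (i @: K)%AS by rewrite Dd memv_aimg.
have Ky' : cubic_root t%:~R z' m' \in (i @: K)%AS by rewrite Dy memv_aimg.
have [rs Drs gE] := hE.
have Drs' : map_poly (in_alg L') (nonic_poly t) %= \prod_(r <- map i rs) ('X - r%:P).
  move: Drs; rewrite -(eqp_map i) -map_poly_comp.
  rewrite (eq_map_poly (g := in_alg L')) => [|a]; last by rewrite /= linearZ rmorph1.
  rewrite (_ : map_poly i _ = \prod_(r <- map i rs) ('X - r%:P)) //.
  rewrite rmorph_prod big_map; apply: eq_bigr => r _.
  exact: map_polyXsubC.
have sE' : splittingFieldFor (i @: K)%AS (map_poly (in_alg L') (nonic_poly t)) (i @: E)%AS.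
  by exists (map i rs); rewrite //= -aimg_adjoin_seq gE.
apply: (unramified_of_unit_difference (F := <<(i @: K)%AS & [:: z'; m'.1; m'.2; h']>>%AS)).
- exact: limgS.
- rewrite /= -gE aimg_adjoin_seq; apply/Fadjoin_seqP; split; first exact: subv_adjoin_seq.
  move=> r rsr; have : root (map_poly (in_alg L') (nonic_poly t)) r.
    by rewrite (eqp_root Drs') root_prod_XsubC.
  rewrite /root nonic_polyE (nonic_value_factor _ hs' (unity_root9 hz')).
  move/prodf_eq0 => [k _]; rewrite subr_eq0 => /eqP ->.
  exact: mem_resolvent.
- exact: (galois_kummer_field ht hz' hs' Kd' Ky').
- exact: galois_nonic.
by move=> g Gg ng; apply: (kummer_unit_difference ht hz' hs' Kd' Ky').
Qed.

End Main.

Theorem theorem14 (t : int)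
    (ht : (t = 5 %[mod 27])%Z \/ (t = 10 %[mod 27])%Z)
    (hq : irreducible_poly (cubic_poly t))
    (L : splittingFieldType rat) (y : L)
    (hy : root (map_poly (in_alg L) (cubic_poly t)) y) :
  cyclic_extension 1%AS <<1; y>>%AS
  /\ (irreducible_poly (nonic_poly t) ->
      forall (d : L) (E : {subfield L}),
        d ^+ 2 = (- 3 * (t - 1) ^+ 2 - 12)%:~R ->
        let K := <<1 & [:: d; y]>>%AS in
        splittingFieldFor K (map_poly (in_alg L) (nonic_poly t)) E ->
        cyclic_extension K E /\ unramified_extension K E).
Proof.
split; first exact: cyclic_cubic ht hq hy.
move=> hn d E hd K hE.
have sKE : (K <= E)%VS by case: hE => rs _ <-; apply: subv_adjoin_seq.
split; last split => //.
- split; first exact: galois_nonic hn _ _ _ hE.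
  have [f _] := algC_embedding L.
  have [z [m [h [hz hs hfd hfy]]]] := kummer_data f hd hy.
  exact: (cyclic_nonic ht hn hd hE hz hs hfd hfy).
- exact: (unramified_nonic ht hy hn hd hE).
apply: unramified_infinite_imaginary sKE _ hd (discriminant_lt0 _).
by apply: seqv_sub_adjoin; rewrite mem_head.
Qed.
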